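(* Let $P$ be a bicyclic $2$-group. If the commutator subgroup $P'$ is not cyclic, then every saturated fusion system on $P$ is nilpotent.
   Context: A group $P$ is bicyclic if $P=\langle x\rangle\langle y\rangle$ for some $x,y\in P$. A saturated fusion system $\mathcal{F}$ on $P$ is nilpotent if $\mathcal{F}=\mathcal{F}_P(P)$, i.e. all morphisms are induced by conjugation by elements of $P$. *)

(* Defs.v *)
From mathcomp Require Import all_boot all_fingroup all_solvable.
Set Implicit Arguments. Unset Strict Implicit. Unset Printing Implicit Defensive.
Local Open Scope group_scope.

Definition bicyclic (gT : finGroupType) (P : {set gT}) : Prop :=
  exists x y : gT, P = <[x]> * <[y]>.

(* A fusion system on S is encoded as a predicate F Q f meaning:
   "the restriction of f : gT -> gT to Q is a morphism in Hom_F(Q, S)".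
   Hom_F(Q, R) is then { f | F Q f && f @: Q \subset R }. *)
Section Fusion.
Variables (gT : finGroupType) (S : {group gT}).
Implicit Type F : {set gT} -> pred (gT -> gT).

Record fusion_system F : Prop := {
  fs_ext : forall Q f g, F Q f -> {in Q, f =1 g} -> F Q g;
  fs_hom : forall Q f, F Q f ->
    [/\ group_set Q, Q \subset S, {in Q &, {morph f : x y / x * y}},
        {in Q &, injective f} & f @: Q \subset S];
  fs_conj : forall (Q : {group gT}) g, Q \subset S -> g \in S ->
    F Q (fun x => x ^ g);
  fs_comp : forall Q f h, F Q f -> F (f @: Q) h -> F Q (fun x => h (f x));
  fs_restr : forall (Q R : {group gT}) f, F Q f -> R \subset Q -> F R f;
  fs_inv : forall Q f, F Q f ->
    exists h, F (f @: Q) h /\ {in Q, forall x, h (f x) = x}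
}.

Definition Fconjugate F (Q Q' : {set gT}) : Prop :=
  exists f, F Q f /\ f @: Q = Q'.

Definition fully_normalized F (Q : {set gT}) : Prop :=
  forall Q', Fconjugate F Q Q' -> #|'N_S(Q')| <= #|'N_S(Q)|.

Definition fully_centralized F (Q : {set gT}) : Prop :=
  forall Q', Fconjugate F Q Q' -> #|'C_S(Q')| <= #|'C_S(Q)|.

Definition AutF F (Q : {set gT}) : {set {perm gT}} :=
  [set a in Aut Q | F Q (fun x => a x)].

Definition AutS (Q : {group gT}) : {set {perm gT}} :=
  conj_aut Q @* 'N_S(Q).

(* N_phi = { g in N_S(Q) | phi c_g phi^-1 \in Aut_S(phi(Q)) } *)
Definition Nphi (Q : {set gT}) (f : gT -> gT) : {set gT} :=
  [set g in 'N_S(Q) |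
     [exists h in 'N_S(f @: Q), [forall x in Q, f (x ^ g) == f x ^ h]]].

(* Saturation (Broto-Levi-Oliver / Aschbacher-Kessar-Oliver axioms) *)
Definition saturated_fusion_system (p : nat) F : Prop :=
  fusion_system F /\
  (forall Q : {group gT}, Q \subset S -> fully_normalized F Q ->
     fully_centralized F Q /\ p.-Sylow(AutF F Q) (AutS Q)) /\
  (forall (Q : {group gT}) f, F Q f -> fully_centralized F (f @: Q) ->
     exists fb, F (Nphi Q f) fb /\ {in Q, fb =1 f}).

Definition nilpotent_fusion F : Prop :=
  forall Q : {group gT}, Q \subset S -> forall f : gT -> gT,
    F Q f = [exists g in S, [forall x in Q, f x == x ^ g]].

End Fusion.

(* Main.v *)
Require Import Defs.
From mathcomp Require Import all_boot all_fingroup all_solvable.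
Set Implicit Arguments. Unset Strict Implicit. Unset Printing Implicit Defensive.
Local Open Scope group_scope.

(* By downward induction on [#|Q|], the Sylow and extension axioms reduce nilpotency to
   the following: if [Q] contains ['C_P(Q)], [X] is a group of automorphisms of [Q] with
   Sylow 2-subgroup [S = Aut_P(Q)], and [S :&: S :^ x] lies in [Inn(Q)] for all [x] in
   [X] outside [S], then [X = S].
   Suppose not.  As ['Phi(P)] is metacyclic, [Q / 'Phi(Q)] has order at most 8; the
   action on it forces [S] to have order 2 modulo [Inn(Q)], so some [a] in [X] of odd
   order is inverted by an element of [S].  Then [K = [Q, a]] is abelian of rank 2 or
   quaternion of order 8, [Q = K C] with [C = C_Q(a)], and [Q / K] is cyclic.
   On the other hand [P'] is abelian and noncyclic, and every [w] outside ['Phi(P)] with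
   [w ^+ 2] in ['Z(P)] inverts [P'].  Comparing the positions of [P'] and of its
   subgroup ['Ohm_1(P')] with that of [Q] contradicts each possible shape of [K].
   For [Q = P], an automorphism of odd order centralizes [P' / 'Phi(P')], on which [P]
   acts nontrivially, and is therefore trivial. *)

(** The condition on [S :&: S :^ x] is the extension axiom read backwards: if an automorphism
    conjugates an element of [Aut_P(Q)] outside [Inn(Q)] back into [Aut_P(Q)], its extension domain
    is larger than [Q], and on larger subgroups all morphisms are already conjugations. The bound 8
    arises because ['Phi(P)] is metacyclic, so that its subgroups need at most two generators, while
    [Q :&: 'Phi(P)] has index at most 2 in [Q]. The same rank bound supplies a recurrent
    contradiction: an elementary abelian subgroup of order 8 inside ['Phi(P)]. The odd-order [a]
    appears because two conjugate involutions modulo [Inn(Q)] generate a dihedral group; its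
    inversion by an element of ['N_P(Q)] is what keeps [[Q, a]] at rank 2. Finally, an element [w]
    outside ['Phi(P)] with central square is sought in each case because [[~ w, d] = d ^+ 2] for [d]
    in [P']: commutators with [w] then tell ['Phi(P')] apart from the rest of [P']. *)

(* Ito's theorem *)
Lemma der1_mul_abelian (gT : finGroupType) (A B P : {group gT}) :
  abelian A -> abelian B -> A * B = P -> abelian P^`(1).
Proof.
move=> cAA cBB defP.
have defP' : B * A = P.
  by rewrite -defP; apply/esym/comm_group_setP; rewrite defP groupP.
have sAP : A \subset P by rewrite -defP mulG_subl.
have sBP : B \subset P by rewrite -defP mulG_subr.
have cJ (H : {group gT}) u v : abelian H -> u \in H -> v \in H -> u ^ v = u.
  by move=> cHH Hu Hv; rewrite /conjg (centsP cHH u) ?mulKg.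
have cR (H : {group gT}) u v : abelian H -> u \in H -> v \in H -> [~ u, v] = 1.
  by move=> cHH Hu Hv; apply/eqP/commgP; apply: (centsP cHH).
(* Factoring [b ^ a1] in [A * B] and [a ^ b1] in [B * A] discards commuting factors, and both orders
   of conjugation end in [[~ a3, b2]]. Taken at the inverses of [a1] and [b1], this says that
   [[~ a1, b1]] centralizes [[~ a, b]]. *)
have comm a b a1 b1 : a \in A -> b \in B -> a1 \in A -> b1 \in B ->
    [~ a, b] ^ (a1 * b1) = [~ a, b] ^ (b1 * a1).
  move=> Aa Bb Aa1 Bb1.
  have: b ^ a1 \in A * B.
    by rewrite defP groupJ // ?(subsetP sAP a1) ?(subsetP sBP b).
  case/mulsgP=> a2 b2 Aa2 Bb2 Eb.
  have: a ^ b1 \in B * A.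
    by rewrite defP' groupJ // ?(subsetP sAP a) ?(subsetP sBP b1).
  case/mulsgP=> b3 a3 Bb3 Aa3 Ea.
  transitivity [~ a3, b2].
    rewrite conjgM conjRg (cJ A a) // Eb commgMJ (cR A a a2) // conj1g mulg1.
    by rewrite conjRg Ea (cJ B b2) // commMgJ (cR B b3) // conj1g mul1g.
  rewrite conjgM conjRg (cJ B b) // Ea commMgJ (cR B b3) // conj1g mul1g.
  by rewrite conjRg Eb (cJ A a3) // commgMJ (cR A a3 a2) // conj1g mulg1.
have sP'R : P^`(1) \subset [~: A, B].
  have [sRP nRP] : [~: A, B] \subset P /\ P \subset 'N([~: A, B]).
    split; first by apply: subset_trans (commgSS sAP sBP) (der_subS 0 _).
    by rewrite -defP mul_subG ?(commg_norml, commg_normr).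
  apply: der1_min => //; rewrite -defP quotientMl ?(subset_trans sAP) //.
  by rewrite abelianM !quotient_abelian //= quotient_cents2r // commGC.
apply: abelianS sP'R _; rewrite abelian_gen.
apply/centsP=> _ /imset2P[a b Aa Bb ->] _ /imset2P[a1 b1 Aa1 Bb1 ->].
have := comm a b a1^-1 b1^-1 Aa Bb (groupVr Aa1) (groupVr Bb1).
have -> : [~ a1, b1] = (a1^-1 * b1^-1) * (b1^-1 * a1^-1)^-1.
  by rewrite commgEl /conjg invMg !invgK !mulgA.
by move=> E; apply/commgP/conjg_fixP; rewrite conjgM E -conjgM mulgV conjg1.
Qed.

(** * Metacyclicity of the Frattini subgroup of a bicyclic 2-group *)

Lemma metacyclic_gen2 (gT : finGroupType) (G : {group gT}) (u v : gT) :
  <[u]> <| G -> <[u]> <*> <[v]> = G -> metacyclic G.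
Proof.
move=> nuG defG; apply/metacyclicP; exists <[u]>%G.
rewrite cycle_cyclic nuG; split=> //.
have sv : <[v]> \subset G by rewrite -defG joing_subr.
have nv : <[v]> \subset 'N(<[u]>) by apply: subset_trans sv (normal_norm nuG).
by rewrite -defG quotientYidl // quotient_cyclic // cycle_cyclic.
Qed.

Lemma proper_cyclic_sub_Phi (gT : finGroupType) (p : nat) (G H : {group gT}) :
  p.-group G -> cyclic G -> H \proper G -> H \subset 'Phi(G).
Proof.
move=> pG cycG prHG; have [eqHG | [M maxM sHM]] := maximal_exists (proper_sub prHG).
  by rewrite -eqHG properxx in prHG.
suff -> : 'Phi(G) = M by [].
have ntG : G :!=: 1 by apply: contraTneq prHG => ->; rewrite /proper sub1G andbF.
have [p_pr _ _] := pgroup_pdiv pG ntG.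
have iM : #|G : M| = p := p_maximal_index pG maxM.
have sPM : 'Phi(G) \subset M := Phi_sub_max maxM.
have iP : #|G : 'Phi(G)| = p.
  rewrite -card_quotient ?gFnorm //.
  apply: (cyclic_abelem_prime (Phi_quotient_abelem pG)).
    exact: quotient_cyclic.
  by rewrite -subG1 quotient_sub1 ?gFnorm // proper_subn // Phi_proper.
apply/eqP; rewrite eqEcard sPM /=.
rewrite -(leq_pmul2r (prime_gt0 p_pr)) -{1}iM -iP !Lagrange ?Phi_sub //.
by have /maxgroupP[] := maxM => /proper_sub.
Qed.

Lemma cyclic_quotient_gen (gT : finGroupType) (G L : {group gT}) :
  L <| G -> cyclic (G / L) -> exists2 y, y \in G & L * <[y]> = G.
Proof.
move=> nLG /cyclicP[yb defyb]; have : yb \in G / L by rewrite defyb cycle_id.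
case/morphimP=> y Ny Gy Ey; exists y => //.
by rewrite -quotientK ?cycle_subG // quotient_cycle // -Ey -defyb quotientGK.
Qed.

(** Let [L] be the preimage of a cyclic normal subgroup of [G / N] with cyclic quotient, and [G = L
    * <[y]>]. Being cyclic over the central [N], [L] is abelian, so commutation with [y] is a
    homomorphism on [L] killing [N], and its image is cyclic and contains [G']. Properness of [N] in
    [G'] then puts [N] inside ['Phi(G')], hence inside ['Phi(L)], and cyclicity lifts from [L / N]
    to [L]. *)
Lemma metacyclic_central_quotient (gT : finGroupType) (p : nat) (G N : {group gT}) :
  p.-group G -> N \subset 'Z(G) -> N \proper G^`(1) -> metacyclic (G / N) ->
  metacyclic G.
Proof.
move=> pG sNZ prN /metacyclicP[Lb [cycLb nLb cycGLb]].
have nNG : N <| G := sub_center_normal sNZ.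
have [L defLb sNL nLG] := inv_quotientN nNG nLb.
rewrite defLb in cycLb cycGLb.
have sLG := normal_sub nLG.
have cLL : abelian L.
  apply: cyclic_factor_abelian cycLb; rewrite subsetI sNL.
  by rewrite (subset_trans sNZ) // subIset // (centS sLG) orbT.
have cycGL : cyclic (G / L) by rewrite -(isog_cyclic (third_isog sNL nNG nLG)).
have [y Gy defG] := cyclic_quotient_gen nLG cycGL.
have [l Ll defL] := cyclic_quotient_gen (normalS sNL sLG nNG) cycLb.
have hom m n : m \in L -> n \in L -> [~ m * n, y] = [~ m, y] * [~ n, y].
  move=> Lm Ln; have Rm : [~ m, y] \in L.
    by rewrite commgEl groupM ?groupV // memJ_norm // (subsetP (normal_norm nLG)).
  by rewrite commMgJ /conjg [_ * n](centsP cLL _ Rm) ?mulKg.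
have homX m k : m \in L -> [~ m ^+ k, y] = [~ m, y] ^+ k.
  move=> Lm; elim: k => [|k IH]; first by rewrite !expg0 comm1g.
  by rewrite !expgS hom ?groupX // IH.
have N1 n : n \in N -> [~ n, y] = 1.
  move=> /(subsetP sNZ)/setIP[_ cn]; apply/eqP/commgP.
  by rewrite /commute (centP cn).
have inD m : m \in L -> [~ m, y] \in <[[~ l, y]]>.
  rewrite -defL => /mulsgP[n _ Nn /cycleP[k ->] ->].
  have Ln := subsetP sNL _ Nn.
  by rewrite (hom n) ?groupX // (N1 n) // mul1g homX // mem_cycle.
have Rl : [~ l, y] \in L.
  by rewrite commgEl groupM ?groupV // memJ_norm // (subsetP (normal_norm nLG)).
have sDL : <[[~ l, y]]> \subset L by rewrite cycle_subG.
have nD : G \subset 'N(<[[~ l, y]]>).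
  rewrite -defG mul_subG //; first by rewrite cents_norm // (subset_trans cLL) ?centS.
  rewrite cycle_subG; apply/normP; apply/eqP; rewrite eqEcard cardJg leqnn andbT.
  by rewrite -cycleJ cycle_subG conjRg {2}/conjg mulKg inD // memJ_norm // (subsetP (normal_norm nLG)).
have sG'D : G^`(1) \subset <[[~ l, y]]>.
  apply: der1_min => //; rewrite -defG quotientMl ?(subset_trans sLG) //.
  rewrite abelianM !quotient_abelian ?cycle_abelian //= quotient_cents2r //.
  rewrite commGC gen_subG; apply/subsetP=> _ /imset2P[m _ Lm /cycleP[k ->] ->].
  elim: k => [|k IH]; first by rewrite commg1.
  by rewrite expgSr commgMJ groupM ?inD // memJ_norm // (subsetP nD).
have cycG' : cyclic G^`(1) := cyclicS sG'D (cycle_cyclic _).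
have sNPhi : N \subset 'Phi(L).
  apply: subset_trans (proper_cyclic_sub_Phi (pgroupS (der_sub 1 G) pG) cycG' prN) _.
  exact: PhiS (pgroupS sLG pG) (subset_trans sG'D sDL).
have cycL : cyclic L.
  apply: Phi_quotient_cyclic.
  have nNL : N <| L := normalS sNL sLG nNG.
  have := quotient_cyclic ('Phi(L) / N) cycLb.
  by rewrite (isog_cyclic (third_isog sNPhi nNL (Phi_normal L))).
by apply/metacyclicP; exists L.
Qed.

Lemma expg_odd (gT : finGroupType) (x : gT) n :
  odd n -> exists m, x ^+ n = (x ^+ 2) ^+ m * x.
Proof.
move=> on; exists n./2; rewrite -expgM -expgSr mulnC muln2.
by rewrite -[n in LHS]odd_double_half on.
Qed.

(** If [x ^+ i * y ^+ j] lies in ['Phi(P)] with [i] odd, then [x] lies in ['Phi(P) <*> <[y]>], which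
    forces [P = <[y]>]; likewise for [j]. Only even exponents survive. *)
Lemma Phi_mul_cycles (gT : finGroupType) (P : {group gT}) x y :
  2.-group P -> <[x]> * <[y]> = P -> ~~ cyclic P ->
  'Phi(P) = <[x ^+ 2]> * <[y ^+ 2]>.
Proof.
move=> pP defP ncycP.
have Px : x \in P by rewrite -defP (subsetP (mulG_subl _ _)) ?cycle_id.
have Py : y \in P by rewrite -defP (subsetP (mulG_subr _ _)) ?cycle_id.
have sub (J : {group gT}) : x \in J -> y \in J -> P \subset J.
  by move=> Jx Jy; rewrite -defP mul_subG ?cycle_subG.
have sq z : z \in P -> z ^+ 2 \in 'Phi(P).
  move=> Pz; rewrite (Phi_joing pP) mem_gen // inE orbC (MhoE 1 pP) mem_gen //.
  by apply/imsetP; exists z.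
have gen z : z \in P -> ~~ ('Phi(P) <*> <[z]> == P).
  move=> Pz; apply: contra ncycP => /eqP/Phi_nongen <-; rewrite genGid; exact: cycle_cyclic.
have evenx i j : x ^+ i * y ^+ j \in 'Phi(P) -> ~~ odd i.
  move=> Phi_ij; apply/negP=> oi; case/negP: (gen y Py).
  rewrite eqEsubset join_subG Phi_sub cycle_subG Py /=.
  have [m Em] := expg_odd x oi.
  have Jx : x \in 'Phi(P) <*> <[y]>.
    rewrite -(groupMl _ (x := (x ^+ 2) ^+ m)).
      have Jy : y ^+ j \in 'Phi(P) <*> <[y]>.
        by rewrite (subsetP (joing_subr _ _)) // mem_cycle.
      by rewrite -Em -(groupMr _ Jy) (subsetP (joing_subl _ _)).
    by rewrite (subsetP (joing_subl _ _)) // groupX ?sq.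
  by apply: sub => //; rewrite (subsetP (joing_subr _ _)) ?cycle_id.
have eveny i j : x ^+ i * y ^+ j \in 'Phi(P) -> ~~ odd j.
  move=> Phi_ij; apply/negP=> oi; case/negP: (gen x Px).
  rewrite eqEsubset join_subG Phi_sub cycle_subG Px /=.
  have [m Em] := expg_odd y oi.
  have Jx : y \in 'Phi(P) <*> <[x]>.
    rewrite -(groupMl _ (x := (y ^+ 2) ^+ m)).
      have Jx : x ^+ i \in 'Phi(P) <*> <[x]>.
        by rewrite (subsetP (joing_subr _ _)) // mem_cycle.
      by rewrite -Em -(groupMl _ Jx) (subsetP (joing_subl _ _)).
    by rewrite (subsetP (joing_subl _ _)) // groupX ?sq.
  by apply: sub => //; rewrite (subsetP (joing_subr _ _)) ?cycle_id.
apply/eqP; rewrite eqEsubset mul_subG ?cycle_subG ?sq // andbT.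
apply/subsetP=> g Phi_g; have := subsetP (Phi_sub P) g Phi_g.
rewrite -defP => /mulsgP[_ _ /cycleP[i ->] /cycleP[j ->] Eg].
rewrite Eg in Phi_g *.
rewrite -(odd_double_half i) -(odd_double_half j).
rewrite (negbTE (evenx _ _ Phi_g)) (negbTE (eveny _ _ Phi_g)) !add0n.
by rewrite -!mul2n !expgM mem_mulg ?mem_cycle.
Qed.

Lemma cycle_expg_odd (gT : finGroupType) (z : gT) n :
  2.-elt z -> odd n -> <[z ^+ n]> = <[z]>.
Proof.
move=> p2z on; apply/esym/eqP; rewrite -/(generator _ _) generator_coprime.
by case/p_natP: p2z => k ->; rewrite coprimeXl // coprime2n.
Qed.

Lemma order_gt2_dvd4 (gT : finGroupType) (z : gT) : 2.-elt z -> 2 < #[z] -> 4 %| #[z].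
Proof.
by case/p_natP=> [[|[|k]]] -> //; rewrite !expnS mulnA dvdn_mulr.
Qed.

(* Let [c] generate [G^`(1)].  If [c] is a square in [G], a cyclic subgroup of maximal order
   among those containing [c] is normal with cyclic quotient.  Otherwise [P] centralizes
   [x ^+ 4] and [y ^+ 4], and then each possible value of [(x ^+ 2) ^ y] makes [c] a square. *)
Lemma metacyclic_Phi_der1_2 (gT : finGroupType) (P G : {group gT}) x y :
  2.-group P -> x \in P -> y \in P -> G <| P -> <[x ^+ 2]> * <[y ^+ 2]> = G ->
  #|G^`(1)| = 2 -> <[x]> <*> <[y]> = P -> metacyclic G.
Proof.
move=> pP Px Py nGP; move Ea: (x ^+ 2) => a; move Eb: (y ^+ 2) => b defG oG' defP.
have sGP := normal_sub nGP; have pG := pgroupS sGP pP.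
have Ga : a \in G by rewrite -defG (subsetP (mulG_subl _ _)) ?cycle_id.
have Gb : b \in G by rewrite -defG (subsetP (mulG_subr _ _)) ?cycle_id.
have joinG : <[a]> <*> <[b]> = G by rewrite -genM_join defG genGid.
have sG'Z : G^`(1) \subset 'Z(P).
  have nG'P : G^`(1) <| P := char_normal_trans (der_char 1 G) nGP.
  apply: prime_meetG; first by rewrite oG'.
  by rewrite meet_center_nil ?(pgroup_nil pP) // -cardG_gt1 oG'.
move Ec : [~ a, b] => c; have G'c : c \in G^`(1) by rewrite -Ec mem_commg.
have cP g : g \in P -> commute c g.
  by move=> Pg; case/setIP: (subsetP sG'Z _ G'c) => _ /centP; apply.
have cG g : g \in G -> commute c g by move/(subsetP sGP); apply: cP.
have G'E : G^`(1) = <[c]>.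
  rewrite -{1}joinG der1_joing_cycles Ec //; apply/centP=> g; rewrite joinG; exact: cG.
have oc : #[c] = 2 by rewrite -oG' G'E.
have c2 : c ^+ 2 = 1 by rewrite -oc expg_order.
have nc1 : c != 1 by rewrite -order_gt1 oc.
have abC : a * b = b * a * c by rewrite -Ec; apply: commgC.
have Za g : g \in G -> commute (a ^+ 2) g.
  move=> Gg; have Cab : commute (a ^+ 2) b.
    by apply/commgP; rewrite commXg Ec ?c2 //; apply/commute_sym/cG.
  rewrite -defG in Gg; case/mulsgP: Gg => _ _ /cycleP[i ->] /cycleP[j ->] ->.
  by apply: commuteM; [apply: commuteX2 | apply: commuteX].
have Zb g : g \in G -> commute (b ^+ 2) g.
  move=> Gg; have Cab : commute (b ^+ 2) a.
    apply/commute_sym/commgP; rewrite commgX Ec ?c2 //; apply/commute_sym/cG => //.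
  rewrite -defG in Gg; case/mulsgP: Gg => _ _ /cycleP[i ->] /cycleP[j ->] ->.
  by apply: commuteM; [apply: commuteX | apply: commuteX2].
have ZG k l : (a ^+ 2) ^+ k * (b ^+ 2) ^+ l \in G by apply: groupM; rewrite !groupX.
have ZC k l g : g \in G -> commute ((a ^+ 2) ^+ k * (b ^+ 2) ^+ l) g.
  move=> Gg; apply/commute_sym; apply: commuteM; apply/commuteX/commute_sym; auto.
(* The squares of [a] and [b] are central in [G] because [c] has order 2, so every element is a
   central one times [1], [a], [b] or [a * b]. *)
have dec g : g \in G -> exists k l (e d : bool),
    g = (a ^+ 2) ^+ k * (b ^+ 2) ^+ l * (a ^+ e * b ^+ d).
  rewrite -defG => /mulsgP[_ _ /cycleP[i ->] /cycleP[j ->] ->].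
  exists i./2, j./2, (odd i), (odd j).
  have -> : a ^+ i = (a ^+ 2) ^+ i./2 * a ^+ odd i.
    by rewrite -expgM -expgD addnC mulnC muln2 odd_double_half.
  have -> : b ^+ j = (b ^+ 2) ^+ j./2 * b ^+ odd j.
    by rewrite -expgM -expgD addnC mulnC muln2 odd_double_half.
  rewrite -!mulgA; congr (_ * _); rewrite !mulgA; congr (_ * _).
  by apply/commute_sym/commuteX/commute_sym/commuteX/commute_sym/Zb.
have abS : (a * b) ^+ 2 = a ^+ 2 * b ^+ 2 * c.
  have baC : b * a = a * b * c.
    by rewrite abC -mulgA -(expgS c 1) c2 mulg1.
  rewrite expgS expg1 -mulgA [b * (a * b)]mulgA baC -!mulgA.
  by rewrite [c * b]cG // !mulgA -[a * a](expgS a 1) -!mulgA [b * (b * c)]mulgA.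
have central_a : ~ (forall g, g \in G -> commute a g).
  by move=> ca; case/negP: nc1; rewrite -Ec; apply/commgP; apply: ca.
have central_b : ~ (forall g, g \in G -> commute b g).
  by move=> cb; case/negP: nc1; rewrite -Ec; apply/commgP; apply/commute_sym; apply: cb.
have central_ab : ~ (forall g, g \in G -> commute (a * b) g).
  move=> cab; apply: central_b => g Gg.
  have := cab a Ga; rewrite /commute -mulgA => /mulgI ba.
  case/negP: nc1; rewrite -Ec; apply/commgP; exact: esym.
have divl z g : (forall h, h \in G -> commute z h) ->
    (forall h, h \in G -> commute (z * g) h) -> forall h, h \in G -> commute g h.
  move=> Cz Czg h Gh; have := Czg h Gh.
  by rewrite /commute mulgA -(Cz h Gh) -!mulgA => /mulgI.
(* None of [a], [b], [a * b] is central, so the two squares generate the centre of [G]. *)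
have decZ g : g \in G -> (forall h, h \in G -> commute g h) -> exists k l,
    g = (a ^+ 2) ^+ k * (b ^+ 2) ^+ l.
  move=> /dec[k [l [e [d ->]]]] Cg; exists k, l.
  have {Cg} := divl _ _ (fun h => ZC k l h) Cg.
  case: e; case: d => /=; rewrite ?expg1 ?expg0 ?mulg1 ?mul1g //.
have sqZ k l : (a ^+ k * b ^+ l) ^+ 2 = (a ^+ 2) ^+ k * (b ^+ 2) ^+ l * c ^+ (k * l).
  have Eba : [~ b, a] = c by rewrite -invg_comm Ec; apply/eqP; rewrite eq_invg_mul -(expgS c 1) c2.
  have Ekl : [~ b ^+ l, a ^+ k] = c ^+ (k * l).
    by rewrite commXXg Eba; [rewrite mulnC | apply/commute_sym/cG | apply/commute_sym/cG].
  rewrite expMg_Rmul Ekl; try by apply/commuteX/commute_sym/cG; rewrite groupX.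
  by rewrite -!expgM !(mulnC _ 2) binn muln1.
have cX n : c ^+ n = c ^+ odd n.
  by rewrite -{1}(odd_double_half n) -mul2n expgD expgM c2 expg1n mulg1.
have [/existsP[g0 /andP[Gg0 /eqP g0c]] | nosq] := boolP [exists g, (g \in G) && (g ^+ 2 == c)].
  pose S := [pred u | (u \in G) && (c \in <[u]>)].
  have S0 : S g0 by rewrite /S /= Gg0 -g0c mem_cycle.
  have [u /andP[Gu cu] maxu] := arg_maxnP (fun u : gT => #[u]) S0.
  have p2 h : h \in G -> 2.-elt h by move=> Gh; apply: mem_p_elt pG Gh.
  have ou : 2 < #[u].
    apply: leq_trans (maxu g0 S0); rewrite ltnNge; apply/negP => le2.
    have : #[g0] %| 2 by case: #[g0] (order_gt0 g0) le2 => [|[|[|]]].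
    by rewrite order_dvdn g0c (negPf nc1).
  have ou4 := order_gt2_dvd4 (p2 u Gu) ou.
  have sG'u : <[u]> <| G.
    by apply: sub_der1_normal; rewrite ?G'E cycle_subG.
  (* The order of [v] is twice that of [v ^+ 2] and at most that of [u], by the choice of [u]. *)
  have lift v : v \in G -> c \in <[v ^+ 2]> -> #[v ^+ 2] < #[u].
    move=> Gv cv; have : #[v] <= #[u].
      by apply: maxu; rewrite /S /= Gv (subsetP (cycleX v 2)).
    apply: leq_trans; rewrite -(ltn_pmul2r (ltn0Sn 1)).
    have : 2 %| #[v].
      move: (p2 v Gv) => /p_natP[[|k] E]; last by rewrite E expnS dvdn_mulr.
      move/eqP: E; rewrite order_eq1 => /eqP v1.
      by move: cv; rewrite v1 expg1n cycle1 inE (negPf nc1).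
    move=> dv; rewrite orderXdiv // divnK // -[X in X < _]muln1 ltn_pmul2l //.
  have sqPhi h : h \in G -> h ^+ 2 \in 'Phi(G).
    move=> Gh; rewrite (Phi_joing pG) mem_gen // inE orbC (MhoE 1 pG) mem_gen //.
    by apply/imsetP; exists h.
  have [k [l [e [d Eu]]]] := dec u Gu.
  have ZPhi : (a ^+ 2) ^+ k * (b ^+ 2) ^+ l \in 'Phi(G).
    by apply: groupM; rewrite groupX ?sqPhi.
  have gen v : v \in G -> a \in 'Phi(G) <*> (<[u]> <*> <[v]>) ->
      b \in 'Phi(G) <*> (<[u]> <*> <[v]>) -> metacyclic G.
    move=> Gv Ja Jb; apply: (metacyclic_gen2 (v := v) sG'u).
    rewrite -[LHS]genGid; apply: Phi_nongen; apply/eqP; rewrite eqEsubset.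
    rewrite !join_subG Phi_sub !cycle_subG Gu Gv /=.
    by rewrite -{1}joinG join_subG !cycle_subG Ja Jb.
  have JP v h : h \in 'Phi(G) -> h \in 'Phi(G) <*> (<[u]> <*> <[v]>).
    by move=> Ph; rewrite (subsetP (joing_subl _ _)).
  have Jv v h : h \in <[v]> -> h \in 'Phi(G) <*> (<[u]> <*> <[v]>).
    by move=> Ph; rewrite (subsetP (joing_subr _ _)) // (subsetP (joing_subr _ _)).
  have Ju v : u \in 'Phi(G) <*> (<[u]> <*> <[v]>).
    by rewrite (subsetP (joing_subr _ _)) // (subsetP (joing_subl _ _)) // cycle_id.
  case: e d Eu => [] [] /=; rewrite ?expg1 ?expg0 ?mulg1 ?mul1g => Eu.
  - apply: (gen b) => //; last by rewrite Jv ?cycle_id.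
    by move: (Ju b); rewrite {1}Eu (groupMl _ (JP b _ ZPhi)) (groupMr _ (Jv b _ (cycle_id b))).
  - apply: (gen b) => //; last by rewrite Jv ?cycle_id.
    by move: (Ju b); rewrite {1}Eu (groupMl _ (JP b _ ZPhi)).
  - apply: (gen a) => //; first by rewrite Jv ?cycle_id.
    by move: (Ju a); rewrite {1}Eu (groupMl _ (JP a _ ZPhi)).
  (* Here [u] is central, so [u] or [u * c] is the square of [a ^+ k * b ^+ l]. As 4 divides the
     order of [u], both have the same order and have [c] among their powers, against [lift]. *)
  have Gkl : a ^+ k * b ^+ l \in G by rewrite groupM ?groupX.
  have := lift _ Gkl; rewrite sqZ -Eu cX; case: (odd (k * l)) => /=; last first.
    by rewrite expg0 mulg1 ltnn => /(_ cu).
  rewrite expg1; have cuc : c \in <[u * c]>.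
    case/cycleP: cu => m Em.
    have em : ~~ odd m.
      have : #[u] %| m * 2 by rewrite order_dvdn expgM -Em c2.
      move/(dvdn_trans ou4); rewrite -[4]/(2 * 2)%N dvdn_pmul2r //.
      by rewrite dvdn2.
    rewrite -(odd_double_half m) (negPf em) add0n -mul2n expgM in Em.
    have Euc : (u * c) ^+ 2 = u ^+ 2.
      by rewrite expgMn ?c2 ?mulg1 //; apply/commute_sym/cG.
    by rewrite -Euc -expgM in Em; apply/cycleP; exists (2 * m./2)%N.
  have -> : #[u * c] = #[u].
    rewrite !orderE; congr #|pred_of_set _|; apply/eqP; rewrite eqEsubset.
    rewrite !cycle_subG groupM ?cycle_id //=.
    by rewrite -(groupMr _ cuc) cycle_id.
  by rewrite ltnn => /(_ cuc).
have {nosq} nosq g : g \in G -> g ^+ 2 <> c.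
  by move=> Gg Eg; case/existsP: nosq; exists g; rewrite Gg Eg eqxx.
(* Both exponents must be odd: otherwise the square of [a ^+ k * b ^+ l] would be [c] itself. *)
have [k [l Ec2]] := decZ c (subsetP (der_sub 1 G) _ G'c) cG.
have [ok ol] : odd k /\ odd l.
  apply/andP; rewrite -oddM; apply/negPn/negP => /negPf nkl.
  case: (nosq (a ^+ k * b ^+ l)); first by rewrite groupM ?groupX.
  by rewrite sqZ cX nkl expg0 mulg1.
(* [x] commutes with [a ^+ 2 = x ^+ 4] and with [c], hence with an odd power of [b ^+ 2], hence with
   [b ^+ 2]; symmetrically for [y]. *)
have ZP g : g \in P -> commute (a ^+ 2) g /\ commute (b ^+ 2) g.
  rewrite -defP => Pg.
  suff: <[x]> <*> <[y]> \subset 'C[a ^+ 2] :&: 'C[b ^+ 2].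
    by move/subsetP/(_ g Pg)=> /setIP[/cent1P Ca /cent1P Cb]; split; apply: commute_sym.
  have Cl u v h m n : commute u h -> commute c h -> 2.-elt v -> odd n ->
      c = u ^+ m * v ^+ n -> commute v h.
    move=> Cu Cc p2v on Ecm; have : v ^+ n = (u ^+ m)^-1 * c by rewrite Ecm mulKg.
    move=> Ev; have Cvn : commute h (v ^+ n).
      rewrite Ev; apply: commuteM; last exact: commute_sym.
      by apply/commuteV/commuteX/commute_sym.
    have : v \in <[v ^+ n]> by rewrite cycle_expg_odd ?cycle_id.
    by case/cycleP=> i ->; apply/commute_sym/commuteX.
  have p2 h : h \in G -> 2.-elt h by move=> Gh; apply: mem_p_elt pG Gh.
  have Ec3 : c = (b ^+ 2) ^+ l * (a ^+ 2) ^+ k.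
    by rewrite Ec2; apply/commuteX/commute_sym/commuteX/commute_sym/Za; rewrite groupX.
  have xa : commute (a ^+ 2) x by rewrite -Ea -expgM; apply/commute_sym/commuteX.
  have yb : commute (b ^+ 2) y by rewrite -Eb -expgM; apply/commute_sym/commuteX.
  rewrite join_subG !cycle_subG; apply/andP; split; apply/setIP; split; apply/cent1P; apply/commute_sym => //.
    by apply: (Cl (a ^+ 2) _ _ k l) => //; [apply: cP | rewrite p2 ?groupX].
  by apply: (Cl (b ^+ 2) _ _ l k) => //; [apply: cP | rewrite p2 ?groupX].
have ZPC i j g : g \in P -> commute ((a ^+ 2) ^+ i * (b ^+ 2) ^+ j) g.
  move=> Pg; have [Ca Cb] := ZP g Pg.
  by apply/commute_sym; apply: commuteM; apply/commuteX/commute_sym.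
have Gay : a ^ y \in G by rewrite memJ_norm // (subsetP (normal_norm nGP)).
have ay2 : (a ^ y) ^+ 2 = a ^+ 2.
  by rewrite -conjXg; apply/conjg_fixP/commgP; case: (ZP y Py).
have [i [j [e [d Eay]]]] := dec _ Gay.
have Cz g : g \in P -> commute ((a ^+ 2) ^+ i * (b ^+ 2) ^+ j) g by apply: ZPC.
have Gz : (a ^+ 2) ^+ i * (b ^+ 2) ^+ j \in G by apply: ZG.
move: Eay Cz Gz; move: (_ ^+ i * _ ^+ j) => z Eay Cz Gz.
(* In the first three cases [c] turns out to be a square, namely of [(z * b)^-1], of [z], and of
   [z ^+ k * b ^+ (k + l)]; in the last, [a] would be central. *)
case: e d Eay => [] [] /=; rewrite ?expg1 ?expg0 ?mulg1 ?mul1g => Eay.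
- move: ay2; rewrite Eay expgMn; last by apply: Cz; rewrite groupM ?(subsetP sGP).
  rewrite abS => E; case: (nosq (z * b)^-1); first by rewrite groupV groupM.
  rewrite expgVn expgMn; last by apply: Cz; rewrite (subsetP sGP).
  have Caz : a ^+ 2 * z ^+ 2 = z ^+ 2 * a ^+ 2 by apply: Za; rewrite groupX.
  have : a ^+ 2 * (z ^+ 2 * b ^+ 2 * c) = a ^+ 2 * 1.
    rewrite mulg1; apply: etrans E.
    move: (z ^+ 2) (b ^+ 2) (a ^+ 2) Caz => z2 b2 a2 Caz.
    by rewrite !mulgA Caz.
  move/mulgI=> E1; apply/eqP; rewrite eq_invg_mul; exact/eqP.
- case: (nosq z Gz).
  have E1 : [~ a, y] = z by rewrite commgEl Eay [z * a](Cz a) ?mulKg // (subsetP sGP).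
  rewrite -Ec -Eb commgX E1; last by apply/commute_sym/Cz.
  by [].
- move: ay2; rewrite Eay expgMn; last by apply: Cz; rewrite (subsetP sGP).
  move=> E; case: (nosq (z ^+ k * b ^+ (k + l))); first by rewrite groupM ?groupX.
  rewrite Ec2 -E expgMn; last by apply/commuteX/commute_sym/commuteX/commute_sym/Cz; rewrite (subsetP sGP).
  rewrite [(z ^+ 2 * _) ^+ k]expgMn; last first.
    by apply/commuteX/commute_sym/commuteX/commute_sym/Cz; rewrite (subsetP sGP).
  by rewrite -!expgM -mulgA -expgD -mulnDr !(mulnC 2).
case: central_a => g Gg.
have Ez : a = z.
  apply: (conjg_inj y); rewrite Eay; apply/esym/conjg_fixP/commgP; exact: Cz.
by rewrite Ez; apply: Cz; rewrite (subsetP sGP).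
Qed.

(** Induction on the order of [P], modulo a central subgroup of order 2 inside the derived subgroup
    of ['Phi(P)]. Metacyclicity lifts by [metacyclic_central_quotient] unless that subgroup is the
    whole derived subgroup, and this exception is [metacyclic_Phi_der1_2]. *)
Lemma metacyclic_Phi_bicyclic (gT : finGroupType) (P : {group gT}) x y :
  2.-group P -> <[x]> * <[y]> = P -> metacyclic 'Phi(P).
Proof.
have [n] := ubnP #|P|; elim: n gT P x y => // n IHn gT P x y ltPn pP defP.
have [cycP | ncycP] := boolP (cyclic P).
  exact: cyclic_metacyclic (cyclicS (Phi_sub P) cycP).
have defG := Phi_mul_cycles pP defP ncycP.
have Px : x \in P by rewrite -defP (subsetP (mulG_subl _ _)) ?cycle_id.
have Py : y \in P by rewrite -defP (subsetP (mulG_subr _ _)) ?cycle_id.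
have joinP : <[x]> <*> <[y]> = P by rewrite -genM_join defP genGid.
have joinG : <[x ^+ 2]> <*> <[y ^+ 2]> = 'Phi(P) by rewrite -genM_join -defG genGid.
have nGP : 'Phi(P) <| P := Phi_normal P.
have nG'P : 'Phi(P)^`(1) <| P := char_normal_trans (der_char 1 _) nGP.
have [G'1 | ntG'] := eqVneq ('Phi(P)^`(1)) 1.
  apply: (metacyclic_gen2 (u := x ^+ 2) (v := y ^+ 2)) => //.
  have sx : <[x ^+ 2]> \subset 'Phi(P) by rewrite -joinG joing_subl.
  by apply: sub_der1_normal; rewrite ?G'1 ?sub1G.
have := meet_center_nil (pgroup_nil pP) nG'P ntG'.
set Z0 := _ :&: _ => ntZ0.
have pZ0 : 2.-group Z0 by apply: pgroupS pP; rewrite subIset // (normal_sub nG'P).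
have [_ dv _] := pgroup_pdiv pZ0 ntZ0.
have [z Z0z oz] := Cauchy (p := 2) isT dv.
have {Z0z} [G'z Zz] := setIP Z0z.
have sNZ : <[z]> \subset 'Z(P) by rewrite cycle_subG.
have nNP : <[z]> <| P := sub_center_normal sNZ.
have sNG' : <[z]> \subset 'Phi(P)^`(1) by rewrite cycle_subG.
have [eqN | neqN] := eqVneq <[z]> 'Phi(P)^`(1).
  by apply: (metacyclic_Phi_der1_2 (P := P) (x := x) (y := y)); rewrite // -eqN -orderE.
apply: (metacyclic_central_quotient (p := 2) (N := <[z]>%G)).
- exact: pgroupS (Phi_sub P) pP.
- rewrite subsetI (subset_trans sNG' (der_sub 1 _)) /=.
  by rewrite (subset_trans sNZ) // subIset // (centS (Phi_sub P)) orbT.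
- by rewrite properEneq neqN.
rewrite (quotient_Phi pP (normal_norm nNP)).
apply: (IHn _ _ (coset <[z]> x) (coset <[z]> y)).
- rewrite ltnS in ltPn; apply: leq_trans ltPn; apply: ltn_quotient (normal_sub nNP).
  by rewrite -cardG_gt1 -orderE oz.
- exact: quotient_pgroup.
have nN := subsetP (normal_norm nNP).
by rewrite -!quotient_cycle ?nN // -quotientMl ?defP // cycle_subG nN.
Qed.

Lemma metacyclic_index_Phi (gT : finGroupType) (G : {group gT}) :
  2.-group G -> metacyclic G -> #|G : 'Phi(G)| <= 4.
Proof.
move=> pG /metacyclicP[H [cycH nHG cycGH]].
have nPG := Phi_normal G; have pPG := Phi_quotient_abelem pG.
rewrite -(card_quotient (normal_norm nPG)).
have small (K : {group gT}) : K \subset G -> cyclic K -> #|K / 'Phi(G)| <= 2.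
  move=> sKG cycK; have [-> | nt] := eqVneq (K / 'Phi(G)) 1; first by rewrite cards1.
  rewrite (cyclic_abelem_prime (p := 2) _ (quotient_cyclic _ cycK)) //.
  by apply: abelemS pPG; rewrite quotientS.
have [y Gy defG] := cyclic_quotient_gen nHG cycGH.
have sHG := normal_sub nHG; have sy : <[y]> \subset G by rewrite cycle_subG.
have -> : G / 'Phi(G) = (H / 'Phi(G)) * (<[y]> / 'Phi(G)).
  by rewrite -quotientMl ?defG // (subset_trans sHG) ?gFnorm.
apply: leq_trans (leq_mul (small H sHG cycH) (small <[y]>%G sy (cycle_cyclic y))).
by rewrite mul_cardG leq_pmulr // cardG_gt0.
Qed.

Lemma coset_eq1 (gT : finGroupType) (H : {group gT}) x :
  x \in 'N(H) -> (coset H x == 1) = (x \in H).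
Proof. by move=> nHx; apply/eqP/idP=> [/coset_idr-> // | /coset_id]. Qed.

Lemma index_le2_mulVg (gT : finGroupType) (K H : {group gT}) x y :
  H \subset K -> #|K : H| <= 2 -> x \in K -> y \in K -> x \notin H -> y \notin H ->
  x^-1 * y \in H.
Proof.
move=> sHK le2 Kx Ky nHx nHy.
have i2 : #|K : H| = 2.
  apply/eqP; rewrite eqn_leq le2 indexg_gt1.
  by apply: contra nHx => /subsetP; apply.
have nHK := index2_normal sHK i2; have nH := subsetP (normal_norm nHK).
have KHz z : z \in K -> z \notin H -> coset H z = coset H x.
  move=> Kz nHz; apply/eqP; apply: contraLR (leqnn 2) => neq.
  rewrite -ltnNge -{2}i2 -(card_quotient (normal_norm nHK)).
  apply: leq_trans (subset_leq_card (A := [set 1; coset H z; coset H x]) _).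
    rewrite -setUA cardsU1 cards2 !inE neq /= negb_or.
    rewrite eq_sym coset_eq1 ?(nH z) // nHz eq_sym coset_eq1 ?(nH x) // nHx //.
  by apply/subsetP=> u; rewrite !inE -orbA => /or3P[] /eqP->; rewrite ?group1 ?mem_quotient.
by rewrite -coset_eq1 ?groupM ?groupV ?nH // morphM ?groupV ?nH // morphV ?nH //= (KHz y) // mulVg.
Qed.

Lemma der1_gen2_sub (gT : finGroupType) (P B : {group gT}) u v :
  <[u]> <*> <[v]> = P -> u \in 'N(B) -> v \in 'N(B) -> [~ u, v] \in B ->
  P^`(1) \subset B.
Proof.
move=> <- nu nv Buv; apply: der1_min; first by rewrite join_subG !cycle_subG nu.
rewrite quotientY ?cycle_subG // abelianY !quotient_abelian ?cycle_abelian //=.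
rewrite !quotient_cycle //; apply/cents_cycle/commgP.
by rewrite -morphR //= coset_id // -invg_comm groupV.
Qed.

(* These records describe [K = [~: Q, <[a]>]] and [C = 'C_Q[a]] for an automorphism [a]
   of [Q] of odd order that is inverted by the conjugation by [t0], without mentioning [a]. *)
Section ActionShape.

Variables (gT : finGroupType) (P Q K C : {group gT}) (t0 : gT).

Record action_split : Prop := ActionSplit {
  split_normal : K <| Q;
  split_sub : C \subset Q;
  split_mul : K * C = Q;
  split_cyclic : cyclic (Q / K);
  split_norm : 'N_P(Q) \subset 'N(K);
  split_mem : t0 \in 'N_P(Q);
  split_notin : t0 \notin Q;
  split_normC : t0 \in 'N(C);
  split_cap : K :&: C \subset 'Phi(K);
  split_act : forall t, t \in 'N_P(Q) -> t \notin Q ->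
    exists2 k, k \in K & [~ k, t] \notin 'Phi(K)
}.

(** [ab_nabelem] serves to build an elementary abelian group of order at least 8 from [U] and an
    involution of [C]. [ab_quadratic] is meant for [t] in [P'], whose action is quadratic because
    [P'] is abelian. *)
Record abelian_shape : Prop := AbelianShape {
  ab_abelian : abelian K;
  ab_cap : K :&: C = 1;
  ab_abelem : 2.-abelem K -> #|K| = 4 /\ C \subset 'C(K);
  ab_nabelem : ~~ 2.-abelem K -> forall i, i \in C -> #[i] = 2 ->
    exists U : {group gT}, [/\ U \subset 'Phi(K), 2.-abelem U, 4 <= #|U| & i \in 'C(U)];
  ab_quadratic : forall t, t \in 'N_P(Q) -> t \notin Q ->
    (forall k, k \in K -> [~ k, t, t] = 1) -> 2.-abelem K
}.

Record quaternion_shape (j : gT) : Prop := QuaternionShape {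
  q8_card : #|K| = 8;
  q8_ord : #[j] = 2;
  q8_cap : K :&: C = <[j]>;
  q8_Phi : 'Phi(K) = <[j]>;
  q8_cent : C \subset 'C(K);
  q8_sqr : forall k, k \in K -> k \notin <[j]> -> k ^+ 2 = j
}.

End ActionShape.

(** * The subgroups [P'], ['Ohm_1(P')] and ['Phi(P)] when [P'] is not cyclic *)

Section NoncyclicDer1.

Variables (gT : finGroupType) (P : {group gT}).
Hypothesis pP : 2.-group P.
Hypothesis bicP : exists x y, <[x]> * <[y]> = P.
Hypothesis ncA : ~~ cyclic P^`(1).

Local Notation A := P^`(1).
Local Notation G := 'Phi(P).
Local Notation E := 'Ohm_1(P^`(1)).

Let sAP : A \subset P := der_sub 1 P.
Let pA : 2.-group A := pgroupS sAP pP.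
Let pG : 2.-group G := pgroupS (Phi_sub P) pP.

Lemma ncyclic_bicyclic : ~~ cyclic P.
Proof. by apply: contra ncA; apply: cyclicS. Qed.

Lemma der1_bicyclic_abelian : abelian A.
Proof.
have [x [y defP]] := bicP.
exact: der1_mul_abelian (cycle_abelian x) (cycle_abelian y) defP.
Qed.
Let cAA := der1_bicyclic_abelian.

Lemma der1_sub_Phi : A \subset G.
Proof. by rewrite (Phi_joing pP) joing_subl. Qed.
Let sAG := der1_sub_Phi.

Lemma sqr_Phi g : g \in P -> g ^+ 2 \in G.
Proof.
move=> Pg; rewrite (Phi_joing pP) mem_gen // inE orbC (MhoE 1 pP) mem_gen //.
by apply/imsetP; exists g.
Qed.

(** Subgroups of the metacyclic group ['Phi(P)] are metacyclic, hence generated by two elements.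
    Only this rank bound is kept of metacyclicity from here on. *)
Lemma index_Phi_sub_Phi (L : {group gT}) : L \subset G -> #|L : 'Phi(L)| <= 4.
Proof.
move=> sLG; have [x [y defP]] := bicP.
apply: metacyclic_index_Phi (pgroupS sLG pG) _.
exact: metacyclicS sLG (metacyclic_Phi_bicyclic pP defP).
Qed.

Lemma card_abelem_Phi (L : {group gT}) : L \subset G -> 2.-abelem L -> #|L| <= 4.
Proof.
move=> sLG abL; have := index_Phi_sub_Phi sLG.
by move: abL; rewrite -(trivg_Phi (pgroupS sLG pG)) => /eqP->; rewrite indexg1.
Qed.

Lemma index_Phi_bicyclic : #|P : G| = 4.
Proof.
have [x [y defP]] := bicP.
have le4 : #|P : G| <= 4.
  rewrite -(card_quotient (gFnorm _ _)).
  have small z : z \in P -> #|<[z]> / G| <= 2.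
    move=> Pz; have [-> | nt] := eqVneq (<[z]> / G) 1; first by rewrite cards1.
    rewrite (cyclic_abelem_prime (p := 2) _ (quotient_cyclic _ (cycle_cyclic z))) //.
    by apply: abelemS (Phi_quotient_abelem pP); rewrite quotientS ?cycle_subG.
  have Px : x \in P by rewrite -defP (subsetP (mulG_subl _ _)) ?cycle_id.
  have Py : y \in P by rewrite -defP (subsetP (mulG_subr _ _)) ?cycle_id.
  have -> : P / G = (<[x]> / G) * (<[y]> / G).
    by rewrite -quotientMl ?defP // cycle_subG (subsetP (gFnorm _ _)).
  apply: leq_trans (leq_mul (small x Px) (small y Py)).
  by rewrite mul_cardG leq_pmulr // cardG_gt0.
have : ~~ (#|P : G| <= 3).
  apply: contra ncyclic_bicyclic => le3; apply: Phi_quotient_cyclic.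
  by apply: cyclic_small; rewrite card_quotient ?gFnorm.
by rewrite -ltnNge => gt3; apply/eqP; rewrite eqn_leq le4.
Qed.
Let iG := index_Phi_bicyclic.

Lemma gen_mod_Phi u v : u \in P -> v \in P -> u \notin G ->
  v \notin G <*> <[u]> -> <[u]> <*> <[v]> = P.
Proof.
move=> Pu Pv nGu nv; rewrite -[LHS]genGid; apply: Phi_nongen.
pose K := (G <*> <[u]>)%G; pose J := (G <*> (<[u]> <*> <[v]>))%G.
have sJP : J \subset P by rewrite !join_subG Phi_sub !cycle_subG Pu Pv.
have sKJ : K \subset J by rewrite join_subG joing_subl (subset_trans (joing_subl _ <[v]>)) ?joing_subr.
have ltG : 1 < #|K : G|.
  rewrite indexg_gt1; apply: contra nGu => /subsetP; apply.
  by rewrite (subsetP (joing_subr _ _)) ?cycle_id.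
have ltK : 1 < #|J : K|.
  rewrite indexg_gt1; apply: contra nv => /subsetP; apply.
  by rewrite (subsetP (joing_subr _ _)) // (subsetP (joing_subr _ _)) ?cycle_id.
have := Lagrange_index sJP (subset_trans (joing_subl G _) sKJ).
rewrite -(Lagrange_index sKJ (joing_subl G _)) iG => E4.
apply/eqP; rewrite eqEsubset sJP -indexg_eq1 /=.
have := indexg_gt0 P J; case: #|P : J| E4 => // [[|n]] // E4 _.
have : n.+2 * 4 <= 4 by rewrite -[X in _ <= X]E4 leq_mul2l (leq_mul ltK ltG) orbT.
by rewrite mulSn -[X in _ <= X]addn0 leq_add2l mulSn.
Qed.

Lemma ex_gen_mod_Phi u : u \in P -> u \notin G ->
  exists2 v, v \in P & <[u]> <*> <[v]> = P.
Proof.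
move=> Pu nGu; have : ~~ (P \subset G <*> <[u]>).
  apply: contra ncyclic_bicyclic => sP; suff <- : << <[u]> >> = P.
    by rewrite genGid cycle_cyclic.
  by apply: Phi_nongen; apply/eqP; rewrite eqEsubset sP join_subG Phi_sub cycle_subG Pu.
by case/subsetPn=> v Pv nv; exists v => //; apply: gen_mod_Phi.
Qed.

(** [w] and [w ^ s] have the same square, whence [w] inverts [[~ w, s] = w^-1 * w ^ s]. These
    commutators generate [P'], and the elements inverted by [w] form a subgroup because [P'] is
    abelian. *)
Lemma inverts_der1 w : w \in P -> w \notin G -> w ^+ 2 \in 'Z(P) ->
  {in A, forall d, d ^ w = d^-1}.
Proof.
move=> Pw nGw /setIP[_ /centP cw2].
have inv1 s : s \in P -> [~ w, s] ^ w = [~ w, s]^-1.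
  move=> Ps; have : (w ^ s) ^+ 2 = w ^+ 2.
    by rewrite -conjXg; apply/conjg_fixP/commgP; apply: cw2.
  rewrite commgEl; move: (w ^ s) => v; rewrite !expgS !expg0 !mulg1 => E2.
  rewrite invMg invgK /conjg mulgA; congr (_ * w); apply/eqP.
  rewrite eq_sym eq_invg_mul [w^-1 * _]mulgA -invMg -E2 invMg.
  by rewrite -(mulgA v^-1) mulVg mulg1 mulgV.
pose R := <<[set [~ w, s] | s in P]>>.
have nRP : P \subset 'N(R).
  apply/subsetP=> g Pg; rewrite inE -genJ gen_subG.
  apply/subsetP=> _ /imsetP[_ /imsetP[s Ps ->] ->].
  have -> : [~ w, s] ^ g = [~ w, g]^-1 * [~ w, s * g] by rewrite commgMJ mulKg.
  by rewrite groupM ?groupV // mem_gen //; apply/imsetP; [exists g | exists (s * g)]; rewrite ?groupM.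
have [v Pv defP] := ex_gen_mod_Phi Pw nGw.
(* Modulo [R] the element [w] is central, and [P] is generated by [w] and one more element, so
   [P / R] is abelian. *)
have sAR : A \subset R.
  have nR u : u \in P -> <[u]> \subset 'N(R) by rewrite cycle_subG; apply: subsetP nRP u.
  suff : abelian ((<[w]> <*> <[v]>) / R) by rewrite defP; apply: der1_min.
  rewrite quotientY ?nR //.
  rewrite abelianY !quotient_abelian ?cycle_abelian //= quotient_cents2r //.
  rewrite commGC gen_subG; apply/subsetP=> _ /imset2P[_ _ /cycleP[i ->] /cycleP[j ->] ->].
  have Rw s : s \in P -> [~ w, s] \in R by move=> Ps; rewrite mem_gen //; apply/imsetP; exists s.
  elim: i => [|i IH]; first by rewrite comm1g.
  rewrite expgSr commMgJ; apply: groupM; last by rewrite Rw ?groupX.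
  by rewrite memJ_norm // (subsetP nRP).
pose T := [set d in A | d ^ w == d^-1].
have gT_T : group_set T.
  apply/group_setP; split; first by rewrite inE group1 conj1g invg1 eqxx.
  move=> d e; rewrite !inE => /andP[Ad /eqP Ed] /andP[Ae /eqP Ee].
  by rewrite groupM // conjMg Ed Ee invMg (centsP cAA d^-1) ?groupV ?eqxx.
move=> d /(subsetP sAR) Rd; have : R \subset Group gT_T.
  rewrite gen_subG; apply/subsetP=> _ /imsetP[s Ps ->].
  by rewrite inE inv1 ?eqxx ?andbT // mem_commg.
by move/subsetP/(_ d Rd); rewrite inE => /andP[_ /eqP].
Qed.

Lemma abelem_Ohm1_der1 : 2.-abelem E.
Proof. by rewrite (abelem_Ohm1 pA) (abelianS (Ohm_sub 1 _)). Qed.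

Lemma mem_Ohm1_der1 d : d \in A -> (d \in E) = (d ^+ 2 == 1).
Proof.
move=> Ad; rewrite (OhmEabelian pA) ?(abelianS (Ohm_sub 1 _)) //.
by rewrite !inE Ad.
Qed.

Lemma card_Ohm1_der1 : #|E| = 4.
Proof.
have sEG : E \subset G := subset_trans (Ohm_sub 1 _) sAG.
have le4 := card_abelem_Phi sEG abelem_Ohm1_der1.
have : ~~ (#|E| <= 3).
  apply: contra ncA => le3; rewrite (abelian_rank1_cyclic cAA) -rank_Ohm1.
  by rewrite -abelian_rank1_cyclic ?cyclic_small ?(abelianS (Ohm_sub 1 _)).
by rewrite -ltnNge => gt3; apply/eqP; rewrite eqn_leq le4.
Qed.

Lemma sub_Ohm1_der1 : E \subset A. Proof. exact: Ohm_sub. Qed.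

Lemma normal_Ohm1_der1 : E <| P.
Proof. exact: char_normal_trans (Ohm_char 1 _) (der_normal 1 P). Qed.

Lemma Phi_der1E : 'Phi(A) = [set d ^+ 2 | d in A].
Proof. by rewrite (Phi_Mho pA cAA) (MhoEabelian 1 pA cAA). Qed.

Lemma index_Phi_der1 : #|A : 'Phi(A)| = 4.
Proof.
have le4 := index_Phi_sub_Phi sAG.
have : ~~ (#|A : 'Phi(A)| <= 3).
  apply: contra ncA => le3; apply: Phi_quotient_cyclic.
  by apply: cyclic_small; rewrite card_quotient ?gFnorm.
by rewrite -ltnNge => gt3; apply/eqP; rewrite eqn_leq le4.
Qed.

Let sEA := sub_Ohm1_der1.
Let nEP := normal_Ohm1_der1.
Let sEP : E \subset P := normal_sub nEP.

(** The conjugacy class of a nontrivial [e] in [E] misses [1], so it has at most 3 elements, hence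
    at most 2, its size being a power of 2. A centralizer of index at most 2 contains ['Phi(P)]. *)
Lemma Phi_cent_Ohm1 : G \subset 'C(E).
Proof.
rewrite centsC; apply/subsetP=> e Ee.
have [-> | nt1] := eqVneq e 1; first exact: group1.
suff : G \subset 'C_P[e].
  move=> sG; apply/centP=> g Gg; have := subsetP sG g Gg.
  by case/setIP=> _ /cent1P/commute_sym.
have : #|P : 'C_P[e]| <= 3.
  rewrite index_cent1 -ltnS -card_Ohm1_der1; apply: proper_card.
  apply/properP; split; first by rewrite class_sub_norm ?(normal_norm nEP).
  by exists 1; [exact: group1 | rewrite class_sym class1G inE].
have := pnat_dvd (dvdn_indexg P 'C_P[e]) pP => /p_natP[[|[|k]] Ei].
- by move=> _; rewrite (subset_trans (Phi_sub P)) // -indexg_eq1 Ei.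
- by move=> _; rewrite Phi_sub_max // p_index_maximal ?subsetIl // Ei.
by rewrite Ei !expnS mulnA leqNgt (_ : 3 < _) // (leq_pmulr 4) ?expn_gt0.
Qed.

Lemma index_cap_Phi (Q : {group gT}) : Q \proper P -> #|Q : Q :&: G| <= 2.
Proof.
move=> /andP[sQP nsPQ]; rewrite indexgI -indexMg.
have nGQ : Q \subset 'N(G) := subset_trans sQP (gFnorm _ _).
rewrite -norm_joinEr //; pose J := (G <*> Q)%G.
have sJP : J \subset P by rewrite join_subG Phi_sub.
have gt1 : 1 < #|P : J|.
  rewrite indexg_gt1; apply: contra nsPQ => sPJ.
  suff -> : Q = P :> {set gT} by [].
  by rewrite -[LHS]genGid; apply: Phi_nongen; apply/eqP; rewrite eqEsubset sJP.
have := Lagrange_index sJP (joing_subl G Q); rewrite iG => E4.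
by rewrite -(leq_pmul2l (ltn0Sn 1)) -[X in _ <= X]/4 -E4 leq_mul2r gt1 orbT.
Qed.

(* Some [g] in ['Phi(P)] with [[~ w, g]] in [E] but not in ['Phi(A)] normalizes [Q]; but
   ['N_('Phi(P))(Q) = (Q :&: 'Phi(P)) <[t]>] only yields commutators in ['Phi(A)]. *)
Lemma Ohm1_normalizer_absurd (Q : {group gT}) w t :
    Q \subset P -> w \in Q -> w \notin G -> w ^+ 2 \in 'Z(P) -> w ^+ 2 \in E ->
    E \subset Q -> Q \subset 'C(E) -> ~~ (E \subset 'Phi(A)) ->
    P \subset 'N(A :&: Q) -> Q :&: G \subset (A :&: Q) * 'C_(Q :&: G)[w] ->
    t \in A -> t \in 'N(Q) -> t \notin Q -> #|'N_P(Q) : Q| <= 2 ->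
  False.
Proof.
move=> sQP Qw nGw Zw2 Ew2 sEQ cEQ nsE nB dec At nQt nQQt i2.
have Pw := subsetP sQP w Qw; have inv := inverts_der1 Pw nGw Zw2.
have Pt := subsetP sAP t At.
have [s Ps defP] := ex_gen_mod_Phi Pw nGw.
have Aa : [~ w, s] \in A by apply: mem_commg.
have nPhi : P \subset 'N('Phi(A)).
  exact: normal_norm (char_normal_trans (Phi_char _) (der_normal 1 P)).
have cA u v : u \in A -> v \in A -> u ^ v = u.
  by move=> Au Av; rewrite /conjg (centsP cAA u) ?mulKg.
pose b := [~ w, s ^+ 2].
have Eb : b = [~ w, s] * [~ w, s] ^ s by rewrite /b expgS expg1 commgMJ.
have Ab : b \in A by apply: mem_commg; rewrite ?groupX.
have sqA d : d \in A -> d ^+ 2 \in 'Phi(A).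
  by move=> Ad; rewrite Phi_der1E; apply/imsetP; exists d.
(* Otherwise ['Phi(A)] and [[~ w, s]] would generate a normal subgroup of [P] with abelian quotient,
   hence all of [A], and [A] would be cyclic. *)
have nPhib : b \notin 'Phi(A).
  apply: contra ncA => Phib.
  pose B0 := ('Phi(A) <*> <[[~ w, s]]>)%G.
  have sB0A : B0 \subset A by rewrite join_subG Phi_sub cycle_subG.
  have B0a : [~ w, s] \in B0 by rewrite (subsetP (joing_subr _ _)) ?cycle_id.
  have nB0 g : g \in P -> [~ w, s] ^ g \in B0 -> g \in 'N(B0).
    move=> Pg B0ag; rewrite inE -genJ gen_subG conjUg subUset -cycleJ.
    by rewrite cycle_subG B0ag (normP (subsetP nPhi g Pg)) joing_subl.
  have nB0P : <[w]> <*> <[s]> \subset 'N(B0).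
    rewrite join_subG !cycle_subG; apply/andP; split; apply: nB0 => //.
      by rewrite inv ?groupV.
    have -> : [~ w, s] ^ s = [~ w, s]^-1 * b by rewrite Eb mulKg.
    by rewrite groupM ?groupV // (subsetP (joing_subl _ _)).
  have : abelian ((<[w]> <*> <[s]>) / B0).
    move: nB0P; rewrite join_subG => /andP[nw ns].
    rewrite quotientY // abelianY !quotient_abelian ?cycle_abelian //=.
    rewrite !cycle_subG in nw ns; rewrite !quotient_cycle //.
    apply/cents_cycle/commgP; rewrite -morphR //= coset_id //.
    by rewrite -invg_comm groupV.
  rewrite defP => /(der1_min (eq_ind _ (fun X : {set gT} => X \subset 'N(B0)) nB0P _ defP)) sAB0.
  suff <- : << <[[~ w, s]]> >> = A by rewrite genGid cycle_cyclic.
  by apply: Phi_nongen; apply/eqP; rewrite eqEsubset sB0A.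
(* This subgroup has index at most 2 in [A], so [P] acts trivially on the quotient and [[~: A, P]]
   lies in it; [b] is a square times such a commutator. *)
pose B1 := ('Phi(A) <*> E)%G.
have nEPhi : E \subset 'N('Phi(A)) := subset_trans sEP nPhi.
have sB1A : B1 \subset A by rewrite join_subG Phi_sub.
have nB1P : P \subset 'N(B1) by rewrite normsY // normal_norm.
have B1b : b \in B1.
  have -> : b = [~ w, s] ^+ 2 * [~ [~ w, s], s].
    by rewrite Eb; move: [~ w, s] => a; rewrite commgEl expgS expg1 -mulgA mulKVg.
  rewrite groupM //; first by rewrite (subsetP (joing_subl _ _)) ?sqA.
  suff : [~: A, P] \subset B1 by move/subsetP; apply; apply: mem_commg.
  have i3 : #|A : B1| <= 2.
    have gt1 : 1 < #|B1 : 'Phi(A)|.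
      rewrite indexg_gt1; apply: contra nsE; apply: subset_trans.
      exact: joing_subr.
    have := Lagrange_index sB1A (joing_subl 'Phi(A) E); rewrite index_Phi_der1 => E4.
    by rewrite -(leq_pmul2r (ltn0Sn 1)) -[X in _ <= X]/4 -E4 leq_mul2l gt1 orbT.
  rewrite gen_subG; apply/subsetP=> _ /imset2P[d g Ad Pg ->].
  have Adg : d ^ g \in A by rewrite memJ_norm // (subsetP (der_norm 1 P)).
  have [B1d | nB1d] := boolP (d \in B1).
    by rewrite commgEl groupM ?groupV // memJ_norm // (subsetP nB1P).
  rewrite commgEl; apply: index_le2_mulVg i3 _ _ _ _ => //.
  by rewrite memJ_norm // (subsetP nB1P).
have [phi Phi_phi [iota E_iota Eb2]] : exists2 phi, phi \in 'Phi(A) & exists2 iota, iota \in E & b = phi * iota.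
  move: B1b; rewrite /B1 /= norm_joinEr // => /mulsgP[phi iota ? ? ->].
  by exists phi => //; exists iota.
have nPhi_iota : iota \notin 'Phi(A).
  by apply: contra nPhib => ?; rewrite Eb2 groupM.
move: Phi_phi; rewrite Phi_der1E => /imsetP[delta Ad Ephi].
have RwA d : d \in A -> [~ w, d] = d ^+ 2.
  move=> Adl; rewrite commgEr conjVg inv // invgK expgS expg1 //.
(* Since [[~ w, d] = d ^+ 2] on [A], the factor [delta^-1] cancels the part [phi = delta ^+ 2] of
   [b] and leaves [[~ w, g] = iota]. *)
pose g := s ^+ 2 * delta^-1.
have Eg : [~ w, g] = iota.
  rewrite commgMJ -/b RwA ?groupV // cA ?groupV // Eb2 Ephi expgVn mulgA mulVg mul1g //.
have Gg : g \in G by rewrite groupM ?sqr_Phi // groupV (subsetP sAG).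
have Pg := subsetP (Phi_sub P) g Gg.
have prQ : Q \proper P by apply/properP; split=> //; exists t.
have cEG := Phi_cent_Ohm1.
(* As [w] inverts [A], [H :&: A = E], so [H / E] embeds in the cyclic group [G / A]. [g] normalizes
   [H] because it moves [w] by [iota], which [G] centralizes; then it normalizes [D], since [D / E]
   is characteristic in [H / E]. Finally [Q] is generated by [w], [A :&: Q] and [D]. *)
have nQg : g \in 'N(Q).
  pose H := 'C_G[w]%G; pose D := 'C_(Q :&: G)[w]%G.
  have sEG : E \subset G := subset_trans sEA sAG.
  have cEw : w \in 'C(E) by rewrite (subsetP cEQ).
  have sED : E \subset D.
    apply/subsetP=> e Ee; apply/setIP; split.
      by rewrite inE (subsetP sEQ) ?(subsetP sEG).
    by apply/cent1P; rewrite /commute (centP cEw).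
  have sDH : D \subset H by rewrite setSI ?subsetIr.
  have HA : H :&: A = E.
    apply/eqP; rewrite eqEsubset subsetI sEA (subset_trans sED sDH) !andbT.
    apply/subsetP=> d /setIP[/setIP[_ /cent1P cwd] Adl]; rewrite mem_Ohm1_der1 //.
    by rewrite -eq_invg_mul -inv // /conjg cwd mulKg.
  have nAG : G \subset 'N(A) := subset_trans (Phi_sub P) (der_norm 1 P).
  have cycGA : cyclic (G / A).
    pose B2 := (A <*> <[s ^+ 2]>)%G.
    have sAB2 : A \subset B2 := joing_subl _ _.
    have sB2P : B2 \subset P by rewrite join_subG sAP cycle_subG groupX.
    have nB2P : P \subset 'N(B2) := sub_der1_norm sAB2 sB2P.
    have nB2 u : u \in P -> u \in 'N(B2) by apply: subsetP.
    have c2 u : u \in P -> u ^+ 2 \in B2 -> (coset B2 u) ^+ 2 = 1.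
      by move=> Pu B2u; rewrite -morphX ?nB2 //= coset_id.
    have sq u : u \in P -> u ^+ 2 \in B2.
      move=> Pu; rewrite -coset_eq1 ?groupX ?nB2 // morphX ?nB2 //=.
      have : coset B2 u \in <[coset B2 w]> <*> <[coset B2 s]>.
        by rewrite -!quotient_cycle ?nB2 // -quotientY ?cycle_subG ?nB2 // defP mem_quotient.
      have cws : commute (coset B2 w) (coset B2 s).
        apply: (centsP (sub_der1_abelian sAB2)); rewrite mem_quotient //.
      rewrite cent_joinEl ?cents_cycle // => /mulsgP[_ _ /cycleP[i ->] /cycleP[j ->] ->].
      rewrite expgMn; last exact: commuteX2.
      rewrite -!expgM !(mulnC _ 2) !expgM !c2 ?expg1n ?mulg1 //.
        by rewrite (subsetP (joing_subr _ _)) ?cycle_id.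
      by rewrite (subsetP sAB2) // (subsetP sEA).
    have sGB2 : G \subset B2.
      rewrite (Phi_joing pP) join_subG sAB2 (MhoE 1 pP) gen_subG.
      by apply/subsetP=> _ /imsetP[u Pu ->]; apply: sq.
    have nAs : <[s ^+ 2]> \subset 'N(A) by rewrite cycle_subG groupX ?(subsetP (der_norm 1 P)).
    apply: cyclicS (quotientS _ sGB2) _; rewrite /= norm_joinEr // quotientMidl.
    exact: quotient_cyclic (cycle_cyclic _).
  have cycHE : cyclic (H / E).
    have sHG : H \subset G by apply: subsetIl.
    have nAH := subset_trans sHG nAG.
    rewrite -HA setIC (isog_cyclic (second_isog nAH)).
    by apply: cyclicS cycGA; apply: quotientS.
  have nEH : H \subset 'N(E).
    by rewrite (subset_trans (subsetIl _ _)) // (subset_trans (Phi_sub P)) // normal_norm.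
  have wg : w ^ g = w * iota by rewrite -Eg commgEl mulKVg.
  have nHg : g \in 'N(H).
    rewrite inE; apply/subsetP=> _ /imsetP[h /setIP[Gh /cent1P cwh] ->].
    have Ghg : h ^ g \in G by rewrite groupJ.
    apply/setIP; split=> //; apply/cent1P.
    have : commute (w ^ g) (h ^ g) by rewrite /commute -!conjMg cwh.
    rewrite wg /commute -mulgA; have -> : iota * h ^ g = h ^ g * iota.
      by rewrite (centP (subsetP cEG _ Ghg)).
    by rewrite !mulgA => /mulIg.
  have nEg : g \in 'N(E) by rewrite (subsetP (normal_norm nEP)).
  have nDg : g \in 'N(D).
    have chD : D / E \char H / E by rewrite (sub_cyclic_char _ cycHE) quotientS.
    have nE_D : E <| D by rewrite /normal sED (subset_trans sDH).
    have : coset E g \in 'N(D / E).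
      apply: (subsetP (char_norms chD)).
      have nHgE : <[g]> / E \subset 'N(H / E) by rewrite quotient_norms // cycle_subG.
      by apply: (subsetP nHgE); rewrite mem_quotient ?cycle_id.
    rewrite -quotient_normG // => /morphimP[h nEh nDh /= Ehg].
    have : h^-1 * g \in E.
      have nEhg : h^-1 * g \in 'N(E) by rewrite groupM ?groupV.
      by rewrite -(coset_eq1 nEhg) (morphM (coset_morphism E)) ?groupV // morphV //= -Ehg mulVg.
    move/(subsetP sED) => Dh; rewrite -(mulKVg h g) groupM //.
    exact: subsetP (normG D) _ Dh.
  have Qw' q : q \in Q :&: G -> q ^ g \in Q.
    move/(subsetP dec)/mulsgP=> [d h Bd Dh ->]; rewrite conjMg groupM //.
      have : d ^ g \in A :&: Q by rewrite memJ_norm ?(subsetP nB).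
      by case/setIP.
    have : h ^ g \in D by rewrite memJ_norm.
    by case/setIP=> /setIP[].
  rewrite inE; apply/subsetP=> _ /imsetP[q Qq ->].
  have [Gq | nGq] := boolP (q \in G); first by rewrite Qw' // inE Qq.
  have : w^-1 * q \in Q :&: G.
    apply: (index_le2_mulVg (K := Q)) (index_cap_Phi prQ) _ _ _ _ => //.
    - exact: subsetIl.
    - by rewrite inE (negPf nGw) andbF.
    - by rewrite inE (negPf nGq) andbF.
  move/Qw' => Qwq; rewrite -(mulKVg w q) conjMg groupM // wg groupM //.
  exact: (subsetP sEQ).
have Nt : t \in 'N_P(Q) by rewrite inE Pt.
have Ng : g \in 'N_P(Q) by rewrite inE Pg.
(* Either [g] or [t^-1 * g] lies in [Q], and [t] is in [A], so both cases give this form. Then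
   [[~ w, g]] is a conjugate of [d ^+ 2], which lies in ['Phi(A)]. *)
have [d [h [Adl Hh Egd]]] : exists d h, [/\ d \in A, h \in 'C_(Q :&: G)[w] & g = d * h].
  have cut q : q \in Q :&: G -> exists d h, [/\ d \in A, h \in 'C_(Q :&: G)[w] & q = d * h].
    by move/(subsetP dec)/mulsgP=> [d h /setIP[Adl _] Hh ->]; exists d, h.
  have [Qg | nQgg] := boolP (g \in Q); first by apply: cut; rewrite inE Qg.
  have Qtg : t^-1 * g \in Q.
    by apply: (index_le2_mulVg (K := 'N_P(Q))) => //; rewrite subsetI sQP normG.
  have [|d [h [Adl Hh Etg]]] := cut (t^-1 * g).
    by rewrite inE Qtg groupM // groupV (subsetP sAG).
  exists (t * d), h; split=> //; first by rewrite groupM.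
  by rewrite -mulgA -Etg mulKVg.
case/setIP: Hh => /setIP[Qh Gh] /cent1P cwh.
case/negP: nPhi_iota; rewrite -Eg Egd commgMJ.
have -> : [~ w, h] = 1 by apply/eqP/commgP/commute_sym.
rewrite mul1g RwA // memJ_norm ?sqA //.
by rewrite (subsetP nPhi) // (subsetP (Phi_sub P)).
Qed.

(** * Exclusion of each shape of [K], according to the position of [P'] *)

Section Essential.

Variables (Q K C : {group gT}) (t0 : gT).
Hypothesis sQP : Q \subset P.
Hypothesis cQ : 'C_P(Q) \subset Q.
Hypothesis i2 : #|'N_P(Q) : Q| <= 2.
Hypothesis sEQ : E \subset Q.
Hypothesis split : action_split P Q K C t0.

Let nKQ := split_normal split.
Let sCQ := split_sub split.
Let defQ := split_mul split.
Let sKQ : K \subset Q := normal_sub nKQ.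
Let sKP : K \subset P := subset_trans sKQ sQP.
Let sCP : C \subset P := subset_trans sCQ sQP.
Let nK := split_norm split.
Let nQ : Q \subset 'N_P(Q).
Proof. by rewrite subsetI sQP normG. Qed.
Let Pt0 : t0 \in P. Proof. by case/setIP: (split_mem split). Qed.
Let nQt0 := split_notin split.
Let prQ : Q \proper P. Proof. by apply/properP; split=> //; exists t0. Qed.

(** Here [Q] is maximal in [P] and contains ['Phi(P)], so every element of [Q] outside ['Phi(P)]
    generates [P] together with [t0]. This traps [A] in [K], or in [C] when [K] lies in ['Phi(P)];
    both contradict the shape. *)
Lemma essential_der1_nsub : A \subset Q -> 
  abelian_shape P Q K C \/ (exists j, quaternion_shape K C j) -> False.
Proof.
move=> sAQ shape.
have nQP : Q <| P := sub_der1_normal sAQ sQP.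
have NP : 'N_P(Q) = P by apply/setIidPl; apply: normal_norm.
have iQ : #|P : Q| = 2.
  by apply/eqP; rewrite eqn_leq -{1}NP i2 indexg_gt1 proper_subn.
have sGQ : G \subset Q by apply: Phi_sub_max; rewrite p_index_maximal // iQ.
have gen u : u \in Q -> u \notin G -> <[u]> <*> <[t0]> = P.
  move=> Qu nGu; apply: gen_mod_Phi (subsetP sQP u Qu) Pt0 nGu _.
  by apply: contra nQt0; apply: subsetP; rewrite join_subG sGQ cycle_subG.
have nt0K : t0 \in 'N(K) by apply: (subsetP nK); apply: split_mem split.
have [sKG | /subsetPn[k Kk nGk]] := boolP (K \subset G).
  have /subsetPn[c Cc nGc] : ~~ (C \subset G).
    apply/negP=> sCG; have : Q \subset G by rewrite -defQ mul_subG.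
    by move=> sQG; move: (indexgS P sQG); rewrite iQ iG.
  have sAC : A \subset C.
    apply: (der1_gen2_sub (gen c (subsetP sCQ c Cc) nGc)).
    - exact: subsetP (normG C) c Cc.
    - exact: split_normC split.
    rewrite commgEl groupM ?groupV // memJ_norm //; exact: split_normC split.
  (* [[~ k, t0]] lies in [K], and in [A], hence in [C]; so it lies in ['Phi(K)], against
     [split_act]. *)
  have [k Kk] := split_act split (split_mem split) nQt0.
  case/negP; apply: (subsetP (split_cap split)); rewrite inE.
  rewrite {1}commgEl groupM ?groupV // ?memJ_norm //.
  by rewrite (subsetP sAC) // mem_commg // (subsetP sKP).
have defP := gen k (subsetP sKQ k Kk) nGk.
have Kkt : [~ k, t0] \in K by rewrite commgEl groupM ?groupV // memJ_norm.
have sAK : A \subset K.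
  by apply: (der1_gen2_sub defP) => //; apply: subsetP (normG K) k Kk.
case: shape => [ab | [j q8]]; last first.
  have : E \subset <[j]>.
    apply/subsetP=> e Ee; apply/negPn/negP=> nje.
    have Ae := subsetP sEA e Ee; move: Ee; rewrite mem_Ohm1_der1 //.
    rewrite (q8_sqr q8 (subsetP sAK e Ae) nje) => /eqP j1.
    by have := q8_ord q8; rewrite j1 order1.
  by move/subset_leq_card; rewrite card_Ohm1_der1 -orderE (q8_ord q8).
have cKK := ab_abelian ab.
have : t0 ^+ 2 \in K * C by rewrite defQ (subsetP sGQ) // sqr_Phi.
case/mulsgP=> k1 c1 Kk1 Cc1 Eu.
(* [t0] fixes its own square [k1 * c1], so [k1^-1 * k1 ^ t0] falls in [K :&: C = 1]. *)
have k1t : k1 ^ t0 = k1.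
  have E1 : k1 ^ t0 * c1 ^ t0 = k1 * c1.
    by rewrite -conjMg -Eu conjXg /conjg mulKg.
  have : k1^-1 * k1 ^ t0 \in K :&: C.
    rewrite inE groupM ?groupV ?memJ_norm //=.
    have -> : k1^-1 * k1 ^ t0 = c1 * (c1 ^ t0)^-1.
      by apply: (mulgI k1); rewrite mulKVg mulgA -E1 mulgK.
    by rewrite groupM ?groupV // memJ_norm //; apply: split_normC split.
  rewrite (ab_cap ab) inE => /eqP E2.
  by apply: (mulgI k1^-1); rewrite E2 mulVg.
have Gk1 : k1 \in G.
  apply/negPn/negP=> nGk1.
  have := der1_gen2_sub (B := 1%G) (gen k1 (subsetP sKQ _ Kk1) nGk1).
  rewrite !norm1 !inE => /(_ isT isT); rewrite commgEl k1t mulVg eqxx => /(_ isT).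
  by move/trivgP => A1; move: ncA; rewrite A1 cyclic1.
have Gc1 : c1 \in G by rewrite -(groupMl _ Gk1) -Eu sqr_Phi.
have ck1 : commute k k1 by apply: (centsP cKK).
have cc1 : commute k c1.
  have [abK | nabK] := boolP (2.-abelem K).
    have [_ /centsP cCK] := ab_abelem ab abK.
    exact/commute_sym/cCK.
  have [-> | nt1] := eqVneq c1 1; first exact: commute1.
  (* The involution of [<[c1]>] and the group [U] would together span an elementary abelian group of
     order at least 8 inside ['Phi(P)]. *)
  have [i [ii oi]] : exists i, i \in <[c1]> /\ #[i] = 2.
    have ntc : <[c1]> != 1 by rewrite cycle_eq1.
    have pc : 2.-group <[c1]> by apply: pgroupS pG; rewrite cycle_subG.
    have [_ dv _] := pgroup_pdiv pc ntc.
    by have [i ? ?] := Cauchy (p := 2) isT dv; exists i.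
  have Gi : i \in G by apply: subsetP ii; rewrite cycle_subG.
  have Ci : i \in C by apply: subsetP ii; rewrite cycle_subG.
  have [U [sUPhi abU leU cUi]] := ab_nabelem ab nabK Ci oi.
  have sUK : U \subset K := subset_trans sUPhi (Phi_sub K).
  have sUG : U \subset G := subset_trans sUPhi (PhiS pP sKP).
  have nUi : i \notin U.
    apply/negP=> Ui; have : i \in K :&: C by rewrite inE (subsetP sUK).
    by rewrite (ab_cap ab) inE => /eqP i1; rewrite i1 order1 in oi.
  have abI : 2.-abelem <[i]> by rewrite prime_abelem // -orderE.
  have cUI : <[i]> \subset 'C(U) by rewrite cycle_subG.
  have TI : U :&: <[i]> = 1.
    by rewrite setIC prime_TIg ?cycle_subG // -orderE oi.
  have dpr : U \x <[i]> = U <*> <[i]> by rewrite dprodE // -?cent_joinEr // setIC.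
  have := card_abelem_Phi (L := (U <*> <[i]>)%G).
  rewrite join_subG sUG cycle_subG Gi -(dprod_card dpr) (dprod_abelem _ dpr) abU abI.
  move=> /(_ isT isT); rewrite -orderE oi leqNgt => /negP; case.
  by apply: leq_trans (leq_mul leU (leqnn 2)).
(* Hence [t0] inverts [[~ k, t0]], so the cyclic group that this commutator generates is normal in
   [P] and contains [A]. *)
have ck : commute k (t0 ^+ 2) by rewrite Eu; apply: commuteM.
have Et : [~ k, t0] ^ t0 = [~ k, t0]^-1.
  have : [~ k, t0 ^+ 2] = 1 by apply/eqP/commgP.
  rewrite expgS expg1 commgMJ => E1; apply/esym/eqP; rewrite eq_invg_mul; exact/eqP.
have sAD := der1_gen2_sub (B := <[[~ k, t0]]>%G) defP.
case/negP: ncA; apply: cyclicS (cycle_cyclic [~ k, t0]); apply: sAD.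
- rewrite (subsetP (cent_sub _)) // cent_cycle; apply/cent1P; exact: (centsP cKK).
- by rewrite inE -cycleJ cycle_subG /= Et groupV cycle_id.
exact: cycle_id.
Qed.

Lemma ex_der1_normalizer : ~~ (A \subset Q) ->
  exists t, [/\ t \in A, t \in 'N(Q) & t \notin Q].
Proof.
move=> nsAQ; have nAQ : Q \subset 'N(A) := subset_trans sQP (der_norm 1 P).
pose J := (A <*> Q)%G; have sJP : J \subset P by rewrite join_subG sAP.
have prJ : Q \proper J.
  rewrite properE joing_subr /=; apply: contra nsAQ; apply: subset_trans.
  exact: joing_subl.
have := nilpotent_proper_norm (pgroup_nil (pgroupS sJP pP)) prJ.
case/properP=> _ [n /setIP[Jn nQn] nQQn].
move: Jn nQn nQQn; rewrite /J /= norm_joinEr // => /mulsgP[t q At Qq ->].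
have nQq := subsetP (normG Q) q Qq.
by rewrite !groupMr // => nQt nQQt; exists t.
Qed.

(** [d] and [d ^ q] have the same square because [q] centralizes [E], so their quotient in the
    abelian group [A] has square 1. *)
Lemma comm_sqr_Ohm1 d q : Q \subset 'C(E) -> d \in A -> d ^+ 2 \in E -> q \in Q ->
  [~ d, q] \in E.
Proof.
move=> cEQ Ad Ed Qq; have Pq := subsetP sQP q Qq.
have Adq : d ^ q \in A by rewrite memJ_norm // (subsetP (der_norm 1 P)).
rewrite mem_Ohm1_der1; last by rewrite commgEl groupM ?groupV.
rewrite commgEl expgMn; last by apply: (centsP cAA); rewrite ?groupV.
rewrite -conjXg /conjg expgVn -(centP (subsetP cEQ q Qq)) //.
by rewrite mulKg mulVg.
Qed.

Lemma sqr_Ohm1_norm d : Q \subset 'C(E) -> d \in A -> d ^+ 2 \in E -> d \in 'N_P(Q).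
Proof.
move=> cEQ Ad Ed; rewrite inE (subsetP sAP) //= inE.
apply/subsetP=> _ /imsetP[q Qq ->].
have -> : q ^ d = q * [~ d, q]^-1.
  by rewrite invg_comm commgEl mulKVg.
by rewrite groupM ?groupV // (subsetP sEQ) // comm_sqr_Ohm1.
Qed.

(** An element of [A] normalizing [Q] acts quadratically on [K], since its commutators with [K] are
    again in the abelian group [A]. So [K] is a four-group and [Q] is abelian. An involution [w] of
    [Q] outside ['Phi(P)] both inverts and centralizes [A :&: Q], which is therefore [E], and
    [Ohm1_normalizer_absurd] applies. *)
Lemma essential_abelian_absurd : abelian_shape P Q K C -> ~~ (A \subset Q) -> False.
Proof.
move=> ab nsAQ; have [t [At nQt nQQt]] := ex_der1_normalizer nsAQ.
have Pt := subsetP sAP t At; have Nt : t \in 'N_P(Q) by rewrite inE Pt.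
have abK : 2.-abelem K.
  apply: (ab_quadratic ab Nt nQQt) => k Kk; apply/eqP/commgP.
  by apply: (centsP cAA) => //; apply: mem_commg (subsetP sKP k Kk) Pt.
have [oK cKC] := ab_abelem ab abK.
have cKK := ab_abelian ab.
have cQQ : abelian Q.
  apply: cyclic_factor_abelian (split_cyclic split).
  rewrite subsetI sKQ /= -defQ centM subsetI; apply/andP; split; first exact: cKK.
  by rewrite centsC.
have cEQ : Q \subset 'C(E) by rewrite centsC (subset_trans sEQ).
(* When [K] lies in ['Phi(P)], an involution of [C] serves: inside ['Phi(P)] it would span with [K]
   a group of order 8. If moreover [C = 1], then [Q = K = E] contains its centralizer in [P], hence
   [A]. *)
have [w [Qw nGw w2]] : exists w, [/\ w \in Q, w \notin G & w ^+ 2 = 1].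
  have [sKG | /subsetPn[w Kw nGw]] := boolP (K \subset G); last first.
    exists w; split; rewrite ?(subsetP sKQ) //.
    by have /(abelemP (isT : prime 2))[_ ->] := abK.
  have [C1 | ntC] := eqVneq (C : {set gT}) 1.
    have EQ : E = Q.
      by apply/eqP; rewrite eqEcard sEQ -defQ C1 mulg1 oK card_Ohm1_der1.
    case/negP: nsAQ; apply: subset_trans cQ; rewrite subsetI sAP -EQ.
    exact: subset_trans cAA (centS sEA).
  have pC : 2.-group C := pgroupS sCP pP.
  have [_ dv _] := pgroup_pdiv pC ntC.
  have [i Ci oi] := Cauchy (p := 2) isT dv.
  exists i; split; rewrite ?(subsetP sCQ) //; last by rewrite -oi expg_order.
  apply/negP=> Gi.
  have abI : 2.-abelem <[i]> by rewrite prime_abelem // -orderE.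
  have cUI : <[i]> \subset 'C(K) by rewrite cycle_subG (subsetP cKC).
  have TI : K :&: <[i]> = 1.
    apply/trivgP; rewrite -(ab_cap ab) setIS // cycle_subG //.
  have dpr : K \x <[i]> = K <*> <[i]> by rewrite dprodE // -?cent_joinEr.
  have := card_abelem_Phi (L := (K <*> <[i]>)%G).
  rewrite join_subG sKG cycle_subG Gi -(dprod_card dpr) (dprod_abelem _ dpr) abK abI.
  by move=> /(_ isT isT); rewrite -orderE oi oK.
have Pw := subsetP sQP w Qw.
have Zw2 : w ^+ 2 \in 'Z(P) by rewrite w2 group1.
have inv := inverts_der1 Pw nGw Zw2.
have AQ : A :&: Q = E.
  apply/eqP; rewrite eqEsubset subsetI sEA sEQ !andbT.
  apply/subsetP=> d /setIP[Ad Qd]; rewrite mem_Ohm1_der1 //.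
  rewrite -eq_invg_mul -inv // /conjg (centsP cQQ d Qd) ?mulKg //.
apply: (Ohm1_normalizer_absurd (Q := Q) (w := w) (t := t)) => //.
- by rewrite w2 group1.
(* Square roots in [A] of two independent elements of [E] normalize [Q] but lie outside it; their
   quotient would then lie in [A :&: Q = E], and the two squares would agree. *)
- apply/negP=> sEPhi.
  have root e : e \in E -> exists2 d, d \in A & e = d ^+ 2.
    by move/(subsetP sEPhi); rewrite Phi_der1E => /imsetP[d Ad ->]; exists d.
  have rootn d : d \in A -> d ^+ 2 \in E -> d ^+ 2 != 1 -> d \notin Q.
    move=> Ad Ed ntd; apply: contra ntd => Qd; rewrite -mem_Ohm1_der1 // -AQ inE Ad //.
  have /subsetPn[e1 E1 n1] : ~~ (E \subset 1%G).
    by apply/negP=> /subset_leq_card; rewrite card_Ohm1_der1 cards1.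
  have /subsetPn[e2 E2 n2] : ~~ (E \subset <[e1]>).
    apply/negP=> /subset_leq_card; rewrite card_Ohm1_der1 -orderE.
    have : #[e1] %| 2.
      rewrite order_dvdn -mem_Ohm1_der1 ?(subsetP sEA) //.
    by move/dvdn_leq => /(_ isT) le2 le4; have := leq_trans le4 le2.
  have [d1 A1 D1] := root e1 E1; have [d2 A2 D2] := root e2 E2.
  have nt1 : e1 != 1 by move: n1; rewrite inE.
  have nt2 : e2 != 1 by apply: contra n2 => /eqP->; apply: group1.
  have : d1^-1 * d2 \in E.
    rewrite -AQ inE groupM ?groupV //=.
    by apply: (index_le2_mulVg nQ i2); rewrite ?sqr_Ohm1_norm ?rootn -?D1 -?D2.
  rewrite mem_Ohm1_der1 ?groupM ?groupV // expgMn; last by apply: (centsP cAA); rewrite ?groupV.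
  rewrite expgVn -D1 -D2 -eq_invg_mul invgK => /eqP E12.
  by rewrite -E12 cycle_id in n2.
- by rewrite AQ normal_norm.
apply: subset_trans (mulG_subr _ _).
apply/subsetP=> q QGq; apply/setIP; split=> //; apply/cent1P.
by case/setIP: QGq => Qq _; apply: (centsP cQQ).
Qed.

(** The element sought is a [y] of order 4 in [K] outside ['Phi(P)]. Once its square [j] is known to
    be central in [P], [y] inverts [A] and plays the role of [w] in [Ohm1_normalizer_absurd]. *)
Lemma essential_quaternion_absurd j :
  quaternion_shape K C j -> ~~ (A \subset Q) -> False.
Proof.
case=> oK oj capKC PhiK cCK sqK nsAQ.
have [t [At nQt nQQt]] := ex_der1_normalizer nsAQ.
have Pt := subsetP sAP t At; have Nt : t \in 'N_P(Q) by rewrite inE Pt.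
have nKt : t \in 'N(K) := subsetP nK t Nt.
have [Kj Cj] : j \in K /\ j \in C by apply/setIP; rewrite capKC cycle_id.
have j2 : j ^+ 2 = 1 by rewrite -oj expg_order.
have ntj : j != 1 by rewrite -order_gt1 oj.
have jV : j^-1 = j by apply/eqP; rewrite eq_invg_mul -(expgS j 1) j2.
have mem_j u : (u \in <[j]>) = (u == 1) || (u == j).
  by rewrite cycle2g // !inE.
have cKC k c : k \in K -> c \in C -> commute k c.
  by move=> Kk Cc; apply/commute_sym; apply: (centsP cCK).
have cjQ q : q \in Q -> commute j q.
  rewrite -defQ => /mulsgP[k c Kk Cc ->].
  by apply: commuteM; [apply/commute_sym; apply: cKC | apply: cKC].
have cQj : Q \subset 'C(<[j]>).
  by apply/subsetP=> q Qq; rewrite cent_cycle; apply/cent1P/commute_sym/cjQ.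
have sj x : x \in K -> x \notin <[j]> -> <[j]> \subset <[x]>.
  by move=> Kx nx; rewrite cycle_subG -(sqK x Kx nx) mem_cycle.
have ord4 x : x \in K -> x \notin <[j]> -> #[x] = 4.
  by move=> Kx nx; rewrite (orderXprime (p := 2) (n := 2)) // sqK.
have njxy x y : x \in K -> y \in K -> x \notin <[j]> -> y \notin <[x]> ->
    (y \notin <[j]>) * (x * y \notin <[j]>).
  move=> Kx Ky nx ny; have sjx := subsetP (sj x Kx nx); split.
    by apply: contra ny; apply: sjx.
  by apply: contra ny => /sjx; rewrite groupMl ?cycle_id.
have noncomm x y : x \in K -> y \in K -> x \notin <[j]> -> y \notin <[x]> -> ~ commute x y.
  move=> Kx Ky nx ny cxy; have [ny' nxy] := njxy x y Kx Ky nx ny.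
  have := sqK _ (groupM Kx Ky) nxy; rewrite expgMn // !sqK // -(expgS j 1) j2 => j1.
  by rewrite -j1 eqxx in ntj.
have invxy x y : x \in K -> y \in K -> x \notin <[j]> -> y \notin <[x]> -> x ^ y = x^-1.
  move=> Kx Ky nx ny; have [ny' nxy] := njxy x y Kx Ky nx ny.
  have yV : y^-1 = j * y.
    apply/eqP; rewrite eq_invg_mul mulgA -(cjQ y) ?(subsetP sKQ) // -mulgA.
    by rewrite -(expgS y 1) sqK // -(expgS j 1) j2.
  apply/esym/eqP; rewrite eq_invg_mul /conjg yV.
  have -> : x * (j * y * (x * y)) = j * (x * y * (x * y)).
    by rewrite !mulgA (cjQ x) ?(subsetP sKQ).
  by rewrite -(expgS (x * y) 1) (sqK _ (groupM Kx Ky) nxy) -(expgS j 1) j2.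
have decK x y k : x \in K -> y \in K -> x \notin <[j]> -> y \notin <[x]> -> k \in K ->
    k \in <[x]> \/ y^-1 * k \in <[x]>.
  move=> Kx Ky nx ny Kk; have [xk | nxk] := boolP (k \in <[x]>); [by left | right].
  apply: (index_le2_mulVg (K := K)) => //; first by rewrite cycle_subG.
  by rewrite -divgS ?cycle_subG // oK -orderE ord4.
have ex_y x : x \in K -> x \notin <[j]> -> exists2 y, y \in K & y \notin <[x]>.
  move=> Kx nx; have /subsetPn[y Ky ny] : ~~ (K \subset <[x]>); last by exists y.
  by apply/negP=> /subset_leq_card; rewrite oK -orderE ord4.
(* Such an [H] has Frattini index at most 4 by the rank bound, and ['Phi(H)] lies in [<[j]>]; so its
   order is at most 8, the order of [K]. *)
have noext (H : {group gT}) : K \subset H -> H \subset G -> H \subset Q ->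
    (forall h, h \in H -> h ^+ 2 \in <[j]>) -> H \subset K.
  move=> sKH sHG sHQ sqH; have pH := pgroupS sHG pG.
  have nH : H \subset 'N(<[j]>) := subset_trans (subset_trans sHQ cQj) (cent_sub _).
  have sPhi : 'Phi(H) \subset <[j]>.
    apply: (Phi_min pH nH); apply: exponent2_abelem; apply/exponentP.
    move=> _ /morphimP[h nh Hh ->]; rewrite -morphX //= coset_id //; exact: sqH.
  have : #|H| <= #|K|.
    rewrite oK -(Lagrange (Phi_sub H)) mulnC -[8]/(4 * 2)%N leq_mul ?index_Phi_sub_Phi //.
    by rewrite -oj orderE subset_leq_card.
  by move=> leHK; have /eqP-> : K == H; rewrite // -val_eqE /= eqEcard sKH.
(* Write an offending [e] as [x * c], so that [c ^+ 2 = j]. For [y] in [K] outside [<[x]>], [y * c]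
   has square 1; outside ['Phi(P)] it would invert [A], hence commute with [e], and [y] would
   commute with [x]. So these products lie in ['Phi(P)], which drags [K] and [c] into it, against
   [noext]. *)
have sEC : E \subset C.
  apply/subsetP=> e Ee; apply/negPn/negP=> nCe.
  have Ae := subsetP sEA e Ee; have Ge := subsetP sAG e Ae.
  have : e \in K * C by rewrite defQ (subsetP sEQ).
  case/mulsgP=> x c Kx Cc Eec.
  have nx : x \notin <[j]>.
    by apply: contra nCe => jx; rewrite Eec groupM //; apply: subsetP jx; rewrite cycle_subG.
  have c2 : c ^+ 2 = j.
    move: Ee; rewrite mem_Ohm1_der1 // Eec expgMn; last exact: cKC.
    by rewrite (sqK x Kx nx) -eq_invg_mul jV => /eqP.
  have Gf y : y \in K -> y \notin <[x]> -> y * c \in G.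
    move=> Ky ny; have [ny' nxy] := njxy x y Kx Ky nx ny.
    apply/negPn/negP=> nGf.
    have f2 : (y * c) ^+ 2 = 1.
      by rewrite expgMn; [rewrite sqK // c2 -(expgS j 1) j2 | apply: cKC].
    have Pf : y * c \in P by rewrite (subsetP sQP) // -defQ mem_mulg.
    have inv := inverts_der1 Pf nGf; rewrite f2 group1 in inv.
    have := inv isT e Ae; move: Ee; rewrite mem_Ohm1_der1 // -eq_invg_mul => /eqP-> Eef.
    apply: (noncomm x y) => //.
    have cef : commute e (y * c) by apply/commgP/conjg_fixP.
    have : commute (y * c) x.
      have Ex : x = e * c^-1 by rewrite Eec mulgK.
      rewrite Ex; apply: commuteM; first exact: commute_sym.
      apply: commuteV; apply/commute_sym; apply: commuteM => //; apply/commute_sym; exact: cKC.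
    move=> cycx; have Ey : y = y * c * c^-1 by rewrite mulgK.
    rewrite Ey; apply: commuteM; first exact: commute_sym.
    by apply: commuteV; apply: cKC.
  have [y Ky ny] := ex_y x Kx nx; have [ny' nxy] := njxy x y Kx Ky nx ny.
  have Gyc := Gf y Ky ny.
  have Gxyc : x * y * c \in G.
    by apply: Gf; [exact: groupM | rewrite groupMl ?cycle_id].
  have Gx : x \in G.
    have -> : x = x * y * c * (y * c)^-1 by rewrite invMg !mulgA mulgK mulgK.
    by rewrite groupM ?groupV.
  have Gc : c \in G by rewrite -(groupMl _ Gx) -Eec.
  have Gy : y \in G by rewrite -(groupMr _ Gc).
  have sKG : K \subset G.
    apply/subsetP=> k Kk; have sxG : {subset <[x]> <= G} by apply/subsetP; rewrite cycle_subG.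
    by case: (decK x y k Kx Ky nx ny Kk) => /sxG //; rewrite groupMl ?groupV.
  have cKc : <[c]> \subset 'C(K) by rewrite cycle_subG (subsetP cCK).
  have : K <*> <[c]> \subset K.
    apply: (noext (K <*> <[c]>)%G); rewrite ?joing_subl //.
    - by rewrite join_subG sKG cycle_subG.
    - by rewrite join_subG sKQ cycle_subG (subsetP sCQ).
    move=> h; rewrite /= cent_joinEr // => /mulsgP[k _ Kk /cycleP[i ->] ->].
    rewrite expgMn; last by apply/commuteX; apply: cKC.
    rewrite -expgM mulnC expgM c2 groupM ?mem_cycle //.
    have [jk | njk] := boolP (k \in <[j]>); first by rewrite groupX.
    by rewrite sqK // cycle_id.
  rewrite join_subG cycle_subG => /andP[_ Kc].
  have : c \in <[j]> by rewrite -capKC inE Kc.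
  by rewrite mem_j => /orP[]/eqP Ecj; move: c2; rewrite Ecj ?expg1n ?j2 => j1; rewrite -j1 eqxx in ntj.
(* This quotient embeds in [Q / K]. As [j] is central in [Q], [C] is abelian, and [Q = K * C]
   centralizes [E]. *)
have cyc : cyclic (C / <[j]>).
  have nKC : C \subset 'N(K) := subset_trans cCK (cent_sub _).
  rewrite -capKC (isog_cyclic (second_isog nKC)).
  by apply: cyclicS (split_cyclic split); rewrite quotientS.
have cCC : abelian C.
  apply: cyclic_factor_abelian cyc; rewrite subsetI cycle_subG Cj /=.
  by rewrite centsC (subset_trans sCQ).
have cEQ : Q \subset 'C(E).
  rewrite centsC (subset_trans sEC) // -defQ centM subsetI cCK; exact: cCC.
(* Otherwise [E] would embed in the cyclic group [C / <[j]>]. *)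
have sjE : <[j]> \subset E.
  apply/negPn/negP=> nsjE.
  have TI : <[j]> :&: E = 1 by rewrite prime_TIg // -orderE oj.
  have nE : E \subset 'N(<[j]>).
    by rewrite (subset_trans sEQ) // (subset_trans cQj) // cent_sub.
  have cycE : cyclic E.
    rewrite (isog_cyclic (quotient_isog nE TI)).
    by apply: cyclicS cyc; apply: quotientS.
  have := cyclic_abelem_prime abelem_Ohm1_der1 cycE.
  by rewrite -cardG_gt1 card_Ohm1_der1 => /(_ isT).
have Ej : j \in E by rewrite -cycle_subG.
have /subsetPn[k0 Kk0 nGk0] : ~~ (K \subset G).
  apply/negP=> sKG; have cKE : E \subset 'C(K) := subset_trans sEC cCK.
  have : K <*> E \subset K.
    apply: (noext (K <*> E)%G); rewrite ?joing_subl //.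
    - by rewrite join_subG sKG (subset_trans sEA).
    - by rewrite join_subG sKQ.
    move=> h; rewrite /= cent_joinEr // => /mulsgP[k e Kk Ee ->].
    rewrite expgMn; last by apply: cKC; rewrite ?(subsetP sEC).
    move: Ee; have [-> | //] := eqVneq (e ^+ 2) 1.
      rewrite mulg1 => _; have [jk | njk] := boolP (k \in <[j]>); first by rewrite groupX.
      by rewrite sqK // cycle_id.
    by move=> nt Ee; case/negP: nt; rewrite -mem_Ohm1_der1 ?(subsetP sEA).
  rewrite join_subG => /andP[_ sEK].
  have : E \subset <[j]> by rewrite -capKC subsetI sEK.
  by move/subset_leq_card; rewrite card_Ohm1_der1 -orderE oj.
(* As [t] is in [A], so is [x = [~ y, t]]: this yields an element of order 4 in [A :&: K] that
   commutes with [t], and hence a [y] outside [<[x]>]. *)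
have [y Ky nfy] := split_act split Nt nQQt; rewrite PhiK in nfy.
pose x := [~ y, t].
have Kx : x \in K by rewrite /x commgEl groupM ?groupV // memJ_norm.
have Ax : x \in A by rewrite mem_commg // (subsetP sKP).
have Gx := subsetP sAG x Ax.
have nx : x \notin <[j]> := nfy.
have nyx : y \notin <[x]>.
  apply: contra nfy => xy.
  have : commute y t.
    case/cycleP: xy => i ->; apply/commute_sym/commuteX; exact: (centsP cAA).
  by move/commgP/eqP => ->; apply: group1.
have nGy : y \notin G.
  apply/negP=> Gy; have sxG : {subset <[x]> <= G} by apply/subsetP; rewrite cycle_subG.
  by case: (decK x y k0 Kx Ky nx nyx Kk0) => /sxG; rewrite ?groupMl ?groupV // (negPf nGk0).
have [ny nxy] := njxy x y Kx Ky nx nyx.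
have Py := subsetP sKP y Ky.
(* The [K]-part of an element of [A :&: Q] commutes with [x], and [<[x]>] is its own centralizer in
   the quaternion group. *)
have AQ d : d \in A -> d \in Q -> exists i c, c \in C /\ d = x ^+ i * c.
  move=> Ad; rewrite -defQ => /mulsgP[k c Kk Cc Ed].
  have cxk : commute x k.
    have Ek : k = d * c^-1 by rewrite Ed mulgK.
    rewrite Ek; apply: commuteM; first exact: (centsP cAA).
    by apply: commuteV; apply: cKC.
  have : k \in <[x]> by apply/negPn/negP=> nk; apply: (noncomm x k).
  by case/cycleP=> i Ei; exists i, c; rewrite -Ei.
have xy : x ^ y = x^-1 by apply: invxy.
have AQ2 d : d \in A -> d \in Q -> d ^ y = d^-1 -> d ^+ 2 \in <[j]>.
  move=> Ad Qd; have [i [c [Cc Ed]]] := AQ d Ad Qd.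
  have cxc : commute (x ^+ i) c by apply: cKC; rewrite ?groupX.
  rewrite Ed conjMg conjXg xy expgVn (_ : c ^ y = c); last first.
    by apply/conjg_fixP/commgP; apply/commute_sym; apply: cKC.
  rewrite cxc invMg => /mulgI Ecc; rewrite expgMn //.
  have -> : c ^+ 2 = 1 by rewrite expgS expg1 {1}Ecc mulVg.
  by rewrite mul1g -expgM mulnC expgM sqK // mem_cycle.
(* The conjugate [d = x ^ g] has square [j ^ g] and normalizes [Q]. If [d] is in [Q], then [y]
   inverts it and its square falls in [<[j]>]. If not, [t] differs from [d] by an element of
   [A :&: Q], which puts [x = [~ y, t]] in [E] although its square is [j]. *)
have Zj : j \in 'Z(P).
  rewrite inE (subsetP sKP) //=; apply/centP=> g Pg; apply/commgP/conjg_fixP.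
  pose d := x ^ g; have Ad : d \in A by rewrite memJ_norm // (subsetP (der_norm 1 P)).
  have d2 : d ^+ 2 = j ^ g by rewrite -conjXg sqK.
  have Ed2 : d ^+ 2 \in E by rewrite d2 memJ_norm // (subsetP (normal_norm nEP)).
  have Nd := sqr_Ohm1_norm cEQ Ad Ed2.
  have [Qd | nQd] := boolP (d \in Q).
    have dy : d ^ y = d^-1.
      have -> : d ^ y = (x ^ (y ^ g^-1)) ^ g.
        by rewrite /d -!conjgM -conjgCV.
      have Ar : [~ y, g^-1] \in A by rewrite mem_commg ?groupV.
      have -> : y ^ g^-1 = y * [~ y, g^-1] by rewrite commgEl mulKVg.
      rewrite conjgM xy -conjVg; congr (_ ^ g); apply/conjg_fixP/commgP.
      by apply: (centsP cAA); rewrite ?groupV.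
    have := AQ2 d Ad Qd dy; rewrite d2 mem_j => /orP[] /eqP //.
    by move/eqP; rewrite conjg_eq1 (negPf ntj).
  have Qdt : d^-1 * t \in Q by apply: (index_le2_mulVg nQ i2).
  have Aq : d^-1 * t \in A by rewrite groupM ?groupV.
  have [i [c [Cc Eq]]] := AQ _ Aq Qdt.
  have Et : t = d * (x ^+ i * c) by rewrite -Eq mulKVg.
  have Ex : x \in E.
    rewrite {1}/x Et commgMJ groupM //.
      rewrite commgMJ (_ : [~ y, c] = 1) ?mul1g; last by apply/eqP/commgP; apply: cKC.
      have cjc : c \in P by rewrite (subsetP sCP).
      rewrite memJ_norm; last by rewrite (subsetP (normal_norm nEP)).
      rewrite -invg_comm groupV commgEl conjXg xy expgVn -invMg groupV.
      rewrite -expgD addnn -mul2n expgM sqK // groupX //.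
    rewrite memJ_norm; last by rewrite (subsetP (normal_norm nEP)) // (subsetP sQP) // -Eq.
    by rewrite -invg_comm groupV comm_sqr_Ohm1 ?(subsetP sKQ).
  move: Ex; rewrite mem_Ohm1_der1 // sqK //; by rewrite (negPf ntj).
have y2 : y ^+ 2 = j by apply: sqK.
have inv : {in A, forall d, d ^ y = d^-1} by apply: inverts_der1; rewrite ?y2.
have t2 : t ^+ 2 = x.
  by rewrite /x commgEr conjVg inv // invgK expgS expg1.
have AQj d : d \in A -> d \in Q -> d ^+ 2 \in <[j]>.
  by move=> Ad Qd; apply: AQ2 => //; apply: inv.
(* Otherwise [t^-1 * d] would be in [A :&: Q] with square in [<[j]>], and [x = t ^+ 2] would lie in
   [E]. *)
have sqQ d : d \in A -> d ^+ 2 \in E -> d \in Q.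
  move=> Ad Ed; apply/negPn/negP=> nQd; have Nd := sqr_Ohm1_norm cEQ Ad Ed.
  have Qtd : t^-1 * d \in Q by apply: (index_le2_mulVg nQ i2).
  have Atd : t^-1 * d \in A by rewrite groupM ?groupV.
  have Ej2 := subsetP sjE _ (AQj _ Atd Qtd).
  have Ex : x \in E.
    rewrite -(groupMr _ Ej2) -t2 -expgMn ?mulKVg //; exact: (centsP cAA).
  by move: Ex; rewrite mem_Ohm1_der1 // sqK // (negPf ntj).
apply: (Ohm1_normalizer_absurd (Q := Q) (w := y) (t := t)) => //.
- exact: (subsetP sKQ).
- by rewrite y2.
- by rewrite y2.
- apply/negP=> sEPhi.
  have : E \subset <[j]>.
    apply/subsetP=> e Ee; have := subsetP sEPhi e Ee.
    rewrite Phi_der1E => /imsetP[d Ad Ed]; rewrite Ed AQj //.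
    by apply: sqQ; rewrite -?Ed.
  by move/subset_leq_card; rewrite card_Ohm1_der1 -orderE oj.
- apply/subsetP=> g Pg; rewrite inE; apply/subsetP=> _ /imsetP[d /setIP[Ad Qd] ->].
  have Adg : d ^ g \in A by rewrite memJ_norm // (subsetP (der_norm 1 P)).
  rewrite inE Adg sqQ // -conjXg memJ_norm ?(subsetP sjE) ?AQj //.
  by rewrite (subsetP (normal_norm nEP)).
(* The factor in [A :&: Q] is a power of [x], namely [k] or [k * y^-1]; what remains is [c] or
   [y * c], and commutes with [y]. *)
apply/subsetP=> q /setIP[Qq Gq]; have : q \in K * C by rewrite defQ.
case/mulsgP=> k c Kk Cc Eq.
have sxAQ : {subset <[x]> <= A :&: Q}.
  by apply/subsetP; rewrite cycle_subG inE Ax (subsetP sKQ).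
have mem u : u \in <[x]> -> u^-1 * q \in 'C[y] -> q \in (A :&: Q) * 'C_(Q :&: G)[y].
  move=> xu cu; apply/mulsgP; exists u (u^-1 * q); rewrite ?mulKVg ?sxAQ //.
  have /setIP[Au Qu] := sxAQ u xu.
  by rewrite inE cu inE !groupM ?groupV // (subsetP sAG).
case: (decK x y k Kx Ky nx nyx Kk) => xk.
  apply: (mem k) => //; rewrite Eq mulKg; apply/cent1P/commute_sym; exact: cKC.
have xu : k * y^-1 \in <[x]>.
  have nyx' : y \in 'N(<[x]>).
    by rewrite inE -cycleJ cycle_subG xy groupV cycle_id.
  have -> : k * y^-1 = (y^-1 * k) ^ y^-1 by rewrite /conjg invgK mulgA mulKVg.
  by rewrite memJ_norm ?groupV.
apply: (mem (k * y^-1)) => //; rewrite invMg invgK Eq -mulgA mulKg.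
by apply/cent1P; apply/commute_sym; apply: commuteM => //; apply: cKC.
Qed.

End Essential.

(** Elements of square 1 outside ['Phi(P)] invert [A], hence commute with [tau]. As [w] does not, it
    lies in ['Phi(P)]; multiplying by an involution of [C1] takes it outside again. When [C1] is
    trivial, [Q] is so small that counting the conjugates of [w] gives [A = 'Phi(P)]. *)
Lemma Ohm1_split_absurd (Q C1 : {group gT}) v w tau :
    Q \subset P -> 'C_P(Q) \subset Q -> tau \in E -> v \in 'Z(P) ->
    w \in Q -> w ^+ 2 = 1 -> [~ w, tau] != 1 ->
    C1 \subset Q -> C1 \subset 'C(E) -> C1 \subset 'C[w] -> E :&: C1 = 1 ->
    Q \subset (<[v]> <*> <[w]>) * C1 -> #|<[v]> <*> <[w]>| <= 4 ->
  False.
Proof.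
move=> sQP cQ Et Zv Qw w2 ntwt sC1Q cEC1 cwC1 TI dec le4.
have At := subsetP sEA tau Et; have Pw := subsetP sQP w Qw.
have cent u : u \in P -> u \notin G -> u ^+ 2 = 1 -> commute u tau.
  move=> Pu nGu u2; have inv : {in A, forall d, d ^ u = d^-1}.
    by apply: inverts_der1; rewrite ?u2 ?group1.
  apply/commute_sym/commgP/conjg_fixP; rewrite inv //.
  by apply/eqP; rewrite eq_invg_mul -(expgS tau 1) -mem_Ohm1_der1.
have Gw : w \in G.
  by apply/negPn/negP=> nGw; case/negP: ntwt; apply/commgP; apply: cent.
have [C1_1 | ntC1] := eqVneq (C1 : {set gT}) 1.
  have sQ : Q \subset <[v]> <*> <[w]> by rewrite C1_1 mulg1 in dec.
  have sCQ : 'C_P[w] \subset Q.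
    apply: subset_trans cQ; rewrite subsetI subsetIl /= centsC (subset_trans sQ) //.
    rewrite join_subG !cycle_subG; case/setIP: Zv => _ cv.
    by rewrite (subsetP (centS (subsetIl _ _)) v cv) -sub_cent1 subsetIr.
  (* The conjugates of [w] lie in the coset [w *: A], and they number at least [#|P| / 4], the order
     of ['Phi(P)], because ['C_P[w]] has order at most 4. *)
  have leG : #|G| <= #|A|.
    have : #|w ^: P| <= #|A|.
      have sw : w ^: P \subset w *: A.
        apply/subsetP=> _ /imsetP[g Pg ->].
        by rewrite mem_lcoset -commgEl mem_commg.
      by rewrite (leq_trans (subset_leq_card sw)) // card_lcoset.
    apply: leq_trans; rewrite -index_cent1.
    have leC : #|'C_P[w]| <= 4.
      by rewrite (leq_trans (subset_leq_card (subset_trans sCQ sQ))).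
    rewrite -(leq_pmul2r (isT : 0 < 4)) -{1}iG Lagrange ?Phi_sub //.
    by rewrite -(Lagrange (subsetIl P 'C[w])) mulnC leq_mul2l leC orbT.
  have Aw : w \in A.
    by have /eqP-> : A == G by rewrite eqEcard sAG.
  by case/negP: ntwt; apply/commgP; apply: (centsP cAA).
have pC1 : 2.-group C1 := pgroupS (subset_trans sC1Q sQP) pP.
have [_ dv _] := pgroup_pdiv pC1 ntC1.
have [i C1i oi] := Cauchy (p := 2) isT dv.
have Qi := subsetP sC1Q i C1i; have Pi := subsetP sQP i Qi.
have cit : commute i tau by apply: (centP (subsetP cEC1 i C1i)).
have ciw : commute i w by apply/cent1P; apply: (subsetP cwC1).
have i2 : i ^+ 2 = 1 by rewrite -oi expg_order.
have nGi : i \notin G.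
  apply/negP=> Gi.
  have abI : 2.-abelem <[i]> by rewrite prime_abelem // -orderE.
  have cEI : <[i]> \subset 'C(E) by rewrite cycle_subG (subsetP cEC1).
  have TIi : E :&: <[i]> = 1.
    by apply/trivgP; rewrite -TI setIS // cycle_subG.
  have dpr : E \x <[i]> = E <*> <[i]> by rewrite dprodE // -?cent_joinEr.
  have := card_abelem_Phi (L := (E <*> <[i]>)%G).
  rewrite join_subG (subset_trans sEA sAG) cycle_subG Gi -(dprod_card dpr).
  rewrite (dprod_abelem _ dpr) abelem_Ohm1_der1 abI card_Ohm1_der1.
  by move=> /(_ isT isT); rewrite -orderE oi.
have : commute (i * w) tau.
  apply: cent; [exact: groupM | by rewrite groupMr |].
  by rewrite expgMn // i2 w2 mulg1.
move=> c_iw; case/negP: ntwt; apply/commgP.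
have -> : w = i^-1 * (i * w) by rewrite mulKg.
by apply/commute_sym; apply: commuteM; [apply/commuteV/commute_sym | apply/commute_sym].
Qed.

End NoncyclicDer1.

(** * Coprime action and commutator maps *)

Lemma coprime_comm_cent (gT : finGroupType) (Q A : {group gT}) :
  A \subset 'N(Q) -> coprime #|Q| #|A| -> solvable Q ->
  [~: Q, A] * 'C_Q(A) = Q.
Proof.
move=> nQA coQA solQ; have sRQ : [~: Q, A] \subset Q by rewrite commg_subl.
have nRQ : Q \subset 'N([~: Q, A]) := commg_norml Q A.
have nRA : A \subset 'N([~: Q, A]) := commg_normr A Q.
have := coprime_quotient_cent sRQ nRA coQA solQ.
have -> : 'C_(Q / [~: Q, A])(A / [~: Q, A]) = Q / [~: Q, A].
  by apply/setIidPl; rewrite quotient_cents2r.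
move=> E; apply/eqP; rewrite eqEsubset mul_subG ?subsetIl //=.
rewrite -(quotientK (H := [~: Q, A])); last by rewrite subIset ?nRQ.
by rewrite E quotientGK // /normal sRQ.
Qed.

Lemma coprime_commGid (gT : finGroupType) (Q A : {group gT}) :
  A \subset 'N(Q) -> coprime #|Q| #|A| -> solvable Q ->
  [~: Q, A, A] = [~: Q, A].
Proof.
move=> nQA coQA solQ; have defQ := coprime_comm_cent nQA coQA solQ.
set R := [~: Q, A] in defQ *; apply/eqP; rewrite eqEsubset.
rewrite commg_subl commg_normr /=.
have nRC : 'C_Q(A) \subset 'N([~: R, A]).
  rewrite normsR //; first by rewrite subIset // commg_norml.
  by rewrite subIset // orbC cents_norm ?subsetIr // centsC centsC.
rewrite {1}/R gen_subG; apply/subsetP=> _ /imset2P[q a Qq Aa ->].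
move: Qq; rewrite -defQ => /mulsgP[r c Rr /setIP[Qc /centP cc] ->].
rewrite commMgJ (_ : [~ c, a] = 1) ?mulg1; last by apply/eqP/commgP; apply: cc.
rewrite memJ_norm ?mem_commg //; apply: (subsetP nRC).
by rewrite inE Qc; apply/centP.
Qed.

Lemma comm_morphism (gT : finGroupType) (V : {group gT}) a :
    abelian V -> a \in 'N(V) ->
  exists f : {morphism V >-> gT}, (forall v, f v = [~ v, a]) /\ 'ker f = 'C_V[a].
Proof.
move=> cVV nVa.
have fV v : v \in V -> [~ v, a] \in V.
  by move=> Vv; rewrite commgEl groupM ?groupV // memJ_norm.
have fM : {in V &, {morph (fun v => [~ v, a]) : x y / x * y}}.
  move=> x y Vx Vy /=; rewrite commMgJ /conjg.
  by rewrite (centsP cVV _ (fV x Vx) y Vy) mulKg.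
exists (Morphism fM); split=> //.
apply/setP=> v; apply/idP/setIP=> [kv | [Vv /cent1P cv]].
  have Vv := dom_ker kv; split=> //; apply/cent1P/commgP/eqP; exact: mker kv.
by apply/kerP => //=; apply/eqP/commgP.
Qed.

Lemma card_comm_cent1 (gT : finGroupType) (V W : {group gT}) a :
    abelian V -> a \in 'N(V) -> (forall v, v \in V -> [~ v, a] \in W) ->
  #|V| <= #|W| * #|'C_V[a]|.
Proof.
move=> cVV nVa sW; have [f [fE kerf]] := comm_morphism cVV nVa.
have := card_morphim f V; rewrite setIid kerf => Ec.
rewrite -(Lagrange (subsetIl V 'C[a])) mulnC leq_mul2r -Ec; apply/orP; right.
apply: subset_leq_card; apply/subsetP=> _ /morphimP[v _ Vv ->].
by rewrite fE sW.
Qed.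

Lemma nontriv_cent1_pgroup (gT : finGroupType) (p : nat) (V : {group gT}) s :
  p.-group V -> p.-elt s -> s \in 'N(V) -> V :!=: 1 -> 'C_V[s] != 1.
Proof.
move=> pV ps nVs ntV; pose J := (V <*> <[s]>)%G.
have nVs' : <[s]> \subset 'N(V) by rewrite cycle_subG.
have pJ : p.-group J by rewrite /J /= norm_joinEr // pgroupM pV.
have nVJ : V <| J by rewrite /normal joing_subl join_subG normG.
apply: contra (meet_center_nil (pgroup_nil pJ) nVJ ntV).
move/eqP=> C1; rewrite -subG1 -C1 setIS // subIset //; apply/orP; right.
by rewrite -cent_cycle centS // joing_subr.
Qed.

(** Commutation with [a] is an endomorphism of the abelian group [V]; the hypothesis makes it onto,
    hence injective. *)
Lemma comm_cycle_id_cent1 (gT : finGroupType) (V : {group gT}) a :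
  abelian V -> a \in 'N(V) -> [~: V, <[a]>] = V -> 'C_V[a] = 1.
Proof.
move=> cVV nVa defV; have [f [fE kerf]] := comm_morphism cVV nVa.
have sVf : V \subset f @* V.
  rewrite -{1}defV gen_subG; apply/subsetP=> _ /imset2P[v _ Vv /cycleP[i ->] ->].
  have im u : u \in V -> [~ u, a] \in f @* V by move=> Vu; rewrite -fE mem_morphim.
  elim: i => [|i IH]; first by rewrite commg1 group1.
  rewrite expgSr commgMJ groupM ?im //; case/morphimP: IH => u _ Vu ->.
  by rewrite fE conjRg {2}/conjg mulKg im // memJ_norm.
have := card_morphim f V; rewrite setIid => Ec.
have skV : 'ker f \subset V := normal_sub (ker_normal f).
have leV : #|V| <= #|V : 'ker f| by rewrite -Ec subset_leq_card.
have : #|'ker f| <= 1.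
  by rewrite -(leq_pmul2r (indexg_gt0 V ('ker f))) mul1n Lagrange.
by rewrite -trivg_card_le1 -kerf => /eqP.
Qed.

Lemma coprime_cent_Phi (gT : finGroupType) (p : nat) (Q A : {group gT}) :
  p.-group Q -> coprime #|Q| #|A| -> A \subset 'N(Q) ->
  [~: Q, A] \subset 'Phi(Q) -> A \subset 'C(Q).
Proof.
move=> pQ coQA nQA sPhi; rewrite centsC; apply/setIidPl.
have defQ := coprime_comm_cent nQA coQA (pgroup_sol pQ).
rewrite -[LHS]genGid; apply: Phi_nongen; apply/eqP; rewrite eqEsubset.
rewrite join_subG Phi_sub subsetIl /= -{1}defQ mul_subG ?joing_subr //.
exact: subset_trans sPhi (joing_subl _ _).
Qed.

Lemma conjg_odd_fix (gT : finGroupType) (a v : gT) n :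
  odd #[a] -> v ^ (a ^+ (2 ^ n)) = v -> v ^ a = v.
Proof.
move=> oa fv; have : a \in 'C[v].
  have : a \in <[a ^+ (2 ^ n)]>.
    have /eqP<- : generator <[a]> (a ^+ (2 ^ n)); last exact: cycle_id.
    by rewrite generator_coprime coprimeXr // coprimen2.
  apply: subsetP; rewrite cycle_subG; apply/cent1P/commute_sym/commgP/conjg_fixP.
  exact: fv.
by move/cent1P=> cav; apply/conjg_fixP/commgP; apply: commute_sym.
Qed.

(** [a] acts irreducibly, which makes [t ^+ 2] act trivially, so [t] and [t ^ a] each fix at least 4
    of the 8 elements. In order 8 two such fixed subgroups share a nontrivial element, which is
    fixed by [t^-1 * t ^ a = a ^+ 2], hence by [a]. *)
Lemma card8_inverted_absurd (gT : finGroupType) (V : {group gT}) (a t : gT) :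
    2.-abelem V -> #|V| = 8 -> a \in 'N(V) -> t \in 'N(V) -> odd #[a] -> 2.-elt t ->
    a ^ t = a^-1 -> [~: V, <[a]>] = V ->
  False.
Proof.
move=> abV oV nVa nVt oa p2t a_t defV.
have cVV := abelem_abelian abV; have pV := abelem_pgroup abV.
have fix1 := comm_cycle_id_cent1 cVV nVa defV.
have fixv v : v \in V -> v ^ a = v -> v = 1.
  move=> Vv va; apply/set1P; rewrite -[[set 1]]fix1 inE Vv; apply/cent1P.
  by apply/commgP/conjg_fixP.
(* An invariant subgroup of order 2 would consist of fixed points, and one of index 2 would contain
   [[~: V, <[a]>]]. *)
have card_inv (W : {group gT}) : W \subset V -> a \in 'N(W) -> W :!=: 1 -> W :=: V.
  move=> sWV nWa ntW; have pW := pgroupS sWV pV.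
  have [_ dv [k oW]] := pgroup_pdiv pW ntW.
  have n2 : #|W| != 2.
    apply/eqP=> oW2; have /subsetPn[v Wv nv] : ~~ (W \subset 1%G).
      by apply/negP=> /subset_leq_card; rewrite oW2 cards1.
    have nva : v ^ a \notin 1%G by move: nv; rewrite !inE conjg_eq1.
    have : v^-1 * v ^ a \in 1%G.
      by apply: (index_le2_mulVg (sub1G W) _ Wv _ nv nva); rewrite ?indexg1 ?oW2 ?memJ_norm.
    rewrite inE => /eqP E1; have va : v ^ a = v by rewrite -[v ^ a](mulKVg v) E1 mulg1.
    by have v1 := fixv v (subsetP sWV v Wv) va; rewrite v1 group1 in nv.
  have n4 : #|V : W| != 2.
    apply/eqP=> i2; suff sVW : V \subset W.
      by have := subset_leq_card sVW; rewrite -(Lagrange sWV) i2 leqNgt ltn_Pmulr.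
    have Wva v : v \in V -> [~ v, a] \in W.
      move=> Vv; rewrite commgEl; have [Wv | nWv] := boolP (v \in W).
        by rewrite groupM ?groupV ?memJ_norm.
      by apply: (index_le2_mulVg sWV); rewrite ?i2 ?memJ_norm.
    rewrite -defV gen_subG; apply/subsetP=> _ /imset2P[v _ Vv /cycleP[i ->] ->].
    elim: i => [|i IH]; first by rewrite commg1.
    by rewrite expgSr commgMJ groupM ?Wva ?memJ_norm.
  apply/eqP; rewrite eqEcard sWV oV oW /=.
  move: n2 n4; rewrite -divgS // oV oW.
  have : 2 ^ k.+1 %| 8 by rewrite -oW -oV cardSg.
  by rewrite -[8]/(2 ^ 3)%N dvdn_Pexp2l //; case: k {oW} => [|[|[|]]].
have ct2 : t ^+ 2 \in 'C(V).
  have nVt2 : t ^+ 2 \in 'N(V) by rewrite groupX.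
  rewrite -sub_cent1; apply/setIidPl; apply: (card_inv 'C_V[t ^+ 2]%G); rewrite ?subsetIl //.
    have ca : commute a (t ^+ 2).
      by apply/commgP/conjg_fixP; rewrite expgS expg1 conjgM a_t conjVg a_t invgK.
    rewrite -cycle_subG normsI //; first by rewrite cycle_subG.
    by apply: subset_trans (normG _); rewrite cycle_subG; apply/cent1P.
  by apply: (nontriv_cent1_pgroup pV) => //; rewrite ?p_eltX // -cardG_gt1 oV.
have le4 : 4 <= #|'C_V[t]|.
  have : 8 <= #|'C_V[t]| * #|'C_V[t]|.
    rewrite -oV; apply: (card_comm_cent1 (W := 'C_V[t]%G)) => // v Vv.
    have Vvt : [~ v, t] \in V by rewrite commgEl groupM ?groupV ?memJ_norm.
    apply/setIP; split=> //; apply/cent1P/commgP/conjg_fixP.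
    have [_ ex] := abelemP (isT : prime 2) abV.
    have E1 : [~ v, t] * [~ v, t] ^ t = 1.
      rewrite -commgMJ -(expgS t 1); apply/eqP/commgP; apply/commute_sym.
      exact: (centP ct2).
    have := ex _ Vvt; rewrite expgS expg1 -[RHS]E1 => /mulgI/esym //.
  have := cardSg (subsetIl V 'C[t]); rewrite oV -[8]/(2 ^ 3)%N.
  by case/dvdn_pfactor => // [[|[|m]]] // _ -> // _; rewrite !expnS mulnA leq_pmulr ?expn_gt0.
have oCa : #|'C_V[t ^ a]| = #|'C_V[t]|.
  by rewrite -(cardJg 'C_V[t] a) conjIg (normP nVa) -!cent_cycle -centJ -cycleJ.
have /subsetPn[v /setIP[/setIP[Vv /cent1P c1] /setIP[_ /cent1P c2]] nv] :
    ~~ ('C_V[t] :&: 'C_V[t ^ a] \subset 1%G).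
  apply/negP=> /trivgP TI; have := mul_cardG 'C_V[t] 'C_V[t ^ a].
  rewrite TI cards1 muln1 oCa => E1.
  have : #|'C_V[t] * 'C_V[t ^ a]| <= 8.
    by rewrite -oV subset_leq_card // mul_subG ?subsetIl.
  by rewrite -E1 leqNgt (leq_trans _ (leq_mul le4 le4)).
have Eta : t^-1 * t ^ a = a ^+ 2.
  by rewrite -commgEl commgEr conjVg a_t invgK expgS expg1.
case/negP: nv; rewrite inE; apply/eqP/fixv => //; apply: (conjg_odd_fix (n := 1) oa).
rewrite expn1 -Eta; apply/conjg_fixP/commgP; apply: commuteM => //.
by apply: commuteV.
Qed.

Lemma index_Phi_le8 (gT : finGroupType) (Q Q0 : {group gT}) :
    2.-group Q -> Q0 \subset Q -> #|Q : Q0| <= 2 -> #|Q0 : 'Phi(Q0)| <= 4 ->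
  #|Q : 'Phi(Q)| <= 8.
Proof.
move=> pQ sQ0 i2 i4; have sPhi : 'Phi(Q0) \subset 'Phi(Q) := PhiS pQ sQ0.
apply: leq_trans (dvdn_leq (indexg_gt0 _ _) (indexgS Q sPhi)) _.
by rewrite -(Lagrange_index sQ0 (Phi_sub _)) -[8]/(2 * 4)%N leq_mul.
Qed.

(** * The structure of [[Q, a]] when [a] has odd order and is inverted by [t] *)

Section InvertedAction.

Variables (gT : finGroupType) (Q Q0 : {group gT}) (a t : gT).
Hypothesis pQ : 2.-group Q.
Hypothesis nQa : a \in 'N(Q).
Hypothesis oa : odd #[a].
Hypothesis ncQa : a \notin 'C(Q).
Hypothesis nQt : t \in 'N(Q).
Hypothesis p2t : 2.-elt t.
Hypothesis a_t : a ^ t = a^-1.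
Hypothesis sQ0 : Q0 \subset Q.
Hypothesis iQ0 : #|Q : Q0| <= 2.
Hypothesis rk : forall L : {group gT}, L \subset Q0 -> #|L : 'Phi(L)| <= 4.

Local Notation K := [~: Q, <[a]>].
Local Notation C := 'C_Q[a].

Let nQA : <[a]> \subset 'N(Q). Proof. by rewrite cycle_subG. Qed.

Let co2 (H : {group gT}) : 2.-group H -> coprime #|H| #|<[a]>|.
Proof. by case/p_natP=> k ->; rewrite coprimeXl // coprime2n. Qed.

Lemma inv_comm_sub : K \subset Q. Proof. by rewrite commg_subl. Qed.
Let sKQ := inv_comm_sub.
Let pK : 2.-group K := pgroupS sKQ pQ.

Lemma inv_comm_normal : K <| Q.
Proof. by rewrite /normal sKQ commg_norml. Qed.

Lemma inv_mul : K * C = Q.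
Proof.
by rewrite -cent_cycle; apply: coprime_comm_cent; rewrite ?co2 ?(pgroup_sol pQ).
Qed.

Let nKa : a \in 'N(K).
Proof. by rewrite -cycle_subG commg_normr. Qed.

Lemma inv_norm_cycle : t \in 'N(<[a]>).
Proof. by rewrite inE -cycleJ a_t cycleV. Qed.

Lemma inv_norm_comm : t \in 'N(K).
Proof.
by rewrite -cycle_subG normsR // cycle_subG ?inv_norm_cycle.
Qed.
Let nKt := inv_norm_comm.

Lemma inv_norm_cent : t \in 'N(C).
Proof.
rewrite -cycle_subG normsI ?cycle_subG // -cent_cycle.
exact: (subsetP (norms_cent _)) inv_norm_cycle.
Qed.

Lemma inv_commGid : [~: K, <[a]>] = K.
Proof. by apply: coprime_commGid; rewrite ?co2 ?(pgroup_sol pQ). Qed.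

(** Since [K = [~: K, <[a]>]], [a] has no nontrivial fixed point on an abelian quotient of [K]. *)
Lemma inv_fix (N : {group gT}) k : N <| K -> a \in 'N(N) -> abelian (K / N) ->
  k \in K -> [~ k, a] \in N -> k \in N.
Proof.
move=> nNK nNa cKN Kk Nka; have nNk := subsetP (normal_norm nNK) k Kk.
have := comm_cycle_id_cent1 (V := (K / N)%G) (a := coset N a) cKN.
rewrite (subsetP (quotient_norm _ _)) ?mem_quotient // => /(_ isT).
rewrite -quotient_cycle // -quotientR ?cycle_subG //; last by rewrite normal_norm.
rewrite inv_commGid => /(_ erefl) fix1.
rewrite -coset_eq1 //; apply/eqP/set1P; rewrite -[[set 1]]fix1.
apply/setIP; split; first by rewrite mem_quotient.
by apply/cent1P/commgP; rewrite -morphR //= coset_id.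
Qed.

Lemma inv_index_neq2 (N H : {group gT}) : N <| K -> a \in 'N(N) -> abelian (K / N) ->
  N \subset H -> H \subset K -> a \in 'N(H) -> #|H : N| != 2.
Proof.
move=> nNK nNa cKN sNH sHK nHa; apply/eqP=> i2.
have /subsetPn[h Hh nNh] : ~~ (H \subset N) by rewrite -indexg_gt1 i2.
case/negP: (nNh); apply: (inv_fix nNK) => //; first exact: (subsetP sHK).
rewrite commgEl; apply: (index_le2_mulVg sNH); rewrite ?i2 ?memJ_norm //.
Qed.

Let sPhiK : 'Phi(K) \subset K := Phi_sub _.
Let nPhiK : 'Phi(K) <| K := Phi_normal _.
Let nPhia : a \in 'N('Phi(K)).
Proof. exact: (subsetP (char_norms (Phi_char _))). Qed.
Let nPhit : t \in 'N('Phi(K)).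
Proof. exact: (subsetP (char_norms (Phi_char _))). Qed.
Let abV : 2.-abelem (K / 'Phi(K)) := Phi_quotient_abelem pK.
Let cV : abelian (K / 'Phi(K)) := abelem_abelian abV.

Let ncK : K :!=: 1.
Proof.
apply: contra ncQa => /eqP K1; rewrite -cycle_subG centsC.
by apply/commG1P.
Qed.

Lemma inv_cap_sub (H : {group gT}) : H \subset Q -> #|H : H :&: Q0| <= 2.
Proof.
move=> sHQ; rewrite indexgI; apply: leq_trans iQ0.
by apply: subset_leq_card; apply: imsetS.
Qed.

Lemma inv_index_Phi_le8 (H : {group gT}) : H \subset Q -> #|H : 'Phi(H)| <= 8.
Proof.
move=> sHQ; apply: (index_Phi_le8 (Q0 := (H :&: Q0)%G) (pgroupS sHQ pQ)); first exact: subsetIl.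
  exact: inv_cap_sub.
by rewrite rk ?subsetIr.
Qed.

(** The rank hypothesis gives at most 8; order 2 would consist of fixed points of [a], and order 8
    is [card8_inverted_absurd]. *)
Lemma inv_index_Phi : #|K : 'Phi(K)| = 4.
Proof.
have n2 : #|K : 'Phi(K)| != 2 by apply: inv_index_neq2.
have le8 := inv_index_Phi_le8 sKQ.
have gt1 : 1 < #|K : 'Phi(K)| by rewrite indexg_gt1 proper_subn // Phi_proper.
have n8 : #|K : 'Phi(K)| != 8.
  apply/eqP=> i8; have nPhiK' := normal_norm nPhiK.
  apply: (card8_inverted_absurd (V := (K / 'Phi(K))%G) (a := coset 'Phi(K) a) (t := coset 'Phi(K) t)) => //.
  - by rewrite card_quotient.
  - by rewrite (subsetP (quotient_norm _ _)) ?mem_quotient.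
  - by rewrite (subsetP (quotient_norm _ _)) ?mem_quotient.
  - exact: dvdn_odd (morph_order (coset_morphism 'Phi(K)) nPhia) oa.
  - exact: morph_p_elt.
  - by rewrite -morphJ //= a_t morphV.
  by rewrite -quotient_cycle // -quotientR ?cycle_subG // inv_commGid.
have := pnat_dvd (dvdn_indexg K 'Phi(K)) pK => /p_natP[k Ek].
move: n2 le8 gt1 n8; rewrite Ek; case: k {Ek} => [|[|[|[|k]]]] // _.
by rewrite -[8]/(2 ^ 3)%N leq_exp2l.
Qed.

(** No subgroup of order 2 of [K / 'Phi(K)] is invariant under [a], so [x] and [x ^ a] are
    independent there. *)
Lemma inv_gen x : x \in K -> x \notin 'Phi(K) -> <[x]> <*> <[x ^ a]> = K.
Proof.
move=> Kx nx; rewrite -[LHS]genGid; apply: Phi_nongen.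
pose J := ('Phi(K) <*> (<[x]> <*> <[x ^ a]>))%G; pose H := ('Phi(K) <*> <[x]>)%G.
have Kxa : x ^ a \in K by rewrite memJ_norm.
have sJK : J \subset K by rewrite !join_subG Phi_sub !cycle_subG Kx Kxa.
have sHJ : H \subset J.
  by rewrite join_subG joing_subl (subset_trans (joing_subl _ <[x ^ a]>)) ?joing_subr.
have sPhiH : 'Phi(K) \subset H := joing_subl _ _.
have sHK := subset_trans sHJ sJK.
have Hx : x \in H by rewrite (subsetP (joing_subr _ _)) ?cycle_id.
have gt1 : 1 < #|H : 'Phi(K)|.
  by rewrite indexg_gt1; apply: contra nx => /subsetP; apply.
have i2 : #|H : 'Phi(K)| = 2.
  have nPhiH : H \subset 'N('Phi(K)) := subset_trans sHK (normal_norm nPhiK).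
  rewrite -card_quotient // (cyclic_abelem_prime (p := 2)) //.
  - exact: abelemS (quotientS _ sHK) abV.
  - rewrite /H /= quotientYidl ?quotient_cyclic ?cycle_cyclic // cycle_subG.
    exact: (subsetP nPhiH).
  by rewrite -subG1 quotient_sub1 // -indexg_gt1.
have nHxa : x ^ a \notin H.
  apply/negP=> Hxa; have nHa : a \in 'N(H).
    rewrite inE -genJ gen_subG conjUg subUset -cycleJ cycle_subG Hxa.
    by rewrite (normP nPhia) sPhiH.
  by have := inv_index_neq2 nPhiK nPhia cV sPhiH sHK nHa; rewrite i2.
have gtJ : 1 < #|J : H|.
  rewrite indexg_gt1; apply: contra nHxa => /subsetP; apply.
  by rewrite (subsetP (joing_subr _ _)) // (subsetP (joing_subr _ _)) // cycle_id.
have := Lagrange_index sJK (subset_trans sPhiH sHJ); rewrite inv_index_Phi.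
rewrite -(Lagrange_index sHJ sPhiH) i2 => E4.
apply/eqP; rewrite eqEsubset sJK -indexg_eq1 /=.
have := indexg_gt0 K J; case: #|K : J| E4 => // [[|n]] // E4 _.
have : n.+2 * 4 <= 4 by rewrite -[X in _ <= X]E4 leq_mul2l (leq_mul gtJ (leqnn 2)) orbT.
by rewrite mulSn -[X in _ <= X]addn0 leq_add2l mulSn.
Qed.

Lemma inv_cap : K :&: C \subset 'Phi(K).
Proof.
apply/subsetP=> k /setIP[Kk /setIP[_ /cent1P ck]].
apply: (inv_fix nPhiK) => //; suff -> : [~ k, a] = 1 by apply: group1.
by apply/eqP/commgP.
Qed.

Let exx : exists2 x, x \in K & x \notin 'Phi(K).
Proof. by apply/subsetPn; rewrite proper_subn // Phi_proper. Qed.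

(** An element of [C] is a 2-element, so it fixes some nontrivial [x] of [K / 'Phi(K)]; commuting
    with [a], it also fixes [x ^ a], hence everything. [K] acts trivially on its own abelian
    quotient. *)
Lemma inv_trivial q k : q \in Q -> k \in K -> [~ k, q] \in 'Phi(K).
Proof.
have nPhiQ : Q \subset 'N('Phi(K)).
  exact: normal_norm (char_normal_trans (Phi_char _) inv_comm_normal).
have trivC c : c \in C -> forall k, k \in K -> [~ k, c] \in 'Phi(K).
  case/setIP=> Qc /cent1P ca; have nc := subsetP nPhiQ c Qc.
  have nKc : c \in 'N(K) := subsetP (normal_norm inv_comm_normal) c Qc.
  have nVc : coset 'Phi(K) c \in 'N(K / 'Phi(K)).
    by rewrite (subsetP (quotient_norm _ _)) ?mem_quotient.
  have p2c : 2.-elt (coset 'Phi(K) c) by apply: morph_p_elt => //; apply: mem_p_elt pQ Qc.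
  have ntV : K / 'Phi(K) != 1.
    by rewrite -subG1 quotient_sub1 ?(normal_norm nPhiK) // proper_subn // Phi_proper.
  have := nontriv_cent1_pgroup (abelem_pgroup abV) p2c nVc ntV.
  rewrite -subG1 => /subsetPn[_ /setIP[/morphimP[x nx Kx ->] /cent1P cx] nt].
  have nPhix : x \notin 'Phi(K) by apply: contra nt => Px; rewrite /= coset_id.
  have cxa : commute (coset 'Phi(K) (x ^ a)) (coset 'Phi(K) c).
    rewrite morphJ //=; have -> : coset 'Phi(K) c = coset 'Phi(K) c ^ coset 'Phi(K) a.
      rewrite -morphJ //; congr (coset _ _); apply/esym/conjg_fixP/commgP.
      exact: ca.
    by rewrite /commute -!conjMg cx.
  have sK : K / 'Phi(K) \subset 'C[coset 'Phi(K) c].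
    suff : (<[x]> <*> <[x ^ a]>) / 'Phi(K) \subset 'C[coset 'Phi(K) c].
      by rewrite (inv_gen Kx nPhix).
    have nxa : x ^ a \in 'N('Phi(K)) by rewrite groupJ.
    rewrite quotientY ?cycle_subG // join_subG !quotient_cycle // !cycle_subG.
    by apply/andP; split; apply/cent1P.
  move=> k1 Kk1; have nk1 := subsetP (normal_norm nPhiK) k1 Kk1.
  apply: coset_idr; first by rewrite groupR.
  rewrite morphR //=; apply/eqP/commgP/cent1P.
  by apply: (subsetP sK); rewrite mem_quotient.
move=> Qq Kk; have : q \in K * C by rewrite inv_mul.
case/mulsgP=> k1 c Kk1 Cc ->.
have Qc : c \in Q by case/setIP: Cc.
rewrite commgMJ; apply: groupM; first exact: trivC.
rewrite memJ_norm; last exact: (subsetP nPhiQ).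
apply: (subsetP (der1_min (normal_norm nPhiK) cV)); exact: mem_commg.
Qed.

(** If [t] acted trivially on [K / 'Phi(K)], then [a] and its inverse would act alike there, so
    [a ^+ 2] and then [a] would act trivially. The factor [q] changes nothing, by [inv_trivial]. *)
Lemma inv_act q : q \in Q -> exists2 k, k \in K & [~ k, t * q] \notin 'Phi(K).
Proof.
move=> Qq; have [/exists_inP // | /exists_inPn triv] :=
  boolP [exists k in K, [~ k, t * q] \notin 'Phi(K)].
have trivt k : k \in K -> [~ k, t] \in 'Phi(K).
  move=> Kk; have Kkt : k ^ t \in K by rewrite memJ_norm.
  have := triv k Kk; rewrite negbK => Ptq.
  have E1 : [~ k, t * q] = [~ k, t] * [~ k ^ t, q].
    by rewrite !commgEl conjgM -mulgA mulKVg.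
  by move: Ptq; rewrite E1 groupMr //; apply: inv_trivial.
have [x Kx nPhix] := exx; have nx := subsetP (normal_norm nPhiK) x Kx.
pose b := coset 'Phi(K); have Kxa : x ^ a \in K by rewrite memJ_norm.
have ct k : k \in K -> (b k) ^ (b t) = b k.
  move=> Kk; have nk := subsetP (normal_norm nPhiK) k Kk.
  by apply/conjg_fixP; rewrite -morphR //= coset_id // trivt.
have E1 : b x ^ b a = b x ^ (b a)^-1.
  have Exa : b (x ^ a) = b x ^ b a by rewrite /b morphJ.
  have Eat : b a ^ b t = (b a)^-1 by rewrite /b -morphJ // a_t morphV.
  transitivity (b (x ^ a) ^ b t); first by rewrite ct // Exa.
  by rewrite Exa conjJg ct // Eat.
have : b x ^ b a = b x.
  apply: (conjg_odd_fix (n := 1)).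
    exact: dvdn_odd (morph_order (coset_morphism 'Phi(K)) nPhia) oa.
  by rewrite expn1 expgS expg1 conjgM E1 conjgKV.
have nxa : [~ x, a] \in 'N('Phi(K)) by rewrite groupR.
move/conjg_fixP; rewrite -morphR //= (coset_eq1 nxa) => Px.
by case/negP: nPhix; apply: (inv_fix nPhiK).
Qed.

Lemma inv_abelian_cap : abelian K -> K :&: C = 1.
Proof.
move=> cKK; apply/trivgP/subsetP=> k /setIP[Kk /setIP[_ ck]].
by rewrite -(comm_cycle_id_cent1 cKK nKa inv_commGid) inE Kk.
Qed.

Lemma inv_abelem : 2.-abelem K -> #|K| = 4 /\ C \subset 'C(K).
Proof.
move=> abK; have Phi1 : 'Phi(K) = 1 by apply/eqP; rewrite (trivg_Phi pK).
have := inv_index_Phi; rewrite Phi1 indexg1; split=> //.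
apply/subsetP=> c /setIP[Qc _]; apply/centP=> k Kk; apply/commute_sym/commgP.
by have := inv_trivial Qc Kk; rewrite Phi1 inE.
Qed.

(** The centralizer of [i] in ['Ohm_1('Phi(K))] is nontrivial because [i] is a 2-element, and
    [a]-invariant because [i] commutes with [a]; hence it does not have order 2. *)
Lemma inv_nabelem i : abelian K -> ~~ 2.-abelem K -> i \in C -> #[i] = 2 ->
  exists U : {group gT}, [/\ U \subset 'Phi(K), 2.-abelem U, 4 <= #|U| & i \in 'C(U)].
Proof.
move=> cKK nabK /setIP[Qi /cent1P ci] oi.
have pPhi : 2.-group 'Phi(K) := pgroupS sPhiK pK.
have abO : 2.-abelem 'Ohm_1('Phi(K)).
  by rewrite (abelem_Ohm1 pPhi) (abelianS _ cKK) // (subset_trans (Ohm_sub _ _)).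
have ntO : 'Ohm_1('Phi(K)) != 1.
  by rewrite Ohm1_eq1 // (trivg_Phi pK).
have chO : 'Ohm_1('Phi(K)) \char K := char_trans (Ohm_char 1 _) (Phi_char K).
have nKi : i \in 'N(K) := subsetP (normal_norm inv_comm_normal) i Qi.
have nOi : i \in 'N('Ohm_1('Phi(K))) by apply: (subsetP (char_norms chO)).
have nOa : a \in 'N('Ohm_1('Phi(K))) by apply: (subsetP (char_norms chO)).
pose U := 'C_('Ohm_1('Phi(K)))[i]%G.
have ntU : U :!=: 1.
  by apply: nontriv_cent1_pgroup (abelem_pgroup abO) _ nOi ntO; apply: mem_p_elt pQ Qi.
have sUK : U \subset K.
  by rewrite subIset // (subset_trans (Ohm_sub _ _)).
have nUa : a \in 'N(U).
  rewrite -cycle_subG normsI ?cycle_subG //.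
  by apply: (subsetP (normG _)); apply/cent1P.
have n1a : a \in 'N(1) by rewrite norm1 inE.
have n2 : #|U : 1%G| != 2.
  exact: inv_index_neq2 (normal1 _) n1a (quotient_abelian _ cKK) (sub1G _) sUK nUa.
exists U; split.
- by rewrite subIset // Ohm_sub.
- by apply: abelemS abO; apply: subsetIl.
- have pU : 2.-group U := pgroupS sUK pK.
  rewrite indexg1 in n2; rewrite -cardG_gt1 in ntU.
  case/p_natP: pU n2 ntU => [[|[|k]] ->] // _ _.
    by rewrite !expnS mulnA leq_pmulr ?expn_gt0.
by rewrite -sub_cent1 subsetIr.
Qed.

Lemma inv_quadratic q : abelian K -> q \in Q ->
  (forall k, k \in K -> [~ k, t * q, t * q] = 1) -> 2.-abelem K.
Proof.
move=> cKK Qq quad; set s := t * q in quad.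
have nKq : q \in 'N(K) := subsetP (normal_norm inv_comm_normal) q Qq.
have nKs : s \in 'N(K) by rewrite groupM.
have : q \in K * C by rewrite inv_mul.
case/mulsgP=> k1 c Kk1 /setIP[Qc /cent1P ca] Eq.
have Kt k : k \in K -> k ^ s = (k ^ t) ^ c.
  move=> Kk; have Kkt : k ^ t \in K by rewrite memJ_norm.
  rewrite /s Eq !conjgM; congr (_ ^ c); apply/conjg_fixP/commgP; exact: (centsP cKK).
have acE : a ^ c = a by apply/conjg_fixP/commgP/commute_sym.
have Ka k : k \in K -> (k ^ a) ^ s = (k ^ s) ^ a^-1.
  move=> Kk; rewrite (Kt (k ^ a)) ?memJ_norm // (Kt k) //.
  have -> : (k ^ a) ^ t = (k ^ t) ^ a^-1 by rewrite conjJg a_t.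
  by rewrite conjJg conjVg acE.
have nKa' : a^-1 \in 'N(K) by rewrite groupV.
have qd k : k \in K -> (k ^ s) ^ s * k = (k ^ s) ^+ 2.
  move=> Kk; have := quad k Kk; have Kks : k ^ s \in K by rewrite memJ_norm.
  move/eqP/conjg_fixP; rewrite commgEl conjMg conjVg => E1.
  have : (k ^ s) ^ s = k ^ s * (k^-1 * k ^ s) by rewrite -E1 mulKVg.
  move=> ->; have := centsP cKK _ Kks _ Kk; move: (k ^ s) => m cmk.
  by rewrite expgS expg1 -!mulgA cmk mulKg.
rewrite abelemE // cKK; apply/exponentP=> m Km.
have [k Kk Em] : exists2 k, k \in K & m = k ^ s.
  by exists (m ^ s^-1); rewrite ?conjgKV // memJ_norm ?groupV.
have Kks : k ^ s \in K by rewrite -Em.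
have Kka : k ^ a \in K by rewrite memJ_norm.
have Ka' u : u \in K -> (u ^ a^-1) ^ s = (u ^ s) ^ a.
  move=> Ku; have Kua : u ^ a^-1 \in K by rewrite memJ_norm.
  by have := Ka _ Kua; rewrite conjgKV => ->; rewrite conjgKV.
(* Like [t], [s] inverts the action of [a] on [K], so the quadratic relation for [k ^ a] says that
   [a] and [a^-1] move [m ^+ 2] alike. Then [a ^+ 2], and so [a], fixes [m ^+ 2]. *)
have := qd (k ^ a) Kka; rewrite Ka // Ka' // -conjMg qd // -Em -conjXg => E1.
have : (m ^+ 2) ^ a = m ^+ 2.
  apply: (conjg_odd_fix (n := 1) oa).
  by rewrite expn1 expgS expg1 conjgM E1 conjgKV.
move=> fixm; apply/set1P; rewrite -[[set 1]](comm_cycle_id_cent1 cKK nKa inv_commGid).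
rewrite inE groupX // andTb; apply/cent1P/commgP/conjg_fixP; exact: fixm.
Qed.

(** Index 1 would make [a] trivial on [Q / 'Phi(Q)], hence on [Q]; index 2 is excluded by
    [inv_index_neq2]. *)
Lemma inv_index_cap_Phi : 4 <= #|K : K :&: 'Phi(Q)|.
Proof.
pose N := (K :&: 'Phi(Q))%G.
have sNK : N \subset K := subsetIl _ _.
have sDN : K^`(1) \subset N.
  rewrite /N /= subsetI der_sub /= (Phi_joing pQ); apply: subset_trans (joing_subl _ _).
  exact: dergS.
have nNa : a \in 'N(N).
  rewrite -cycle_subG normsI ?cycle_subG //.
  exact: (subsetP (char_norms (Phi_char Q))).
have n2 := inv_index_neq2 (sub_der1_normal sDN sNK) nNa (sub_der1_abelian sDN) sNK (subxx _) nKa.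
have gt1 : 1 < #|K : N|.
  rewrite indexg_gt1; apply: contra ncQa => sKN.
  rewrite -cycle_subG; apply: (coprime_cent_Phi pQ (co2 pQ) nQA).
  exact: subset_trans sKN (subsetIr _ _).
have := pnat_dvd (dvdn_indexg K N) pK => /p_natP[k Ek].
move: n2 gt1; rewrite /= Ek; case: k {Ek} => [|[|k]] // _ _.
by rewrite !expnS mulnA leq_pmulr ?expn_gt0.
Qed.

(** [K] covers a subgroup of order at least 4 in [Q / 'Phi(Q)], whose order is at most 8, so at most
    one generator is left. *)
Lemma inv_cyclic_quotient : cyclic (Q / K).
Proof.
have nPhiQ : Q \subset 'N('Phi(Q)) := gFnorm _ _.
have ge4 := inv_index_cap_Phi.
pose J := (K <*> 'Phi(Q))%G.
have nKPhi : 'Phi(Q) \subset 'N(K) by rewrite (subset_trans (Phi_sub _)) ?commg_norml.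
have sJQ : J \subset Q by rewrite join_subG sKQ Phi_sub.
have iJ : 4 <= #|J : 'Phi(Q)|.
  apply: leq_trans ge4 _; rewrite indexgI /J /= norm_joinEr //.
  by rewrite (normC (subset_trans sKQ nPhiQ)) indexMg.
have le2 : #|Q : J| <= 2.
  have := Lagrange_index sJQ (joing_subr K 'Phi(Q)); have := inv_index_Phi_le8 (subxx Q).
  move=> le8 E8; rewrite -(leq_pmul2r (isT : 0 < 4)) -[(2 * 4)%N]/8.
  by apply: leq_trans le8; rewrite -E8 leq_mul2l iJ orbT.
apply: Phi_quotient_cyclic; apply: cyclic_small.
have nKQ : Q \subset 'N(K) := commg_norml _ _.
have EPhi : 'Phi(Q / K) = J / K by rewrite -(quotient_Phi pQ nKQ) /J /= quotientYidl.
rewrite card_quotient ?gFnorm //= EPhi.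
rewrite (index_quotient_eq (G := Q) (K := J)) //; first exact: leq_trans le2 _.
by rewrite subIset // joing_subl orbT.
Qed.

Local Notation D := K^`(1).

Let sDPhi : D \subset 'Phi(K).
Proof. by rewrite (Phi_joing pK) joing_subl. Qed.

Let nDa : a \in 'N(D).
Proof. exact: (subsetP (char_norms (der_char 1 _))). Qed.

Let sqPhi k : k \in K -> k ^+ 2 \in 'Phi(K).
Proof.
move=> Kk; rewrite (Phi_joing pK) mem_gen // inE orbC (MhoE 1 pK) mem_gen //.
by apply/imsetP; exists k.
Qed.

(** [K] is generated by [x] and [x ^ a]; once [D / N] is central in [K / N], the single commutator
    [[~ x, x ^ a]] generates it. *)
Lemma inv_der_index (N : {group gT}) : N <| K -> N \subset D -> [~: D, K] \subset N ->
  (forall x y, x \in K -> y \in K -> [~ x, y] ^+ 2 \in N) -> #|D : N| <= 2.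
Proof.
move=> nNK sND sDKN sq; have nN := subsetP (normal_norm nNK).
have [x Kx nx] := exx; have Kxa : x ^ a \in K by rewrite memJ_norm.
have nDN : D \subset 'N(N) by rewrite (subset_trans (der_sub 1 _)) ?normal_norm.
have cen : coset N [~ x, x ^ a] \in 'C(K / N).
  apply: (subsetP (quotient_cents2r sDKN)); rewrite mem_quotient //; exact: mem_commg.
rewrite -card_quotient //.
have -> : D / N = <[coset N [~ x, x ^ a]]>.
  rewrite quotient_der ?normal_norm //.
  suff : ((<[x]> <*> <[x ^ a]>) / N)^`(1) = <[coset N [~ x, x ^ a]]>.
    by rewrite (inv_gen Kx nx).
  rewrite quotientY ?cycle_subG ?nN // !quotient_cycle ?nN //.
  rewrite der1_joing_cycles -?morphR ?nN //=.
  rewrite -!quotient_cycle ?nN // -quotientY ?cycle_subG ?nN // (inv_gen Kx nx).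
  exact: cen.
rewrite -orderE dvdn_leq // order_dvdn -morphX ?nN ?groupR //=.
by rewrite coset_id // sq.
Qed.

Lemma inv_comm_normal_sub (N : {group gT}) k : D \subset N -> N \subset K ->
  a \in 'N(N) -> k \in K -> [~ k, a] \in N -> k \in N.
Proof.
move=> sDN sNK nNa; apply: inv_fix => //; first exact: sub_der1_normal.
exact: sub_der1_abelian.
Qed.

Let nilK : nilpotent K := pgroup_nil pK.

Let normD : K \subset 'N(D) := der_norm 1 _.

Let sDKD : [~: D, K] \subset D.
Proof. by rewrite commg_subl. Qed.

Let nDKK : [~: D, K] <| K.
Proof. by rewrite /normal (subset_trans sDKD) ?der_sub // commg_normr. Qed.

Let nDKa : a \in 'N([~: D, K]).
Proof. by rewrite -cycle_subG normsR // cycle_subG. Qed.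

Lemma inv_der_eq_Phi : ~~ abelian K -> D = 'Phi(K).
Proof.
move=> nabK; apply/eqP; rewrite eqEsubset sDPhi /=; apply/negPn/negP=> nsPhiD.
have ntD : D != 1 by rewrite -[D != 1]negbK; apply: contra nabK => /negPn/eqP/commG1P.
have pPhi := pgroupS sPhiK pK; have pD := pgroupS (der_sub 1 _) pK.
have chPhiPhi : 'Phi('Phi(K)) \char K := char_trans (Phi_char _) (Phi_char _).
have sPhiQ0 : 'Phi(K) \subset Q0.
  have := inv_cap_sub sKQ; have sI : K :&: Q0 \subset K := subsetIl _ _.
  have := pnat_dvd (dvdn_indexg K (K :&: Q0)) pK => /p_natP[[|[|k]] Ek].
  - by move=> _; apply: subset_trans sPhiK _; apply/setIidPl/eqP; rewrite eqEsubset sI -indexg_eq1 Ek.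
  - move=> _; apply: subset_trans (Phi_sub_max _) (subsetIr K Q0).
    by apply: p_index_maximal; rewrite ?Ek.
  by rewrite Ek -[X in _ <= X]/(2 ^ 1)%N leq_exp2l.
(* ['Phi(K)] lies in [Q0], so it has at most two generators. The nontrivial [a]-invariant section
   ['Phi(K) / N2] cannot have order 2, so it already uses up both. *)
have sDPP : D \subset 'Phi('Phi(K)).
  pose N2 := (D <*> 'Phi('Phi(K)))%G.
  have sN2 : N2 \subset 'Phi(K) by rewrite join_subG sDPhi Phi_sub.
  have sDN2 : D \subset N2 := joing_subl _ _.
  have sN2K := subset_trans sN2 sPhiK.
  have nN2a : a \in 'N(N2).
    by rewrite -cycle_subG normsY ?cycle_subG // (subsetP (char_norms chPhiPhi)).
  have n2 := inv_index_neq2 (sub_der1_normal sDN2 sN2K) nN2a (sub_der1_abelian sDN2) sN2 sPhiK nPhia.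
  have gt1 : 1 < #|'Phi(K) : N2|.
    rewrite indexg_gt1; apply: contra nsPhiD => sPhiN2.
    suff <- : <<D>> = 'Phi(K) by rewrite genGid.
    by apply: Phi_nongen; apply/eqP; rewrite joingC eqEsubset sN2.
  have ge4 : 4 <= #|'Phi(K) : N2|.
    have := pnat_dvd (dvdn_indexg 'Phi(K) N2) pPhi => /p_natP[k Ek].
    move: n2 gt1; rewrite Ek; case: k {Ek} => [|[|k]] // _ _.
    by rewrite !expnS mulnA leq_pmulr ?expn_gt0.
  apply: subset_trans sDN2 _; rewrite -indexg_eq1 eqn_leq indexg_gt0 andbT.
  have := Lagrange_index sN2 (joing_subr D _) => E4.
  rewrite -(leq_pmul2l (isT : 0 < 4)) muln1.
  by apply: leq_trans (rk sPhiQ0); rewrite -E4 leq_mul2r ge4 orbT.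
pose N := ([~: D, K] <*> 'Phi(D))%G.
have sND : N \subset D by rewrite join_subG sDKD Phi_sub.
have chPD : 'Phi(D) \char K := char_trans (Phi_char _) (der_char 1 _).
have nNK : N <| K.
  by rewrite /normal (subset_trans sND) ?der_sub // normsY ?(normal_norm nDKK) ?(char_norm chPD).
have nNa : a \in 'N(N).
  by rewrite -cycle_subG normsY ?cycle_subG // (subsetP (char_norms chPD)).
have nsDN : ~~ (D \subset N).
  apply/negP=> sDN; have prD : [~: D, K] \proper D.
    by apply: (nil_comm_properl nilK) => //; rewrite ?der_sub // subsetI subxx.
  have : <<[~: D, K]>> = D.
    by apply: Phi_nongen; apply/eqP; rewrite joingC eqEsubset sDN sND.
  by rewrite genGid => E1; rewrite E1 properxx in prD.
have sqN d : d \in D -> d ^+ 2 \in N.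
  move=> Dd; apply: (subsetP (joing_subr _ _)).
  rewrite (Phi_joing pD) mem_gen // inE orbC (MhoE 1 pD) mem_gen //.
  by apply/imsetP; exists d.
have i2 : #|D : N| <= 2.
  apply: inv_der_index => //; first exact: joing_subl.
  by move=> x y Kx Ky; apply: sqN; apply: mem_commg.
pose b := coset N; pose L := ('Phi(K) / N)%G.
have nKN := normal_norm nNK.
have cD d : d \in D -> b d \in 'C(K / N).
  move=> Dd; apply: (subsetP (quotient_cents2r (joing_subl _ _))).
  by rewrite mem_quotient.
have sLC : L \subset 'C(K / N).
  rewrite /L /= (quotient_Phi pK nKN) (Phi_joing (quotient_pgroup _ pK)).
  rewrite join_subG -quotient_der // quotient_cents2r ?joing_subl //=.
  rewrite (MhoE 1 (quotient_pgroup _ pK)) gen_subG.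
  apply/subsetP=> _ /imsetP[_ /morphimP[x nx Kx ->] ->].
  apply/centP=> _ /morphimP[y ny Ky ->]; apply/commgP.
  have Dxy : [~ x, y] \in D by apply: mem_commg.
  rewrite commXg /= -?morphR //.
    have nDxy : [~ x, y] \in 'N(N) by rewrite groupR.
    by rewrite -morphX //= coset_id ?sqN.
  by rewrite /commute (centP (cD _ Dxy)) ?mem_quotient.
have sLK : L \subset K / N by apply: quotientS.
have cLL : abelian L by rewrite /abelian (subset_trans sLC) ?centS.
have pL : 2.-group L := quotient_pgroup _ pPhi.
have nLa : b a \in 'N(L).
  by rewrite (subsetP (quotient_norm _ _)) ?mem_quotient.
have cob : coprime #|L| #|<[b a]>|.
  case/p_natP: pL => k ->; rewrite coprimeXl // coprime2n.
  exact: dvdn_odd (morph_order (coset_morphism N) nNa) oa.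
have defL := coprime_comm_cent (A := <[b a]>%G) (Q := L).
rewrite cycle_subG nLa cob (pgroup_sol pL) in defL.
have sCD : 'C_L(<[b a]>) \subset D / N.
  apply/subsetP=> _ /setIP[/morphimP[l nl Pl ->]]; rewrite cent_cycle => /cent1P cl.
  rewrite mem_quotient //; have Kl := subsetP sPhiK l Pl.
  apply: inv_comm_normal_sub => //; first exact: der_sub.
  have nla : [~ l, a] \in 'N(N) by rewrite groupR.
  apply: (subsetP sND); rewrite -(coset_eq1 nla) /= -[coset N _]/(coset_morphism N _) morphR //.
  exact/commgP.
(* The fixed points of [a] on [L] come from [D], hence lie in ['Phi(L)], and the commutator part
   must be all of [L]. So [a] has no fixed point but [1] on [L], although it fixes the nontrivial
   [D / N], of order 2. *)
have defL' : [~: L, <[b a]>] = L.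
  rewrite -[LHS]genGid; apply: Phi_nongen; apply/eqP; rewrite eqEsubset.
  rewrite join_subG Phi_sub commg_subl cycle_subG nLa /=.
  have nPN : 'Phi(K) \subset 'N(N) := subset_trans sPhiK nKN.
  have sCP : 'C_L(<[b a]>) \subset 'Phi(L).
    apply: subset_trans sCD _.
    by rewrite /L /= -(quotient_Phi pPhi nPN) quotientS.
  have := mul_subG (joing_subr 'Phi(L) [~: L, <[b a]>]) (subset_trans sCP (joing_subl _ [~: L, <[b a]>])).
  by rewrite (defL isT isT isT).
have C1 := comm_cycle_id_cent1 cLL nLa defL'.
case/negP: nsDN; rewrite -(quotient_sub1 (subset_trans (der_sub 1 _) nKN)) -C1.
apply/subsetP=> _ /morphimP[d nd Dd ->]; apply/setIP; split.
  by rewrite mem_quotient // (subsetP sDPhi).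
apply/cent1P/commgP; rewrite /= -[coset N d]/(coset_morphism N d) -morphR //= coset_id //.
have [Nd | nNd] := boolP (d \in N); first by rewrite commgEl groupM ?groupV ?memJ_norm.
by rewrite commgEl; apply: (index_le2_mulVg sND); rewrite ?memJ_norm.
Qed.

Lemma inv_quaternion : ~~ abelian K -> exists j, quaternion_shape K C j.
Proof.
move=> nabK; have defD := inv_der_eq_Phi nabK.
have sDK : D \subset K := der_sub 1 _.
have ntD : D != 1 by rewrite -[D != 1]negbK; apply: contra nabK => /negPn/eqP/commG1P.
pose N := [~: D, K]%G; have sND : N \subset D := sDKD.
have prN : N \proper D.
  by apply: (nil_comm_properl nilK) => //; rewrite ?der_sub // subsetI subxx.
have nNK : N <| K := nDKK; have nNa : a \in 'N(N) := nDKa.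
have nN := subsetP (normal_norm nNK).
have sqD k : k \in K -> k ^+ 2 \in D by rewrite defD; apply: sqPhi.
have commN d k : d \in D -> k \in K -> [~ d, k] \in N by apply: mem_commg.
pose b := coset N.
have cD d k : d \in D -> k \in K -> commute (b d) (b k).
  move=> Dd Kk; have nd := nN d (subsetP sDK d Dd); have nk := nN k Kk.
  by apply/commgP; rewrite /b /= -morphR //= coset_id // commN.
have i2 : #|D : N| <= 2.
  apply: inv_der_index => // x y Kx Ky.
  have Dxy : [~ x, y] \in D by apply: mem_commg.
  have nx := nN x Kx; have ny := nN y Ky; have nxy : [~ x, y] \in 'N(N) by rewrite groupR.
  have nxy2 : [~ x, y] ^+ 2 \in 'N(N) by rewrite groupX.
  rewrite -(coset_eq1 nxy2) -[coset N _]/(coset_morphism N _) morphX // morphR //=.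
  rewrite -commXg; last first.
    apply/commute_sym; rewrite /= -[coset N x]/(coset_morphism N x).
    by rewrite -[coset N y]/(coset_morphism N y) -morphR //; apply: cD.
  by apply/commgP; rewrite -[coset N x]/(coset_morphism N x) -morphX //; apply: cD; rewrite ?sqD.
have sqN d : d \in D -> d ^+ 2 \in N.
  move=> Dd; have [Nd | nNd] := boolP (d \in N); first by rewrite groupX.
  have := index_le2_mulVg sND i2 (groupVr Dd) Dd; rewrite invgK groupV.
  by move=> /(_ nNd nNd); rewrite expgS expg1.
(* Otherwise [x], [x ^ a] and [x ^ (a ^+ 2)], which represent the nontrivial cosets of [D], all have
   squares in [N]; then [K / N] has exponent 2 and is abelian, against [N] being proper in [D]. *)
have sq1 x : x \in K -> x \notin D -> x ^+ 2 \notin N.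
  move=> Kx nDx; apply/negP=> Nx2.
  pose y := x ^ a; pose z := y ^ a; pose H := (D <*> <[x]>)%G.
  have Ky : y \in K by rewrite memJ_norm.
  have Kz : z \in K by rewrite memJ_norm.
  have nDxa : [~ x, a] \notin D.
    by apply: contra nDx; apply: inv_comm_normal_sub.
  have Ny2 : y ^+ 2 \in N by rewrite -conjXg memJ_norm.
  have Nz2 : z ^+ 2 \in N by rewrite -conjXg memJ_norm.
  have dec k : k \in K -> exists d, d \in D /\ (k = d \/ k = x * d \/ k = y * d \/ k = z * d).
    have sHK : H \subset K by rewrite join_subG sDK cycle_subG.
    have sDH : D \subset H := joing_subl _ _.
    have Hx : x \in H by rewrite (subsetP (joing_subr _ _)) ?cycle_id.
    have gtH : 1 < #|H : D| by rewrite indexg_gt1; apply: contra nDx => /subsetP; apply.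
    have leD : #|H : D| <= 2.
      have nDx' : <[x]> \subset 'N(D) by rewrite cycle_subG (subsetP normD).
      rewrite /H /= norm_joinEr // indexMg -card_quotient // quotient_cycle ?(subsetP normD) //.
      rewrite -orderE dvdn_leq // order_dvdn -[coset _ x]/(coset_morphism D x) -morphX ?(subsetP normD) //=.
      by rewrite coset_id ?sqD.
    have leH : #|K : H| <= 2.
      have iD : #|K : D| = 4 by rewrite defD inv_index_Phi.
      have := Lagrange_index sHK sDH; rewrite /= iD => E4.
      by rewrite -(leq_pmul2r (isT : 0 < 2)) -[(2 * 2)%N]/4 -E4 leq_mul2l gtH orbT.
    have inH u : u \in K -> u \notin D -> u \in H -> exists2 d, d \in D & u = x * d.
      move=> Ku nDu Hu; exists (x^-1 * u); last by rewrite mulKVg.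
      exact: (index_le2_mulVg sDH).
    have nHy : y \notin H.
      apply/negP=> Hy; case: (inH y Ky) => //; first by rewrite memJ_norm.
      move=> d Dd Ey; case/negP: nDxa; rewrite commgEl -/y Ey mulKg //.
    have nHz : z \notin H.
      apply/negP=> Hz; case: (inH z Kz) => //; first by rewrite !memJ_norm.
      move=> d Dd Ez; case/negP: nDxa.
      have nx : x \in 'N(D) := subsetP normD x Kx.
      have nxa : [~ x, a] \in 'N(D) by rewrite groupR.
      rewrite -(coset_eq1 nxa) -[coset D _]/(coset_morphism D _) morphR //.
      apply/conjg_fixP; apply: (conjg_odd_fix (n := 1)).
        exact: dvdn_odd (morph_order (coset_morphism D) nDa) oa.
      rewrite expn1 expgS expg1 conjgM -!morphJ ?groupJ // -/y -/z Ez morphM //.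
        by rewrite /= [X in _ * X]coset_id ?mulg1.
      exact: (subsetP (normG D)).
    move=> Kk; have [Hk | nHk] := boolP (k \in H).
      have [Dk | nDk] := boolP (k \in D); first by exists k; split; [|left].
      by have [d Dd ->] := inH k Kk nDk Hk; exists d; split=> //; right; left.
    have Hyk : y^-1 * k \in H by apply: (index_le2_mulVg sHK).
    have [Dyk | nDyk] := boolP (y^-1 * k \in D).
      by exists (y^-1 * k); split=> //; right; right; left; rewrite mulKVg.
    have Hzk : z^-1 * k \in H by apply: (index_le2_mulVg sHK).
    have [Dzk | nDzk] := boolP (z^-1 * k \in D).
      by exists (z^-1 * k); split=> //; right; right; right; rewrite mulKVg.
    have : (y^-1 * k)^-1 * (z^-1 * k) \in D.
      by apply: (index_le2_mulVg sDH).
    have -> : (y^-1 * k)^-1 * (z^-1 * k) = (y * z^-1) ^ k.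
      by rewrite invMg invgK /conjg !mulgA.
    rewrite memJ_norm ?(subsetP normD) // -(memJ_norm (x := z)) ?(subsetP normD) //.
    have -> : (y * z^-1) ^ z = ([~ x, a] ^ a)^-1.
      have -> : [~ x, a] ^ a = y^-1 * z by rewrite commgEl conjMg conjVg.
      have conjVM (u v : gT) : (u * v^-1) ^ v = v^-1 * u.
        by rewrite /conjg -mulgA mulVg mulg1.
      by rewrite conjVM [RHS]invMg invgK.
    by rewrite groupV memJ_norm // (negPf nDxa).
  have sqall k : k \in K -> k ^+ 2 \in N.
    have sqm u d : u \in K -> u ^+ 2 \in N -> d \in D -> (u * d) ^+ 2 \in N.
      move=> Ku Nu Dd; have Kd := subsetP sDK d Dd.
      have nu := nN u Ku; have nd := nN d Kd.
      have nud1 : u * d \in 'N(N) by exact: groupM.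
      have nud : (u * d) ^+ 2 \in 'N(N) by exact: groupX.
      rewrite -(coset_eq1 nud) -[coset N _]/(coset_morphism N _) morphX // morphM //.
      rewrite expgMn; last by apply/commute_sym; apply: cD.
      by rewrite -!morphX //= (coset_id Nu) (coset_id (sqN d Dd)) mulg1.
    move=> Kk; have [d [Dd [->|[->|[->|->]]]]] := dec k Kk; first exact: sqN.
    - exact: sqm.
    - exact: sqm.
    exact: sqm.
  have : abelian (K / N).
    apply: (@abelem_abelian _ 2); apply: exponent2_abelem; apply/exponentP.
    move=> xb /morphimP[u nu Ku ->]; rewrite -morphX //= coset_id //; exact: sqall.
  move/(der1_min (normal_norm nNK)) => sDN.
  by rewrite properE sDN andbF in prN.
have N1 : N :=: 1.
  apply/eqP; apply/negPn/negP=> ntN.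
  have prM : [~: N, K] \proper N.
    by apply: (nil_comm_properl nilK) => //; rewrite ?(normal_sub nNK) // subsetI subxx normal_norm.
  have nM : K \subset 'N([~: N, K]) by rewrite commg_normr.
  (* [x ^+ 2] generates [D] modulo [N] and commutes with [x], so [[~ d, x]] reduces to a commutator
     of an element of [N]. Elements outside [D] generate [K], so [N = [~: D, K]] would lie in
     [[~: N, K]]. *)
  have com1 x d : x \in K -> x \notin D -> d \in D -> [~ d, x] \in [~: N, K].
    move=> Kx nDx Dd.
    have xx : [~ x ^+ 2, x] = 1 by apply/eqP/commgP/commute_sym/commuteX.
    have [Nd | nNd] := boolP (d \in N); first exact: mem_commg.
    have Nxd : (x ^+ 2)^-1 * d \in N.
      by apply: (index_le2_mulVg sND i2) => //; rewrite ?sqD ?sq1.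
    have -> : d = x ^+ 2 * ((x ^+ 2)^-1 * d) by rewrite mulKVg.
    by rewrite commMgJ xx conj1g mul1g mem_commg.
  have sNM : [~: D, K] \subset [~: N, K].
    rewrite gen_subG; apply/subsetP=> _ /imset2P[d k Dd Kk ->].
    have [Dk | nDk] := boolP (k \in D); last exact: com1.
    have [x Kx nx] := exx; rewrite -defD in nx.
    have nDxk : x^-1 * k \notin D by rewrite groupMr // groupV.
    have Kxk : x^-1 * k \in K by rewrite groupM ?groupV.
    rewrite -(mulKVg x k) commgMJ groupM ?com1 // memJ_norm ?com1 //.
    exact: (subsetP nM).
  by move: prM; rewrite properE => /andP[_ /negP[]].
have oD : #|D| = 2.
  have := i2; rewrite N1 indexg1 => le2.
  by apply/eqP; rewrite eqn_leq le2 cardG_gt1.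
have [j defj] : exists j, D = <[j]>.
  by apply/cyclicP; apply: prime_cyclic; rewrite oD.
have oj : #[j] = 2 by rewrite orderE -defj.
have Dj : j \in D by rewrite defj cycle_id.
have in_j d : d \in D -> d != 1 -> d = j.
  by rewrite defj (cycle2g oj) !inE => /orP[/eqP->|/eqP //]; rewrite eqxx.
have cDK d k : d \in D -> k \in K -> commute d k.
  by move=> Dd Kk; apply/commgP; rewrite -in_set1 -[[set 1]]N1 commN.
have ja : j ^ a = j by apply: in_j; rewrite ?memJ_norm // conjg_eq1 -order_gt1 oj.
exists j; split=> //; rewrite -?defj //.
- by rewrite -(Lagrange sDK) oD /= defD inv_index_Phi.
- apply/eqP; rewrite eqEsubset {1}defD inv_cap subsetI sDK defj cycle_subG.
  apply/setIP; split; first exact: (subsetP (subset_trans sDK sKQ)).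
  by apply/cent1P/commgP/conjg_fixP.
(* Commuting with [u], [c] also commutes with [u ^ a], and the two generate [K]. Either [x] or
   [x * x ^ a] can serve as [u]: if [[~ x, c]] is not [1], it equals [j], and so does
   [[~ x ^ a, c]]. *)
- have fix_all c u : c \in C -> u \in K -> u \notin D -> commute u c -> c \in 'C(K).
    case/setIP=> Qc /cent1P ca Ku nDu cu; rewrite -sub_cent1.
    rewrite defD in nDu; rewrite -(inv_gen Ku nDu) join_subG !cycle_subG.
    have ac : c ^ a = c by apply/conjg_fixP/commgP; apply: commute_sym.
    apply/andP; split; apply/cent1P; first exact: commute_sym.
    by rewrite -ac; apply/commgP; rewrite -conjRg conjg_eq1; apply/commgP/commute_sym.
  apply/subsetP=> c Cc; have [x Kx nx] := exx; rewrite -defD in nx.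
  have Qc : c \in Q by case/setIP: Cc.
  have ac : c ^ a = c.
    by case/setIP: Cc => _ /cent1P ca; apply/conjg_fixP/commgP; apply: commute_sym.
  have Dxc : [~ x, c] \in D by rewrite defD inv_trivial.
  have [E1 | n1] := eqVneq [~ x, c] 1.
    by apply: (fix_all c x) => //; apply/commgP; rewrite E1.
  have Exc := in_j _ Dxc n1; have Kxa : x ^ a \in K by rewrite memJ_norm.
  have Exac : [~ x ^ a, c] = j by rewrite -{1}ac -conjRg Exc ja.
  have E2 : [~ x * x ^ a, c] = 1.
    rewrite commMgJ Exc Exac /conjg (cDK _ _ Dj Kxa) mulKg -(expgS j 1) -oj expg_order //.
  apply: (fix_all c (x * x ^ a)) => //; first exact: groupM; last by apply/commgP; rewrite E2.
  rewrite -(groupMl _ (groupVr (sqD x Kx))) expgS expg1 invMg mulgA mulgKV -commgEl.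
  by apply: contra nx; apply: inv_comm_normal_sub => //; apply: der_sub.
move=> k Kk nDk; apply: in_j; first exact: sqD.
by have := sq1 k Kk nDk; rewrite N1 inE.
Qed.
End InvertedAction.

(** * Sylow subgroups that meet their conjugates in [I], and transvections *)

Lemma odd_elt1_pgroup (gT : finGroupType) (G : {group gT}) :
  (forall b, b \in G -> odd #[b] -> b = 1) -> 2.-group G.
Proof.
move=> odd1; apply/pgroupP=> p prp /(Cauchy prp)[b Gb ob]; rewrite inE.
case: (even_prime prp) => [-> // | odp]; rewrite -ob in odp.
by rewrite -ob (odd1 b Gb odp) order1 in prp.
Qed.

(** A 2-group [J] containing [s] and [s ^ x] would lie in some [S :^ y]. Then [s] in [S :&: S :^ y]
    forces [y] into [S], so [s ^ x] lies in [S :&: S :^ x], hence in [I], and [s] with it. *)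
Lemma TI_conj_npgroup (gT : finGroupType) (X S J : {group gT}) (I : {set gT}) s x :
    2.-Sylow(X) S -> X \subset 'N(I) ->
    (forall g, g \in X -> g \notin S -> S :&: S :^ g \subset I) ->
    s \in S -> s \notin I -> x \in X -> x \notin S ->
    J \subset X -> s \in J -> s ^ x \in J ->
  ~~ 2.-group J.
Proof.
move=> sylS nIX TI Ss nIs Xx nSx sJX Js Jsx; apply/negP=> pJ.
have [y Xy sJS] := Sylow_subJ sylS sJX pJ.
have Sy : y \in S.
  apply/negPn/negP=> nSy; case/negP: nIs; apply: (subsetP (TI y Xy nSy)).
  by rewrite inE Ss (subsetP sJS).
case/negP: nIs; rewrite -(memJ_norm (x := x)) ?(subsetP nIX) //.
apply: (subsetP (TI x Xx nSx)); rewrite inE memJ_conjg Ss andbT.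
by rewrite -(conjGid Sy) (subsetP sJS).
Qed.

(** The commutator map of [t] sends [V] into ['C_V[t]] because [t ^+ 2] acts trivially. So the
    square of the order of its image is at most 8, and the image has order 2. *)
Lemma transvection_abelem (gT : finGroupType) (V : {group gT}) t :
    2.-abelem V -> #|V| <= 8 -> t \in 'N(V) -> t \notin 'C(V) -> t ^+ 2 \in 'C(V) ->
  exists z, [/\ z \in 'C_V[t], #[z] = 2, #|V : 'C_V[t]| = 2, #|'C_V[t]| <= 4
    & forall v, v \in V -> [~ v, t] \in <[z]>].
Proof.
move=> abV leV nVt nct ct2; have cVV := abelem_abelian abV.
have [_ ex] := abelemP (isT : prime 2) abV.
have [f [fE kerf]] := comm_morphism cVV nVt.
have fV v : v \in V -> [~ v, t] \in V.
  by move=> Vv; rewrite commgEl groupM ?groupV ?memJ_norm.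
have sfC : f @* V \subset 'C_V[t].
  apply/subsetP=> _ /morphimP[v _ Vv ->]; rewrite fE inE fV //=.
  apply/cent1P/commgP/conjg_fixP.
  have E1 : [~ v, t] * [~ v, t] ^ t = 1.
    rewrite -commgMJ -(expgS t 1); apply/eqP/commgP; apply/commute_sym.
    exact: (centP ct2).
  have := ex _ (fV v Vv); rewrite expgS expg1 -[RHS]E1 => /mulgI/esym //.
have sCV : 'C_V[t] \subset V := subsetIl _ _.
have Ef : #|f @* V| = #|V : 'C_V[t]| by rewrite card_morphim setIid kerf.
have gt1 : 1 < #|f @* V|.
  rewrite Ef indexg_gt1; apply: contra nct => sVC.
  by rewrite -sub_cent1 (subset_trans sVC) ?subsetIr.
have leC := subset_leq_card sfC; have := Lagrange sCV; rewrite -Ef => EL.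
have le4 : #|'C_V[t]| <= 4.
  rewrite -(leq_pmul2r (isT : 0 < 2)) (leq_trans _ leV) // -EL.
  by rewrite leq_mul2l gt1 orbT.
have le2 : #|f @* V| <= 2.
  have : #|f @* V| * #|f @* V| <= 8 by apply: leq_trans leV; rewrite -EL leq_mul2r leC orbT.
  have pf : 2.-group (f @* V) by rewrite morphim_pgroup ?(abelem_pgroup abV).
  case/p_natP: pf => [[|[|k]]] ->; rewrite // -expnD -[8]/(2 ^ 3)%N leq_exp2l //.
  by rewrite !addSn !addnS.
have o2 : #|f @* V| = 2 by apply/eqP; rewrite eqn_leq le2.
have [z defz] : exists z, f @* V = <[z]> by apply/cyclicP; apply: prime_cyclic; rewrite o2.
exists z; split; rewrite -?Ef // ?orderE -?defz //.
  by rewrite (subsetP sfC) // defz cycle_id.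
by move=> v Vv; rewrite -fE mem_morphim.
Qed.

Lemma comm_joing_sub (gT : finGroupType) (V W : {group gT}) (x y : gT) :
    V \subset 'N(W) -> x \in 'N(W) -> y \in 'N(W) ->
    (forall v, v \in V -> [~ v, x] \in W) -> (forall v, v \in V -> [~ v, y] \in W) ->
  [~: V, <[x]> <*> <[y]>] \subset W.
Proof.
move=> nWV nWx nWy cx cy.
have cen u : u \in 'N(W) -> (forall v, v \in V -> [~ v, u] \in W) -> coset W u \in 'C(V / W).
  move=> nWu cu; apply/centP=> _ /morphimP[v nv Vv ->]; apply/commute_sym/commgP.
  by rewrite /= -[coset W v]/(coset_morphism W v) -morphR //= coset_id ?cu.
rewrite commGC -quotient_cents2 ?join_subG ?cycle_subG ?nWx // quotientY ?cycle_subG //.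
by rewrite !quotient_cycle // join_subG !cycle_subG !cen.
Qed.

Lemma coprime_stable_chain (gT : finGroupType) (V W U : {group gT}) b :
    2.-group V -> b \in 'N(V) -> odd #[b] ->
    [~: V, <[b]>] \subset W -> [~: W, <[b]>] \subset U -> [~: U, <[b]>] = 1 ->
  b \in 'C(V).
Proof.
move=> pV nVb ob sW sU U1; rewrite -cycle_subG centsC; apply/commG1P.
have Eid : [~: V, <[b]>, <[b]>] = [~: V, <[b]>].
  apply: coprime_commGid; rewrite ?cycle_subG ?(pgroup_sol pV) //.
  by case/p_natP: pV => k ->; rewrite coprimeXl // coprime2n.
apply/trivgP; rewrite /= -Eid -{1}Eid -U1 commSg // (subset_trans _ sU) // commSg //.
Qed.

(** The group generated by [t] and [t'] stabilizes the chain [V], [<[z]> <*> <[z']>], [<[z']>], [1].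
    It is enough that [t] fixes [z']; [t'] may move [z]. *)
Lemma transvections_odd_cent (gT : finGroupType) (V : {group gT}) t t' z z' b :
    2.-group V -> z \in 'Z(V) -> z' \in 'Z(V) -> t \in 'N(V) -> t' \in 'N(V) ->
    (forall v, v \in V -> [~ v, t] \in <[z]>) ->
    (forall v, v \in V -> [~ v, t'] \in <[z']>) ->
    z ^ t = z -> z' ^ t = z' -> z' ^ t' = z' ->
    b \in <[t]> <*> <[t']> -> odd #[b] ->
  b \in 'C(V).
Proof.
move=> pV Zz Zz' nVt nVt' tz tz' fixz fixz' fixz't Jb ob.
pose J := (<[t]> <*> <[t']>)%G; pose W := (<[z]> <*> <[z']>)%G; pose U := <[z']>%G.
have sWZ : W \subset 'Z(V) by rewrite join_subG !cycle_subG Zz.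
have sWV : W \subset V := subset_trans sWZ (center_sub V).
have sUW : U \subset W := joing_subr _ _.
have nUV (H : {group gT}) : H \subset W -> V \subset 'N(H).
  move=> sHW; rewrite cents_norm // centsC (subset_trans sHW) // (subset_trans sWZ) //.
  exact: subsetIr.
have nW u : (forall v, v \in V -> [~ v, u] \in W) -> u \in 'N(W).
  move=> cu; rewrite inE; apply/subsetP=> _ /imsetP[w Ww ->].
  by rewrite -[w ^ u](mulKVg w) -commgEl groupM // cu // (subsetP sWV).
have cW v : v \in V -> [~ v, t] \in W.
  by move=> Vv; rewrite (subsetP (joing_subl _ _)) ?tz.
have cW' v : v \in V -> [~ v, t'] \in W.
  by move=> Vv; rewrite (subsetP (joing_subr _ _)) ?tz'.
have nUt : t \in 'N(U) by rewrite inE -cycleJ fixz'.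
have nUt' : t' \in 'N(U) by rewrite inE -cycleJ fixz't.
have c1 : [~: V, J] \subset W by apply: comm_joing_sub; rewrite ?nUV ?nW.
have c2 : [~: W, J] \subset U.
  apply: comm_joing_sub => //; first by rewrite (subset_trans sWV) ?nUV.
    move=> w Ww; suff -> : [~ w, t] = 1 by rewrite group1.
    apply/eqP/commgP/cent1P; move: w Ww; apply/subsetP.
    by rewrite join_subG !cycle_subG; apply/andP; split; apply/cent1P/commgP/conjg_fixP.
  by move=> w Ww; rewrite tz' // (subsetP sWV).
have c3 : [~: U, J] = 1.
  apply/commG1P; rewrite centsC join_subG !cycle_subG /U /= cent_cycle.
  by apply/andP; split; apply/cent1P/commute_sym/commgP/conjg_fixP.
have sbJ : <[b]> \subset J by rewrite cycle_subG.
apply: (coprime_stable_chain (W := W) (U := U)) => //.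
- by move: Jb; apply/subsetP; rewrite join_subG !cycle_subG nVt.
- exact: subset_trans (commgS _ sbJ) c1.
- exact: subset_trans (commgS _ sbJ) c2.
by apply/trivgP; rewrite /= -c3 commgS.
Qed.

Section TISylow.

Variables (gT : finGroupType) (V X S : {group gT}).
Hypothesis abV : 2.-abelem V.
Hypothesis leV : #|V| <= 8.
Hypothesis nVX : X \subset 'N(V).
Hypothesis sylS : 2.-Sylow(X) S.
Hypothesis sIS : 'C_X(V) \subset S.
Hypothesis TI : forall g, g \in X -> g \notin S -> S :&: S :^ g \subset 'C_X(V).
Hypothesis neXS : X :!=: S.

(* Some [t] in [S] acts on [V] as the transvection with center [z] and axis [V2]; [z ^ g] lies
   in [V2] only for [g] in [S].  A third coset of ['C_X(V)] in [S] would put every point off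
   [V2] in the orbit of [z], while a conjugate of [V2] meets that orbit only once. *)
Lemma TI_sylow_index : #|S : 'C_X(V)| <= 2.
Proof.
have sSX := pHall_sub sylS; have pS := pHall_pgroup sylS.
have cVV := abelem_abelian abV; have pV := abelem_pgroup abV.
have nIX : 'C_X(V) <| X.
  by rewrite /normal subsetIl normsI ?normG // (subset_trans nVX) ?norms_cent.
pose I := 'C_X(V)%G; change (#|S : I| <= 2); have {}nIX : I <| X := nIX.
have nIS : S \subset 'N(I) := subset_trans sSX (normal_norm nIX).
rewrite leqNgt; apply/negP=> gt2.
have ntSI : S / I != 1.
  by rewrite -cardG_gt1 card_quotient // (leq_trans _ gt2).
have pSI : 2.-group (S / I) := quotient_pgroup _ pS.
(* An involution of the centre of [S / I], so that [S] preserves the centre and the axis of the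
   transvection. *)
have [t [St nIt It2 cSt]] : exists t,
    [/\ t \in S, t \notin I, t ^+ 2 \in I & forall s, s \in S -> [~ t, s] \in I].
  have ntZ : 'Z(S / I) != 1 by rewrite center_nil_eq1 ?(pgroup_nil pSI).
  have [_ dv _] := pgroup_pdiv (pgroupS (center_sub _) pSI) ntZ.
  have [tb /setIP[/morphimP[t nt St ->] cst] ot] := Cauchy (isT : prime 2) dv.
  exists t; split=> // [||s Ss].
  - by rewrite -(coset_eq1 nt) -order_gt1 ot.
  - have nt2 : t ^+ 2 \in 'N(I) by rewrite groupX.
    rewrite -(coset_eq1 nt2) -[coset I _]/(coset_morphism I _) morphX //.
    by apply/eqP; rewrite -[X in _ ^+ X]ot expg_order.
  have ns := subsetP nIS s Ss; have nts : [~ t, s] \in 'N(I) by rewrite groupR.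
  rewrite -(coset_eq1 nts) -[coset I _]/(coset_morphism I _) morphR //.
  by apply/commgP; apply: (centP cst); rewrite mem_quotient.
have Xt := subsetP sSX t St; have nVt := subsetP nVX t Xt.
have IC u : u \in I -> u \in 'C(V) by case/setIP.
have CI u : u \in X -> u \in 'C(V) -> u \in I by move=> Xu cu; apply/setIP.
have nct : t \notin 'C(V) by apply: contra nIt; apply: CI.
have [z [V2z oz i2 le4 tz]] := transvection_abelem abV leV nVt nct (IC _ It2).
set V2 := 'C_V[t]%G in V2z i2 le4.
have sV2V : V2 \subset V := subsetIl _ _.
have Vz := subsetP sV2V z V2z.
have zcyc u : u \in <[z]> -> u = 1 \/ u = z.
  by rewrite (cycle2g oz) !inE => /orP[]/eqP->; [left|right].
have offV2 v : v \in V -> v \notin V2 -> v ^ t = v * z.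
  move=> Vv nv; have [E1|E1] := zcyc _ (tz v Vv).
    by case/negP: nv; rewrite inE Vv; apply/cent1P/commgP; rewrite E1.
  by rewrite -E1 commgEl mulKVg.
have memV2 v : v \in V -> v ^ t = v -> v \in V2.
  by move=> Vv Ev; rewrite inE Vv; apply/cent1P/commgP/conjg_fixP.
have inV2 v : v \in V2 -> v ^ t = v.
  by case/setIP=> _ /cent1P cv; apply/conjg_fixP/commgP.
have tS s v : s \in S -> v \in V -> v ^ (t ^ s) = v ^ t.
  move=> Ss Vv; have -> : t ^ s = t * [~ t, s] by rewrite commgEl mulKVg.
  rewrite conjgM; apply/conjg_fixP/commgP/commute_sym.
  by apply: (centP (IC _ (cSt s Ss))); rewrite memJ_norm.
have V2S s v : s \in S -> v \in V2 -> v ^ s \in V2.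
  move=> Ss V2v; have Vv := subsetP sV2V v V2v.
  have ns := subsetP nVX s (subsetP sSX s Ss).
  have Vvs : v ^ s \in V by rewrite memJ_norm.
  apply: memV2 => //; rewrite -(tS s) // -conjgM -conjgC conjgM.
  by rewrite (inV2 v).
have [p0 Vp0 np0] : exists2 v, v \in V & v \notin V2.
  by apply/subsetPn; rewrite -indexg_gt1 i2.
have zS s : s \in S -> z ^ s = z.
  move=> Ss; have ns := subsetP nVX s (subsetP sSX s Ss).
  have np : p0 ^ s \notin V2.
    apply: contra np0 => V2p; have := V2S _ _ (groupVr Ss) V2p.
    by rewrite conjgK.
  have Vp : p0 ^ s \in V by rewrite memJ_norm.
  have := tS s _ Ss Vp; rewrite offV2 // -conjgM -conjgC conjgM offV2 // conjMg.
  exact: mulgI.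
(* If [z ^ g] lies on the axis of [t], then [transvections_odd_cent] makes the group generated by
   [t] and [t ^ g] a 2-group, which [TI_conj_npgroup] forbids for [g] outside [S]. *)
have zX g : g \in X -> z ^ g \in V2 -> g \in S.
  move=> Xg V2zg; apply/negPn/negP=> nSg.
  have nVg := subsetP nVX g Xg.
  pose t' := t ^ g; pose z' := z ^ g; pose J := (<[t]> <*> <[t']>)%G.
  have Xt' : t' \in X by rewrite groupJ.
  have sJX : J \subset X by rewrite join_subG !cycle_subG Xt.
  have Vz' : z' \in V by rewrite memJ_norm.
  have tz' v : v \in V -> [~ v, t'] \in <[z']>.
    move=> Vv; rewrite -[v](conjgKV g) -conjRg cycleJ memJ_conjg.
    by apply: tz; rewrite memJ_norm ?groupV.
  have Jt : t \in J by rewrite (subsetP (joing_subl _ _)) ?cycle_id.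
  have Jt' : t' \in J by rewrite (subsetP (joing_subr _ _)) ?cycle_id.
  case/negP: (TI_conj_npgroup sylS (normal_norm nIX) TI St nIt Xg nSg sJX Jt Jt').
  apply: odd_elt1_pgroup => b Jb odb; have Xb := subsetP sJX b Jb.
  have cb : b \in 'C(V).
    apply: (transvections_odd_cent (t := t) (t' := t') (z := z) (z' := z')) => //.
    - by rewrite (center_idP cVV).
    - by rewrite (center_idP cVV).
    - exact: subsetP nVX t' Xt'.
    - exact: inV2.
    - exact: inV2.
    by rewrite -conjJg (inV2 z).
  have Sb := subsetP sIS b (CI b Xb cb).
  by apply/eqP; rewrite -order_eq1 (pnat_1 (mem_p_elt pS Sb)) // -odd_2'nat.
have [h Sh nh] : exists2 h, h \in S & h \notin I <*> <[t]>.
  apply/subsetPn; apply/negP=> sSJ.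
  have nIt' : <[t]> \subset 'N(I) by rewrite cycle_subG (subsetP nIS).
  have : #|I <*> <[t]> : I| <= 2.
    rewrite norm_joinEr // indexMg -card_quotient // quotient_cycle ?(subsetP nIS) //.
    rewrite -orderE dvdn_leq // order_dvdn -[coset _ t]/(coset_morphism I t) -morphX ?(subsetP nIS) //=.
    by rewrite coset_id.
  rewrite leqNgt => /negP[]; apply: leq_trans gt2 _.
  by rewrite subset_leq_card // imsetS.
have sIJ : I \subset I <*> <[t]> := joing_subl _ _.
have Jt : t \in I <*> <[t]> by rewrite (subsetP (joing_subr _ _)) ?cycle_id.
have [g Xg nSg] : exists2 g, g \in X & g \notin S.
  by apply/subsetPn; apply: contra neXS => sXS; rewrite eqEsubset sXS sSX.
have nVg := subsetP nVX g Xg; pose p := z ^ g.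
have Vp : p \in V by rewrite memJ_norm.
have np : p \notin V2 by apply: contra nSg; apply: zX.
have Xh := subsetP sSX h Sh.
have fixp s : s \in S -> p ^ s = p -> s \in I.
  move=> Ss ps; apply: (subsetP (TI Xg nSg)); rewrite inE Ss /= mem_conjg.
  apply: zX; first by rewrite groupJ ?groupV // (subsetP sSX).
  have -> : z ^ (s ^ g^-1) = z; last by [].
  by rewrite -{1}(conjgK g z) -conjJg -/p ps conjgK.
have nV2ph : p ^ h \notin V2.
  by apply: contra np => V2p; have := V2S _ _ (groupVr Sh) V2p; rewrite conjgK.
have Vph : p ^ h \in V by rewrite memJ_norm // (subsetP nVX).
pose q1 := p^-1 * p ^ h.
have V2q1 : q1 \in V2 by apply: (index_le2_mulVg sV2V); rewrite ?i2.
have nq1 : q1 \notin <[z]>.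
  apply/negP=> /zcyc[E1|E1].
    case/negP: nh; apply: (subsetP sIJ); apply: fixp => //.
    by rewrite -[p ^ h](mulKVg p) -/q1 E1 mulg1.
  have Eph : p ^ h = p ^ t by rewrite offV2 // -E1 mulKVg.
  case/negP: nh; rewrite -(mulgKV t h) groupM // (subsetP sIJ) // fixp //.
    by rewrite groupM ?groupV.
  by rewrite conjgM Eph conjgK.
have szV2 : <[z]> \subset V2 by rewrite cycle_subG.
(* [V2] has index 2 in [V] and order more than 2, as it contains [q1] besides [<[z]>]; so it meets
   its conjugate nontrivially. *)
have [q [V2q Vgq ntq]] : exists q, [/\ q \in V2, q \in V2 :^ g & q != 1].
  have /subsetPn[q /setIP[V2q Vgq] ntq] : ~~ (V2 :&: V2 :^ g \subset 1%G).
    apply/negP=> /trivgP T1; have := mul_cardG V2 (V2 :^ g)%G; rewrite /= T1 cards1 muln1 cardJg => E1.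
    have leVV : #|V2 * V2 :^ g| <= #|V|.
      by rewrite subset_leq_card // mul_subG // -(normP nVg) conjSg.
    have : #|V2| <= 2.
      by rewrite -(leq_pmul2l (cardG_gt0 V2)) E1 (leq_trans leVV) // -(Lagrange sV2V) i2.
    rewrite leqNgt => /negP[]; rewrite -oz orderE proper_card // properEneq szV2 andbT.
    by apply: contra nq1 => /eqP->.
  by exists q; rewrite V2q Vgq; rewrite inE in ntq.
have orb u : u \in X -> z ^ u \in V2 :^ g -> z ^ u = p.
  move=> Xu; rewrite mem_conjg -conjgM => V2u.
  have Xug : u * g^-1 \in X by rewrite groupM ?groupV.
  have := zS _ (zX _ Xug V2u); rewrite conjgM => E1.
  by rewrite -[LHS](conjgKV g) E1.
have V2gp : p \in V2 :^ g by rewrite memJ_conjg.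
have pq u : u \in X -> z ^ u = p * q -> False.
  move=> Xu Eu; have := orb u Xu; rewrite Eu groupM // => /(_ isT) /eqP.
  by rewrite -{2}[p]mulg1 (inj_eq (mulgI p)) (negPf ntq).
have nqz : q \notin <[z]>.
  apply/negP=> /zcyc[E1|E1]; first by rewrite E1 eqxx in ntq.
  have := Vgq; rewrite E1 mem_conjg => /(zX _ (groupVr Xg)).
  by rewrite groupV (negPf nSg).
(* Hence [p * q] is [p ^ h] or [p ^ (h * t)]: a second point of the orbit of [z] in [V2 :^ g],
   against [orb]. *)
have : q^-1 * q1 \in <[z]>.
  apply: (index_le2_mulVg szV2) => //.
  rewrite -(leq_pmul2l (cardG_gt0 <[z]>)) Lagrange // -orderE oz. exact: le4.
have Xgh : g * h \in X by rewrite groupM.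
case/zcyc=> E1.
  have Eq : q1 = q by rewrite -[q1](mulKVg q) E1 mulg1.
  by apply: (pq _ Xgh); rewrite conjgM -/p -Eq mulKVg.
have Eq : q1 * z = q.
  have zz : z * z = 1 by rewrite -(expgS z 1) -[X in _ ^+ X]oz expg_order.
  by rewrite -[q1](mulKVg q) E1 -mulgA zz mulg1.
apply: (pq (g * h * t)); first by rewrite groupM.
by rewrite !conjgM -/p offV2 // -Eq mulgA mulKVg.
Qed.

End TISylow.

(* Two conjugate involutions modulo [I] generate a dihedral group of twice odd order. *)
Lemma ex_inverted_odd (gT : finGroupType) (X S I : {group gT}) :
    2.-Sylow(X) S -> I <| X -> I \proper S -> #|S : I| <= 2 -> X :!=: S ->
    (forall g, g \in X -> g \notin S -> S :&: S :^ g \subset I) ->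
  exists a t, [/\ a \in X, a != 1, odd #[a], t \in S /\ t \notin I & a ^ t = a^-1].
Proof.
move=> sylS nIX prIS leSI neXS TI; have sIS := proper_sub prIS.
have sSX := pHall_sub sylS; have pS := pHall_pgroup sylS; have pI := pgroupS sIS pS.
have nI := subsetP (normal_norm nIX).
have [x Xx nSx] : exists2 g, g \in X & g \notin S.
  by apply/subsetPn; apply: contra neXS => sXS; rewrite eqEsubset sXS sSX.
have nIS : S \subset 'N(I) := subset_trans sSX (normal_norm nIX).
have [t St nIt] : exists2 t, t \in S & t \notin I by apply/subsetPn/proper_subn.
have Xt := subsetP sSX t St.
pose b := coset I.
have It2 : t ^+ 2 \in I.
  have := index_le2_mulVg sIS leSI (groupVr St) St; rewrite groupV invgK -(expgS t 1).
  exact.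
have bt2 : b t ^+ 2 = 1 by rewrite /b -morphX ?nI //= coset_id.
have nbt : b t != 1 by rewrite /b coset_eq1 ?nI.
pose t' := t ^ x; have Xt' : t' \in X by rewrite groupJ.
have bt'2 : b t' ^+ 2 = 1 by rewrite /b /t' morphJ ?nI //= -conjXg bt2 conj1g.
have nbtt' : b t != b t'.
  apply/eqP=> Eb; have It't : t^-1 * t' \in I.
    rewrite -coset_eq1 ?nI ?groupM ?groupV // -[coset I _]/(coset_morphism I _).
    by rewrite morphM ?morphV ?groupV ?nI //= -/b Eb mulVg.
  have St' : t' \in S by rewrite -(mulKVg t t') groupM // (subsetP sIS).
  case/negP: nIt; rewrite -(memJ_norm (x := x)) ?nI //; apply: (subsetP (TI x Xx nSx)).
  by rewrite inE St' memJ_conjg.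
have sylb : 2.-Sylow(X / I) (S / I) by apply: quotient_pHall => //; apply: normal_norm.
(* Two commuting involutions of [X / I] generate a 2-group, and the Sylow 2-subgroups of [X / I]
   have order at most 2. *)
have cardb (u v : coset_of I) : u \in X / I -> v \in X / I -> u ^+ 2 = 1 -> v ^+ 2 = 1 ->
    commute u v -> u != 1 -> v != 1 -> u = v.
  move=> Xu Xv u2 v2 cuv nu nv; pose J := (<[u]> <*> <[v]>)%G.
  have sJX : J \subset X / I by rewrite join_subG !cycle_subG Xu.
  have pJ : 2.-group J.
    have nuv : <[v]> \subset 'N(<[u]>).
      by rewrite cents_norm // cent_cycle cycle_subG; apply/cent1P; apply: commute_sym.
    have p2 (w : coset_of I) : w ^+ 2 = 1 -> 2.-group <[w]>.
      by move=> w2; apply: (pnat_dvd (n := 2)) => //; rewrite -orderE order_dvdn w2.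
    by rewrite /J /= norm_joinEr // pgroupM !p2.
  have [y Xy sJS] := Sylow_subJ sylb sJX pJ.
  have leJ : #|J| <= 2.
    apply: leq_trans (subset_leq_card sJS) _.
    by rewrite cardJg card_quotient.
  have Ju : u \in J by rewrite (subsetP (joing_subl _ _)) ?cycle_id.
  have Jv : v \in J by rewrite (subsetP (joing_subr _ _)) ?cycle_id.
  have := index_le2_mulVg (sub1G J); rewrite indexg1 => /(_ u v leJ Ju Jv).
  by rewrite !inE => /(_ nu nv) /eqP E1; rewrite -[v](mulKVg u) E1 mulg1.
have mb u : u \in X -> b u \in X / I by move=> Xu; rewrite mem_quotient.
pose r := b t * b t'.
have Xr : r \in X / I by rewrite groupM ?mb.
have inv2 (u : coset_of I) : u ^+ 2 = 1 -> u^-1 = u.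
  by move=> u2; apply/eqP; rewrite eq_invg_mul -(expgS u 1) u2.
have nr : r != 1 by rewrite -eq_invg_mul inv2.
have Er : r^-1 = b t' * b t by rewrite /r invMg !inv2.
have rt : r ^ b t = r^-1 by rewrite /conjg -mulgA Er /r mulKg.
have rt' : r ^ b t' = r^-1 by rewrite Er /r /conjg -(mulgA (b t)) -(expgS (b t') 1) bt'2 mulg1 inv2.
(* An involution in [<[r]>] would commute with both [b t] and [b t'], and so equal both. *)
have or : odd #[r].
  rewrite -[odd _]negbK; apply/negP=> evr.
  have dv : 2 %| #|<[r]>| by rewrite -orderE dvdn2.
  have [i /cycleP[k Ei] oi] := Cauchy (isT : prime 2) dv.
  have i2 : i ^+ 2 = 1 by rewrite -[X in _ ^+ X]oi expg_order.
  have Xi : i \in X / I by rewrite Ei groupX.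
  have ni : i != 1 by rewrite -order_gt1 oi.
  have inv_fix u : r ^ u = r^-1 -> commute u i.
    move=> ru; apply/commute_sym/commgP/conjg_fixP.
    by rewrite Ei conjXg ru expgVn -Ei inv2.
  case/eqP: nbtt'; rewrite (cardb (b t) i) ?mb //; last exact: inv_fix.
  rewrite (cardb (b t') i) ?mb //; first exact: inv_fix.
  by rewrite /b /t' morphJ ?nI //= conjg_eq1.
have [u nu Xu Eu] := morphimP Xr.
pose a := u.`_2^'; have Xa : a \in X by rewrite groupX.
have ba : b a = r.
  rewrite /a /b -[coset I _]/(coset_morphism I _) morph_constt //= -[coset I u]Eu.
  by apply: constt_p_elt; rewrite /p_elt -odd_2'nat.
have oa : odd #[a] by rewrite odd_2'nat; apply: p_elt_constt.
have coI : coprime #|I| #|<[a]>|.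
  by case/p_natP: pI => k ->; rewrite coprimeXl // coprime2n.
have nIa : <[a]> \subset 'N(I) by rewrite cycle_subG nI.
have sat : <[a ^ t]> \subset I * <[a]>.
  rewrite -norm_joinEr // cycle_subG /= norm_joinEr // -(mulgKV a^-1 (a ^ t)).
  rewrite mem_mulg ?groupV ?cycle_id // invgK.
  have Xata : a ^ t * a \in X by rewrite groupM ?groupJ.
  rewrite -(coset_eq1 (nI _ Xata)) -[coset I _]/(coset_morphism I _).
  by rewrite morphM ?morphJ ?groupJ ?nI //= -/b ba rt mulVg.
have oat : #|<[a ^ t]>| = #|<[a]>| by rewrite -!orderE orderJ.
(* Modulo [I], [t] inverts [a]; to make this exact, the two complements [<[a ^ t]>] and [<[a]>] of
   [I] are matched by some [i] in [I], which is then absorbed into [t]. *)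
have [i Ii Eat] := SchurZassenhaus_trans_sol (pgroup_sol pI) nIa sat coI oat.
have Si := subsetP sIS i Ii; have Xi := subsetP sSX i Si.
exists a, (t * i^-1); split=> //.
- by apply: contra nr => /eqP a1; rewrite -ba a1 /b -[coset I 1]/(coset_morphism I 1) morph1.
- by rewrite groupM ?groupV // groupMr ?groupV.
have aa : a ^ (t * i^-1) \in <[a]>.
  by rewrite conjgM -mem_conjg -Eat cycle_id.
have aI : <[a]> :&: I = 1 by apply: coprime_TIg; rewrite coprime_sym.
have ba1 : b (a ^ (t * i^-1)) = b a^-1.
  have E1 : b (a ^ t) = r^-1 by rewrite /b morphJ ?nI //= -/b ba rt.
  have bi : b i^-1 = 1 by rewrite /b coset_id ?groupV.
  rewrite conjgM /b morphJ ?nI ?groupJ ?groupV //= -/b E1 bi conjg1.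
  by rewrite /b morphV ?nI //= -/b ba.
have : (a ^ (t * i^-1))^-1 * a^-1 \in <[a]> :&: I.
  rewrite inE groupM ?groupV ?cycle_id //=.
  have Xaa : (a ^ (t * i^-1))^-1 * a^-1 \in X by rewrite groupM ?groupV ?groupJ ?groupM ?groupV.
  rewrite -(coset_eq1 (nI _ Xaa)).
  rewrite -[coset I _]/(coset_morphism I _) morphM ?groupV ?nI ?groupJ ?groupM ?groupV //.
  by rewrite morphV ?nI ?groupJ ?groupM ?groupV //= -/b ba1 mulVg.
by rewrite aI inE -eq_mulVg1 => /eqP.
Qed.

(** Reduction to the action on [Q / 'Phi(Q)]. The elements of [X] acting trivially there form a
    normal 2-subgroup by [coprime_cent_Phi]; it lies in [S] and its conjugates, hence in [I], so [I]
    is exactly the kernel. *)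
Lemma TI_sylow_index_Phi (gT : finGroupType) (Q X S I : {group gT}) :
    2.-group Q -> #|Q : 'Phi(Q)| <= 8 -> X \subset 'N(Q) -> 'C_X(Q) = 1 -> Q :&: X = 1 ->
    2.-Sylow(X) S -> I <| X -> I \subset S -> [~: Q, I] \subset 'Phi(Q) ->
    (forall g, g \in X -> g \notin S -> S :&: S :^ g \subset I) -> X :!=: S ->
  #|S : I| <= 2.
Proof.
move=> pQ le8 nQX fX tiQX sylS nIX sIS trI TI neXS.
have sSX := pHall_sub sylS; have pS := pHall_pgroup sylS.
pose M := 'Phi(Q)%G; have sMQ : M \subset Q := Phi_sub _.
have nMX : X \subset 'N(M) := subset_trans nQX (char_norms (Phi_char _)).
have nMQ : Q \subset 'N(M) := normal_norm (Phi_normal _).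
have nM := subsetP nMX.
have inj u v : u \in X -> v \in X -> coset M u = coset M v -> u = v.
  move=> Xu Xv Euv; have Xuv : u^-1 * v \in X by rewrite groupM ?groupV.
  have : u^-1 * v \in Q :&: X.
    rewrite inE Xuv andbT (subsetP sMQ) // -(coset_eq1 (nM _ Xuv)).
    rewrite -[coset M _]/(coset_morphism M _) morphM ?morphV ?groupV ?nM //=.
    by rewrite Euv mulVg.
  by rewrite tiQX inE => /eqP E1; rewrite -[v](mulKVg u) E1 mulg1.
have sIX := subset_trans sIS sSX.
have centE u : u \in X -> coset M u \in 'C(Q / M) -> [~: Q, <[u]>] \subset M.
  move=> Xu cu; rewrite commGC -quotient_cents2 ?cycle_subG ?nM //.
  by rewrite quotient_cycle ?nM // cycle_subG.
pose N := (X :&: coset M @*^-1 'C(Q / M))%G.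
have nNX : N <| X.
  rewrite /normal subsetIl normsI ?normG //.
  have := morphpre_norms (coset_morphism M) (norms_cent (quotient_norms M nQX)).
  by apply: subset_trans; rewrite -sub_morphim_pre.
have pN : 2.-group N.
  apply: odd_elt1_pgroup => b /setIP[Xb /morphpreP[nb cb]] odb; apply/set1P.
  rewrite -[[set 1]]fX inE Xb -cycle_subG; apply: (coprime_cent_Phi pQ); rewrite ?centE //.
    by case/p_natP: pQ => k ->; rewrite coprimeXl // coprime2n.
  by rewrite cycle_subG (subsetP nQX).
have [x Xx nSx] : exists2 g, g \in X & g \notin S.
  by apply/subsetPn; apply: contra neXS => sXS; rewrite eqEsubset sXS sSX.
have sNS : N \subset S by apply: normal_sub_max_pgroup (Hall_max sylS) pN nNX.
have sNI : N \subset I.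
  apply: subset_trans (TI x Xx nSx); rewrite subsetI sNS -{1}(normP (subsetP (normal_norm nNX) x Xx)).
  by rewrite conjSg.
have EI : 'C_(X / M)(Q / M) = I / M.
  apply/eqP; rewrite eqEsubset; apply/andP; split.
    apply/subsetP=> _ /setIP[/morphimP[u nu Xu ->] cu]; rewrite mem_quotient //.
    by apply: (subsetP sNI); rewrite inE Xu; apply/morphpreP.
  by rewrite subsetI quotientS // quotient_cents2r // commGC.
have := @TI_sylow_index _ (Q / M)%G (X / M)%G (S / M)%G.
rewrite /= EI => H.
have -> : #|S : I| = #|S / M : I / M|.
  have oq (H1 : {group gT}) : H1 \subset X -> #|H1 / M| = #|H1|.
    move=> sHX; apply/esym/card_isog/quotient_isog; first exact: subset_trans nMX.
    by apply/trivgP; rewrite -tiQX setISS.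
  by rewrite -!divgS ?quotientS // !oq.
apply: H; rewrite ?Phi_quotient_abelem ?card_quotient ?quotient_norms ?quotientS //.
- by apply: quotient_pHall; rewrite ?(subset_trans sSX).
- move=> _ /morphimP[g ng Xg ->] nSg.
  have {}nSg : g \notin S by apply: contra nSg => Sg; rewrite mem_quotient.
  apply/subsetP=> _ /setIP[/morphimP[s ns Ss ->]]; rewrite -quotientJ //.
  case/morphimP=> s' ns' Ss' Es; have Xs := subsetP sSX s Ss.
  have Xs' : s' \in X by move: Ss'; apply: subsetP; rewrite -(conjGid Xg) conjSg.
  rewrite mem_quotient // (subsetP (TI g Xg nSg)) // inE Ss.
  by rewrite (inj s s').
apply: contra neXS => /eqP Eq; rewrite eqEsubset sSX andbT.
apply/subsetP=> u Xu; have : coset M u \in S / M by rewrite -Eq mem_quotient.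
by case/morphimP=> s ns Ss Es; rewrite (inj u s) // (subsetP sSX).
Qed.

(** In the semidirect product of [Q] by [Aut Q], automorphisms become elements acting by
    conjugation, so the lemmas on normalizing elements apply to them. *)
Lemma holomorph (gT : finGroupType) (Q : {group gT}) :
  exists (hT : finGroupType) (f : {morphism Q >-> hT}) (g : {morphism Aut Q >-> hT}),
    [/\ 'injm f, 'injm g, f @* Q :&: g @* Aut Q = 1,
        {in Q & Aut Q, forall x a, f x ^ g a = f (a x)}
      & {in Aut Q, forall a, g a \in 'N(f @* Q) /\ (g a \in 'C(f @* Q) -> a = 1)}].
Proof.
pose to := [Aut Q]%gact; exists (sdprod_by to).
exists (sdpair1_morphism to), (sdpair2_morphism to).
have act : {in Q & Aut Q, forall x a, sdpair1 to x ^ sdpair2 to a = sdpair1 to (a x)}.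
  by move=> x a Qx Aa; rewrite -sdpair_act.
split=> //; first exact: injm_sdpair1; first exact: injm_sdpair2; first exact: im_sdpair_TI.
move=> a Aa; split=> [|ca].
  by rewrite (subsetP (im_sdpair_norm to)) ?mem_morphim.
apply: (eq_Aut Aa (group1 _)) => x Qx; rewrite perm1.
apply: (injmP (injm_sdpair1 to)); rewrite ?Aut_closed //= -act //.
by apply/conjg_fixP/commgP/commute_sym; apply: (centP ca); rewrite mem_morphim.
Qed.

Lemma index_injm (aT rT : finGroupType) (D G H : {group aT}) (f : {morphism D >-> rT}) :
  'injm f -> G \subset D -> H \subset G -> #|f @* G : f @* H| = #|G : H|.
Proof.
move=> injf sGD sHG; rewrite -!divgS ?morphimS //.
by rewrite !card_injm // (subset_trans sHG).
Qed.

Lemma conj_aut_conjg (gT : finGroupType) (Q : {group gT}) b q :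
  b \in Aut Q -> q \in Q -> conj_aut Q q ^ b = conj_aut Q (b q).
Proof.
move=> Ab Qq; have Qbq : b q \in Q by rewrite Aut_closed.
apply: (eq_Aut (A := Q)); rewrite ?groupJ ?Aut_aut // => x Qx.
have Qbx : (b^-1)%g x \in Q by rewrite Aut_closed ?groupV.
rewrite conj_autE // /conjg !permM.
rewrite conj_autE // -(autmE Ab) !morphM ?morphV ?groupM ?groupV //= autmE.
by rewrite permKV.
Qed.

(** * Transfer to the semidirect product and back to [P] *)

Section EssentialTransfer.

Variables (gT : finGroupType) (P Q Q0 : {group gT}) (X : {group {perm gT}}).
Hypothesis pP : 2.-group P.
Hypothesis prQ : Q \proper P.
Hypothesis cQ : 'C_P(Q) \subset Q.
Hypothesis sXA : X \subset Aut Q.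
Local Notation S := (conj_aut Q @* 'N_P(Q)).
Local Notation I := (conj_aut Q @* Q).
Hypothesis sylS : 2.-Sylow(X) S.
Hypothesis TI : forall x, x \in X -> x \notin S -> S :&: S :^ x \subset I.
Hypothesis neXS : X :!=: S.
Hypothesis sQ0 : Q0 \subset Q.
Hypothesis iQ0 : #|Q : Q0| <= 2.
Hypothesis rk : forall L : {group gT}, L \subset Q0 -> #|L : 'Phi(L)| <= 4.

Let sQP := proper_sub prQ.
Let pQ := pgroupS sQP pP.
Let sQN : Q \subset 'N_P(Q). Proof. by rewrite subsetI sQP normG. Qed.

Lemma inn_normal : I <| X.
Proof.
rewrite /normal (subset_trans (morphimS _ sQN) (pHall_sub sylS)).
apply/subsetP=> b Xb; have Ab := subsetP sXA b Xb.
rewrite inE; apply/subsetP=> _ /imsetP[_ /morphimP[q nq Qq ->] ->].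
rewrite conj_aut_conjg // mem_morphim ?(subsetP (normG Q)) ?Aut_closed //.
Qed.

Lemma conj_aut_mem_inn n : n \in 'N_P(Q) -> conj_aut Q n \in I -> n \in Q.
Proof.
case/setIP=> Pn nn /morphimP[q nq Qq Enq].
have : q^-1 * n \in 'ker (conj_aut Q).
  by apply/kerP; rewrite ?groupM ?groupV // morphM ?morphV ?groupV //= Enq mulVg.
rewrite ker_conj_aut => cqn; rewrite -(mulKVg q n) groupM // (subsetP cQ) //.
by apply/setIP; split; rewrite // groupM ?groupV // (subsetP sQP).
Qed.

Lemma inn_proper : I \proper S.
Proof.
have /properP[_ [n Nn nQn]] := nilpotent_proper_norm (pgroup_nil pP) prQ.
apply/properP; split; first exact: morphimS.
exists (conj_aut Q n); last by apply: contra nQn; apply: conj_aut_mem_inn.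
by rewrite mem_morphim //; case/setIP: Nn.
Qed.

(** Because [Q] contains its centralizer in [P], [S / I] is a copy of ['N_P(Q) / Q], so the index
    bound for [S] carries over to ['N_P(Q)], and the inverting [t], found in the image of [S], comes
    from some [t0] in ['N_P(Q)]. *)
Lemma essential_inverted :
  #|'N_P(Q) : Q| <= 2 /\
  exists (hT : finGroupType) (f : {morphism Q >-> hT}) (a t : hT) (t0 : gT),
  [/\ 'injm f, a \in 'N(f @* Q), odd #[a] & a \notin 'C(f @* Q)] /\
  [/\ t \in 'N(f @* Q) /\ 2.-elt t, a ^ t = a^-1, t0 \in 'N_P(Q), t0 \notin Q
    & forall x, x \in Q -> f x ^ t = f (x ^ t0)].
Proof.
have [hT [f [g [injf injg tifg act gAut]]]] := holomorph Q.
have sSX := pHall_sub sylS; have sIX := normal_sub inn_normal; have sIS := proper_sub inn_proper.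
have sSA := subset_trans sSX sXA.
have nf u : u \in Aut Q -> g u \in 'N(f @* Q) by move=> /gAut[].
have fix1 u : u \in Aut Q -> g u \in 'C(f @* Q) -> u = 1 by move=> /gAut[].
have gX : g @* X \subset 'N(f @* Q).
  by apply/subsetP=> _ /morphimP[u Au _ ->]; apply: nf.
have cgX : 'C_(g @* X)(f @* Q) = 1.
  apply/trivgP/subsetP=> _ /setIP[/morphimP[u Au _ ->] cu].
  by rewrite (fix1 u) // morph1 inE.
have tiX : f @* Q :&: g @* X = 1 by apply/trivgP; rewrite -tifg setIS ?morphimS.
have sylg : 2.-Sylow(g @* X) (g @* S) by rewrite morphim_pHall.
have nIg : g @* I <| g @* X by apply: morphim_normal; apply: inn_normal.
have prIg : g @* I \proper g @* S by rewrite injm_proper ?inn_proper // (subset_trans sIX).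
have memg u (B : {set {perm gT}}) : B \subset Aut Q -> u \in Aut Q -> (g u \in g @* B) = (u \in B).
  move=> sBA Au; apply/idP/idP=> [|Bu]; last by rewrite mem_morphim.
  by case/morphimP=> v Av Bv /(injmP injg)-> .
have TIg h : h \in g @* X -> h \notin g @* S -> g @* S :&: (g @* S) :^ h \subset g @* I.
  case/morphimP=> u Au Xu ->; rewrite memg // => nSu.
  by rewrite -morphimJ // -injmI // morphimS // TI.
have neg : g @* X != g @* S by apply: contra neXS; rewrite injm_eq.
have trg : [~: f @* Q, g @* I] \subset 'Phi(f @* Q).
  rewrite gen_subG; apply/subsetP=> _ /imset2P[_ _ /morphimP[x _ Qx ->] /morphimP[u Au Iu ->] ->].
  case/morphimP: Iu Au => q nq Qq -> Au.
  rewrite commgEl act // conj_autE // -morphV // -morphM ?groupV ?groupJ // -commgEl.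
  have EPhi : 'Phi(f @* Q) = (f @* Q)^`(1) <*> 'Mho^1(f @* Q) := Phi_joing (morphim_pgroup f pQ).
  rewrite morphR //= EPhi mem_gen // inE.
  by rewrite mem_commg // mem_morphim.
have le8 : #|f @* Q : 'Phi(f @* Q)| <= 8.
  rewrite -injm_Phi // index_injm ?Phi_sub //.
  exact: index_Phi_le8 pQ sQ0 iQ0 (rk (subxx _)).
have leSI := TI_sylow_index_Phi (morphim_pgroup f pQ) le8 gX cgX tiX sylg nIg (proper_sub prIg) trg TIg neg.
have [a [t [Xa nta oa [St nIt] a_t]]] := ex_inverted_odd sylg nIg prIg leSI neg TIg.
have [u Au Xu Ea] := morphimP Xa.
have [s As Ss Et] := morphimP St.
have [t0 nt0 Nt0 Es] := morphimP Ss; rewrite {s Ss}Es in As Et.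
split.
  move: leSI; rewrite index_injm //; have := index_morphim_ker (conj_aut_morphism Q) sQN (subsetIr _ _).
  rewrite /= ker_conj_aut => <-; suff -> : #|'N_P(Q) :&: 'C(Q) : Q| = 1%N by rewrite muln1.
  by apply/eqP; rewrite indexg_eq1 (subset_trans _ cQ) // setSI ?subsetIl.
exists hT, f, a, t, t0; split; split=> //.
- by rewrite Ea nf.
- by rewrite Ea; apply: contra nta => cu; rewrite Ea (fix1 u) // morph1.
- rewrite Et nf //; split=> //; apply: mem_p_elt (pHall_pgroup sylg) _.
  by rewrite -Et.
- apply: contra nIt => Qt0; rewrite Et mem_morphim //.
  by rewrite mem_morphim.
by move=> x Qx; rewrite Et act // norm_conj_autE.
Qed.

(** [K] and [C] are pulled back along the injection [f]. As [Q] has index at most 2 in ['N_P(Q)],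
    the elements of ['N_P(Q)] outside [Q] have the form [t0 * q], whence the products [t * q] in the
    lemmas on the inverted action. *)
Lemma essential_structure :
  #|'N_P(Q) : Q| <= 2 /\
  exists (K C : {group gT}) t0,
    action_split P Q K C t0 /\ (abelian_shape P Q K C \/ exists j, quaternion_shape K C j).
Proof.
have [i2 [hT [f [a [t [t0 [[injf nQa oa ncQa] [[nQt p2t] a_t Nt0 nQt0 act]]]]]]]] := essential_inverted.
split=> //.
have pQh : 2.-group (f @* Q) := morphim_pgroup f pQ.
have preP (L : {group hT}) : L \subset f @* Q -> exists2 L0 : {group gT}, L0 \subset Q & f @* L0 = L.
  by move=> sL; exists (f @*^-1 L)%G; rewrite ?subsetIl //= morphpreK.
have iQh : #|f @* Q : f @* Q0| <= 2 by rewrite index_injm.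
have rkh (L : {group hT}) : L \subset f @* Q0 -> #|L : 'Phi(L)| <= 4.
  move=> sL; have [L0 sL0 EL] := preP L (subset_trans sL (morphimS f sQ0)).
  rewrite -EL -injm_Phi // index_injm ?Phi_sub //; apply: rk.
  by move: sL; rewrite -EL injmSK.
have [K sKQ fK] := preP [~: f @* Q, <[a]>]%G (inv_comm_sub nQa).
have [C sCQ fC] := preP 'C_(f @* Q)[a]%G (subsetIl _ _).
rewrite /= in fK fC.
have PhiK : f @* 'Phi(K) = 'Phi(f @* K) by rewrite injm_Phi.
have sPhi : 'Phi(K) \subset Q := subset_trans (Phi_sub _) sKQ.
have mem_f (L : {set gT}) x : L \subset Q -> x \in Q -> (f x \in f @* L) = (x \in L).
  move=> sLQ Qx; apply/idP/idP=> [|Lx]; last by rewrite mem_morphim.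
  by case/morphimP=> v Qv Lv /(injmP injf)-> .
have inQ q x : q \in Q -> x \in Q -> f x ^ (t * f q) = f (x ^ (t0 * q)).
  move=> Qq Qx; have Qxt : x ^ t0 \in Q by rewrite memJ_norm //; case/setIP: Nt0.
  by rewrite !conjgM act // -morphJ.
have QN n x : n \in 'N_P(Q) -> x \in Q -> x ^ n \in Q.
  by case/setIP=> _ nn Qx; rewrite memJ_norm.
have commE q x : q \in Q -> x \in Q -> [~ f x, t * f q] = f [~ x, t0 * q].
  move=> Qq Qx; have Qn : x ^ (t0 * q) \in Q by rewrite QN // groupM // (subsetP sQN).
  by rewrite !commgEl inQ // [RHS]morphM ?groupV // morphV.
have offQ n : n \in 'N_P(Q) -> n \notin Q -> exists2 q, q \in Q & n = t0 * q.
  move=> Nn nQn; exists (t0^-1 * n); last by rewrite mulKVg.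
  exact: (index_le2_mulVg sQN).
have normf (L : {group gT}) : L \subset Q -> t \in 'N(f @* L) -> t0 \in 'N(L).
  move=> sLQ nLt; rewrite inE; apply/subsetP=> _ /imsetP[x Lx ->].
  have Qx := subsetP sLQ x Lx; rewrite -mem_f ?QN // -act //.
  by rewrite memJ_norm // mem_morphim.
have nKt0 : t0 \in 'N(K) by apply: normf => //; rewrite fK inv_norm_comm.
have nKQ : K <| Q by rewrite -(injm_normal injf) // fK inv_comm_normal.
have mulKC : K * C = Q.
  apply: (injm_morphim_inj injf); rewrite ?mul_subG //.
  by rewrite morphimMl // fK fC inv_mul.
have actP n : n \in 'N_P(Q) -> n \notin Q -> exists2 k, k \in K & [~ k, n] \notin 'Phi(K).
  move=> Nn nQn; have [q Qq ->] := offQ n Nn nQn.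
  have [k0 Kk0] := inv_act pQh nQa oa ncQa nQt p2t a_t iQh rkh (mem_morphim f Qq Qq).
  rewrite -fK in Kk0 *; have [k Qk Kk Ek] := morphimP Kk0.
  rewrite Ek commE // -PhiK mem_f //; first by exists k.
  by rewrite commgEl groupM ?groupV // QN // groupM // (subsetP sQN).
exists K, C, t0; split.
  split=> //.
  - have [y Qy Ey] := cyclic_quotient_gen (inv_comm_normal nQa) (inv_cyclic_quotient pQh nQa oa ncQa iQh rkh).
    have [x Qx _ Ex] := morphimP Qy.
    have EQ : K * <[x]> = Q.
      apply: (injm_morphim_inj injf); rewrite ?mul_subG ?cycle_subG //.
      by rewrite morphimMl // fK morphim_cycle // -Ex.
    by rewrite -EQ quotientMidl quotient_cyclic ?cycle_cyclic.
  - apply/subsetP=> n Nn; have [Qn | nQn] := boolP (n \in Q).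
      exact: subsetP (normal_norm nKQ) n Qn.
    have [q Qq ->] := offQ n Nn nQn; rewrite groupM //.
    exact: subsetP (normal_norm nKQ) q Qq.
  - by apply: normf => //; rewrite fC inv_norm_cent.
  by rewrite -(injmSK injf) ?subIset ?sKQ // injmI // PhiK fK fC inv_cap.
have [abK | nabK] := boolP (abelian K); last first.
  right; have nabKh : ~~ abelian [~: f @* Q, <[a]>] by rewrite -fK injm_abelian.
  have [jh shape] := inv_quaternion pQh nQa oa ncQa nQt p2t a_t iQh rkh nabKh.
  case: shape; rewrite /reverse_coercion /= -fK -fC => oK oj Ecap EPhi cCK sq.
  have Kjh : jh \in f @* K.
    have sP : 'Phi(f @* K) \subset f @* K := Phi_sub _.
    by apply: (subsetP sP); rewrite EPhi cycle_id.
  have [j Qj Kj Ej] := morphimP Kjh; rewrite Ej in oj Ecap EPhi sq.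
  exists j; split.
  - by rewrite -oK card_injm.
  - by rewrite -oj order_injm.
  - apply: (injm_morphim_inj injf); rewrite ?subIset ?sKQ ?cycle_subG //.
    by rewrite injmI // Ecap morphim_cycle.
  - by apply: (injm_morphim_inj injf); rewrite ?cycle_subG // PhiK EPhi morphim_cycle.
  - by rewrite -(injm_cents injf).
  move=> k Kk nk; have Qk := subsetP sKQ k Kk; apply: (injmP injf); rewrite ?groupX //.
  rewrite morphX // sq ?mem_morphim //; apply: contra nk.
  by rewrite -morphim_cycle // mem_f ?cycle_subG.
left; have abKh : abelian [~: f @* Q, <[a]>] by rewrite -fK injm_abelian.
split=> //.
- apply: (injm_morphim_inj injf); rewrite ?subIset ?sKQ ?sub1G //.
  by rewrite injmI // fK fC inv_abelian_cap // morphim1.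
- rewrite -(injm_abelem injf) // => abe; rewrite fK in abe.
  have := inv_abelem pQh nQa oa ncQa nQt p2t a_t iQh rkh abe.
  by rewrite -fK -fC card_injm // injm_cents.
- rewrite -(injm_abelem injf) // fK => nab i Ci oi; have Qi := subsetP sCQ i Ci.
  have [||U [sU abU oU cU]] := inv_nabelem pQh nQa oa (i := f i) abKh nab.
  - by rewrite -fC mem_morphim.
  - by rewrite order_injm.
  rewrite -fK -PhiK in sU; have [U0 sU0 EU] := preP U (subset_trans sU (morphimS _ sPhi)).
  exists U0; rewrite -EU in sU abU oU cU; split.
  - by rewrite -(injmSK injf).
  - by rewrite -(injm_abelem injf).
  - by rewrite -(card_injm injf).
  by rewrite -sub1set -(injm_cents injf) ?sub1set // morphim_set1 // sub1set.
move=> n Nn nQn quad; rewrite -(injm_abelem injf) // fK.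
have [q Qq En] := offQ n Nn nQn.
apply: (inv_quadratic pQh nQa oa nQt a_t abKh (mem_morphim f Qq Qq)) => kh.
rewrite -fK => /morphimP[k Qk Kk ->].
have Qkn : [~ k, t0 * q] \in Q by rewrite commgEl groupM ?groupV // -En QN.
by rewrite commE // commE // -En quad // morph1.
Qed.
End EssentialTransfer.

Lemma aut_transvections_pgroup (gT : finGroupType) (Q : {group gT}) s1 s2 z1 z2 :
    2.-group Q -> s1 \in Aut Q -> s2 \in Aut Q -> z1 \in 'Z(Q) -> z2 \in 'Z(Q) ->
    (forall q, q \in Q -> q^-1 * s1 q \in <[z1]>) ->
    (forall q, q \in Q -> q^-1 * s2 q \in <[z2]>) ->
    s1 z1 = z1 -> s1 z2 = z2 -> s2 z2 = z2 ->
  2.-group (<[s1]> <*> <[s2]>).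
Proof.
move=> pQ A1 A2 Z1 Z2 c1 c2 f11 f12 f22.
have [hT [f [g [injf injg _ act gAut]]]] := holomorph Q.
have Q1 : z1 \in Q by case/setIP: Z1.
have Q2 : z2 \in Q by case/setIP: Z2.
have cf z u : z \in Q -> u \in Aut Q -> (forall q, q \in Q -> q^-1 * u q \in <[z]>) ->
    forall v, v \in f @* Q -> [~ v, g u] \in <[f z]>.
  move=> Qz Au cu _ /morphimP[q _ Qq ->]; rewrite commgEl act // -morphV // -morphM ?groupV ?Aut_closed //.
  by rewrite -morphim_cycle // mem_morphim ?cu // groupM ?groupV ?Aut_closed.
have sJA : <[s1]> <*> <[s2]> \subset Aut Q by rewrite join_subG !cycle_subG A1.
apply: odd_elt1_pgroup => b Jb odb; have Ab := subsetP sJA b Jb.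
have [_ fix1] := gAut b Ab; apply: fix1.
apply: (transvections_odd_cent (t := g s1) (t' := g s2) (z := f z1) (z' := f z2)).
- exact: morphim_pgroup.
- by rewrite -injm_center // mem_morphim.
- by rewrite -injm_center // mem_morphim.
- by have [] := gAut s1 A1.
- by have [] := gAut s2 A2.
- exact: cf.
- exact: cf.
- by rewrite act // f11.
- by rewrite act // f12.
- by rewrite act // f22.
- have -> : <[g s1]> <*> <[g s2]> = g @* (<[s1]> <*> <[s2]>).
    by rewrite morphimY ?cycle_subG // !morphim_cycle.
  by rewrite mem_morphim.
by rewrite order_injm.
Qed.

(** * Automorphism groups of proper subgroups *)

Section EssentialNoncyclicDer1.

Variables (gT : finGroupType) (P Q : {group gT}) (X : {group {perm gT}}).
Hypothesis pP : 2.-group P.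
Hypothesis bicP : exists x y, <[x]> * <[y]> = P.
Hypothesis ncA : ~~ cyclic P^`(1).
Hypothesis prQ : Q \proper P.
Hypothesis cQ : 'C_P(Q) \subset Q.
Hypothesis sXA : X \subset Aut Q.
Local Notation S := (conj_aut Q @* 'N_P(Q)).
Local Notation I := (conj_aut Q @* Q).
Hypothesis sylS : 2.-Sylow(X) S.
Hypothesis TI : forall x, x \in X -> x \notin S -> S :&: S :^ x \subset I.
Local Notation E := 'Ohm_1(P^`(1)).

Let sQP := proper_sub prQ.
Let pQ := pgroupS sQP pP.

(** An element [tau] of [E] outside [Q] acts on [Q] like a transvection whose centre [v] is central
    in [P]. Its conjugate by [x] outside [S] has centre [w = x v], and the two do not generate a
    2-group. So each moves the centre of the other, and [Q] is [<[v]> <*> <[w]>] times the common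
    fixed points, which [Ohm1_split_absurd] refutes. *)
Lemma essential_Ohm1_sub : X :!=: S -> E \subset Q.
Proof.
move=> neXS; apply/negPn/negP=> /subsetPn[tau Etau nQtau].
have sSX := pHall_sub sylS; have sSA := subset_trans sSX sXA.
have abE := abelem_Ohm1_der1 pP bicP; have cEE := abelem_abelian abE.
have nEP := normal_Ohm1_der1 P; have sEP := normal_sub nEP.
have oE := card_Ohm1_der1 pP bicP ncA.
have Ptau := subsetP sEP tau Etau.
have sZQ : 'Z(P) \subset Q.
  by apply: subset_trans cQ; rewrite setIS // centS.
have [v [Ev Zv ntv]] : exists v, [/\ v \in E, v \in 'Z(P) & v != 1].
  have : E :&: 'Z(P) != 1.
    by apply: meet_center_nil (pgroup_nil pP) nEP _; rewrite -cardG_gt1 oE.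
  by case/trivgPn=> v /setIP[Ev Zv] ntv; exists v.
have Qv := subsetP sZQ v Zv.
have ex2 d : d \in E -> d ^+ 2 = 1.
  by have [_ ex] := abelemP (isT : prime 2) abE; apply: ex.
have vv : v * v = 1 by rewrite -(expgS v 1) ex2.
have cvP q : q \in P -> commute v q by move=> Pq; apply/commute_sym; apply: (centerC Pq).
have ovE : #[v] = 2 by apply: (abelem_order_p abE).
have svE : <[v]> \subset E by rewrite cycle_subG.
have ivE : #|E : <[v]>| <= 2 by rewrite -divgS // oE -orderE ovE.
have vcyc u : u \in <[v]> -> u = 1 \/ u = v.
  by rewrite (cycle2g ovE) !inE => /orP[]/eqP->; [left|right].
have EQ d : d \in E -> d \in Q -> d \in <[v]>.
  move=> Ed Qd; apply/negPn/negP=> nvd.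
  have nvt : tau \notin <[v]> by apply: contra nQtau; apply: subsetP; rewrite cycle_subG.
  have := index_le2_mulVg svE ivE Ed Etau nvd nvt => /(subsetP (_ : <[v]> \subset Q)).
  by rewrite cycle_subG => /(_ Qv); rewrite groupMl ?groupV // (negPf nQtau).
have tauQ q : q \in P -> [~ q, tau] \in <[v]>.
  move=> Pq; have nEq := subsetP (normal_norm nEP) q Pq.
  have Etq : tau ^ q \in E by rewrite memJ_norm.
  have nvt : tau \notin <[v]> by apply: contra nQtau; apply: subsetP; rewrite cycle_subG.
  have nvtq : tau ^ q \notin <[v]>.
    apply: contra nvt => h; rewrite -(memJ_norm (x := q)) //.
    by rewrite inE -cycleJ /conjg cvP // mulKg.
  have := index_le2_mulVg svE ivE Etq Etau nvtq nvt.
  by rewrite -groupV invMg invgK -commgEl -invg_comm groupV.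
have Ntau : tau \in 'N_P(Q).
  rewrite inE Ptau inE; apply/subsetP=> _ /imsetP[q Qq ->].
  rewrite -[q ^ tau](mulKVg q) -commgEl groupM //.
  have := tauQ q (subsetP sQP q Qq); apply: subsetP; rewrite cycle_subG //.
have ntau : tau \in 'N(Q) by case/setIP: Ntau.
pose s := conj_aut Q tau.
have Ss : s \in S by rewrite mem_morphim.
have nIs : s \notin I by apply: contra nQtau; apply: (conj_aut_mem_inn prQ cQ Ntau).
have sE q : q \in Q -> s q = q ^ tau by move=> Qq; rewrite norm_conj_autE.
have [x Xx nSx] : exists2 g, g \in X & g \notin S.
  by apply/subsetPn; apply: contra neXS => sXS; rewrite eqEsubset sXS sSX.
have Ax := subsetP sXA x Xx; have As := subsetP sSA s Ss; have Xs := subsetP sSX s Ss.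
pose s' := s ^ x; pose w := x v.
have As' : s' \in Aut Q by rewrite groupJ.
have Qw : w \in Q by rewrite Aut_closed.
have s'E q : q \in Q -> s' (x q) = x (s q) by move=> Qq; rewrite /s' /conjg !permM permK.
have noJ : ~~ 2.-group (<[s]> <*> <[s']>).
  have nIX : X \subset 'N(I) := normal_norm (inn_normal prQ sXA sylS).
  apply: (TI_conj_npgroup sylS nIX TI Ss nIs Xx nSx).
  - by rewrite join_subG !cycle_subG Xs groupJ.
  - by rewrite (subsetP (joing_subl _ _)) ?cycle_id.
  by rewrite (subsetP (joing_subr _ _)) ?cycle_id.
have xM p q : p \in Q -> q \in Q -> x (p * q) = x p * x q.
  by move=> Qp Qq; rewrite -(autmE Ax) morphM.
have ZQv : v \in 'Z(Q) by rewrite inE Qv; move: Zv; rewrite inE => /andP[_]; apply: subsetP; rewrite centS.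
have ZQw : w \in 'Z(Q).
  rewrite inE Qw; apply/centP=> q Qq; have [r Qr ->] : exists2 r, r \in Q & q = x r.
    by exists ((x^-1)%g q); rewrite ?Aut_closed ?groupV // permKV.
  by rewrite /commute /w -!xM // cvP // (subsetP sQP).
have cs q : q \in Q -> q^-1 * s q \in <[v]>.
  by move=> Qq; rewrite sE // -commgEl tauQ // (subsetP sQP).
have cs' q : q \in Q -> q^-1 * s' q \in <[w]>.
  move=> Qq; have [r Qr ->] : exists2 r, r \in Q & q = x r.
    by exists ((x^-1)%g q); rewrite ?Aut_closed ?groupV // permKV.
  have -> : <[w]> = autm Ax @* <[v]> by rewrite morphim_cycle.
  have -> : (x r)^-1 * s' (x r) = autm Ax (r^-1 * s r).
    by rewrite s'E // morphM ?groupV ?Aut_closed // morphV.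
  by rewrite mem_morphim ?cs // groupM ?groupV ?Aut_closed.
have sv : s v = v by rewrite sE // /conjg cvP // mulKg.
have s'w : s' w = w by rewrite /w s'E // sv.
have ow : #[w] = 2 by rewrite -ovE; apply: (order_injm (injm_autm Ax)).
have ww : w * w = 1 by rewrite -(expgS w 1) -[X in _ ^+ X]ow expg_order.
have wcyc u : u \in <[w]> -> u = 1 \/ u = w.
  by rewrite (cycle2g ow) !inE => /orP[]/eqP->; [left|right].
have sw : s w = w * v.
  have [E1|E1] := vcyc _ (cs w Qw); last by rewrite -E1 mulKVg.
  case/negP: noJ; apply: (aut_transvections_pgroup pQ As As' ZQv ZQw) => //.
  by rewrite -[s w](mulKVg w) E1 mulg1.
have s'v : s' v = v * w.
  have [E1|E1] := wcyc _ (cs' v Qv); last by rewrite -E1 mulKVg.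
  case/negP: noJ; rewrite joingC; apply: (aut_transvections_pgroup pQ As' As ZQw ZQv) => //.
  by rewrite -[s' v](mulKVg v) E1 mulg1.
have vw : commute v w := cvP w (subsetP sQP w Qw).
have sM p q : p \in Q -> q \in Q -> s (p * q) = s p * s q.
  by move=> Qp Qq; rewrite -(autmE As) morphM.
have s'M p q : p \in Q -> q \in Q -> s' (p * q) = s' p * s' q.
  by move=> Qp Qq; rewrite -(autmE As') morphM.
pose C1 := [set q in Q | (s q == q) && (s' q == q)].
have gC1 : group_set C1.
  apply/group_setP; split.
    by rewrite inE group1 -(autmE As) -(autmE As') !morph1 eqxx.
  move=> p q; rewrite !inE => /and3P[Qp /eqP sp /eqP s'p] /and3P[Qq /eqP sq /eqP s'q].
  by rewrite groupM // sM // s'M // sp sq s'p s'q !eqxx.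
have sC1Q : C1 \subset Q by apply/subsetP=> q; rewrite inE => /andP[].
apply: (Ohm1_split_absurd pP bicP ncA (Q := Q) (C1 := Group gC1) (v := v) (w := w) (tau := tau)) => //.
- rewrite commgEl -sE // sw mulKg //.
- apply/subsetP=> q; rewrite inE => /and3P[Qq /eqP sq _]; apply/centP=> d Ed.
  have cvq := cvP q (subsetP sQP q Qq).
  have ctq : commute q tau by apply/commgP/conjg_fixP; rewrite -sE.
  have [Qd | nQd] := boolP (d \in <[v]>).
    by have [->|->] := vcyc d Qd; [apply: commute1 | apply: commute_sym].
  have nvt : tau \notin <[v]> by apply: contra nQtau; apply: subsetP; rewrite cycle_subG.
  have := index_le2_mulVg svE ivE Etau Ed nvt nQd => vt.
  rewrite -(mulKVg tau d); apply: commuteM => //.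
  by have [->|->] := vcyc _ vt; [apply: commute1 | apply: commute_sym].
- apply/subsetP=> q; rewrite inE => /andP[Qq _]; apply/cent1P.
  by case/setIP: ZQw => _ /centP; move=> /(_ q Qq) /commute_sym.
- apply/trivgP/subsetP=> d /setIP[Ed]; rewrite inE => /and3P[Qd _ /eqP s'd].
  have [->|Edv] := vcyc d (EQ d Ed Qd); first by rewrite inE.
  move: s'd; rewrite Edv s'v -[RHS]mulg1 => /mulgI w1.
  by move: ow; rewrite w1 order1.
- apply/subsetP=> q Qq.
  have [i [j [Eq1 Eq2]]] : exists i j, s q = q * v ^+ i /\ s' q = q * w ^+ j.
    have /cycleP[i Ei] := cs q Qq; have /cycleP[j Ej] := cs' q Qq.
    by exists i, j; rewrite -Ei -Ej !mulKVg.
  (* [s] multiplies [w] by [v], and [s'] multiplies [v] by [w], so [d] is moved by [v ^+ i] and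
     [w ^+ j] exactly as [q] is; these have square 1, hence [q * d] is fixed by both. *)
  pose d := w ^+ i * v ^+ j.
  have Qd : d \in Q by rewrite groupM ?groupX.
  have Jd : d \in <[v]> <*> <[w]>.
    have Jv : v \in <[v]> <*> <[w]> by rewrite (subsetP (joing_subl _ _)) ?cycle_id.
    have Jw : w \in <[v]> <*> <[w]> by rewrite (subsetP (joing_subr _ _)) ?cycle_id.
    by rewrite groupM ?groupX.
  have sX u n : u \in Q -> s (u ^+ n) = s u ^+ n by move=> Qu; rewrite -(autmE As) morphX.
  have s'X u n : u \in Q -> s' (u ^+ n) = s' u ^+ n by move=> Qu; rewrite -(autmE As') morphX.
  have vX n : v ^+ n * v ^+ n = 1 by rewrite -expgMn // vv expg1n.
  have wX n : w ^+ n * w ^+ n = 1 by rewrite -expgMn // ww expg1n.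
  have cvq := cvP q (subsetP sQP q Qq).
  have cwq : commute w q by case/setIP: ZQw => _ /centP; apply.
  have cdq : commute d q.
    by apply/commute_sym; apply: commuteM; apply/commuteX/commute_sym.
  have cvd : commute d (v ^+ i).
    by apply/commuteX/commute_sym/cvP; apply: (subsetP sQP).
  have cwd : commute d (w ^+ j).
    by apply/commuteX/commute_sym; case/setIP: ZQw => _ /centP; apply.
  have Esd : s d = d * v ^+ i.
    rewrite /d sM ?groupX // !sX // sv sw (expgMn _ (commute_sym vw)).
    by rewrite -!mulgA (commuteX2 _ _ (commute_refl v)).
  have Es'd : s' d = d * w ^+ j.
    rewrite /d s'M ?groupX // !s'X // s'w s'v (expgMn _ vw).
    by rewrite -!mulgA.
  have Cqd : q * d \in C1.
    rewrite inE groupM //= sM // s'M // Eq1 Eq2 Esd Es'd cvd cwd !mulgA.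
    by rewrite -(mulgA q (v ^+ i)) -(mulgA q (w ^+ j)) vX wX !mulg1 !eqxx.
  have -> : q = d^-1 * (q * d) by rewrite -cdq mulKg.
  by rewrite mem_mulg // groupV.
rewrite norm_joinEr; last first.
  by rewrite cents_norm // cent_cycle cycle_subG; apply/cent1P/commute_sym.
have := mul_cardG <[v]> <[w]>; rewrite -!orderE ovE ow => E4.
by rewrite -[4]/(2 * 2)%N E4 leq_pmulr // cardG_gt0.
Qed.

Lemma proper_essential_Sylow : X :=: S.
Proof.
apply/eqP/negPn/negP=> neXS; have sEQ := essential_Ohm1_sub neXS.
have sQ0 : Q :&: 'Phi(P) \subset Q := subsetIl _ _.
have rk (L : {group gT}) : L \subset Q :&: 'Phi(P) -> #|L : 'Phi(L)| <= 4.
  by rewrite subsetI => /andP[_]; apply: index_Phi_sub_Phi.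
have iQ0 := index_cap_Phi pP bicP ncA prQ.
have [i2 [K [C [t0 [split shape]]]]] :=
  essential_structure pP prQ cQ sXA sylS TI neXS sQ0 iQ0 rk.
have [sAQ | nsAQ] := boolP (P^`(1) \subset Q).
  exact: (essential_der1_nsub pP bicP ncA sQP i2 split sAQ shape).
case: shape => [shape | [j shape]].
  exact: (essential_abelian_absurd pP bicP ncA sQP cQ i2 sEQ split shape nsAQ).
exact: (essential_quaternion_absurd pP bicP ncA sQP i2 sEQ split shape nsAQ).
Qed.

End EssentialNoncyclicDer1.

(** If [P] acted trivially on [P' / 'Phi(P')], the commutator of two generators of [P] would be
    central modulo ['Phi(P')] and would generate this quotient, which is not cyclic. *)
Lemma ncycl_der1_comm_nsub (gT : finGroupType) (P : {group gT}) :
    2.-group P -> (exists x y, <[x]> * <[y]> = P) -> ~~ cyclic P^`(1) ->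
  ~~ ([~: P^`(1), P] \subset 'Phi(P^`(1))).
Proof.
move=> pP bicP ncA; apply/negP=> sAP; pose A := P^`(1)%G.
have [x [y defP]] := bicP.
have nMP : P \subset 'N('Phi(A)) by apply: (char_norm_trans (Phi_char A)); apply: der_norm.
have pA : 2.-group A := pgroupS (der_sub 1 P) pP.
have Px : x \in P by rewrite -defP (subsetP (mulG_subl _ _)) ?cycle_id.
have Py : y \in P by rewrite -defP (subsetP (mulG_subr _ _)) ?cycle_id.
have nx := subsetP nMP x Px; have ny := subsetP nMP y Py.
have nMA : A \subset 'N('Phi(A)) := subset_trans (der_sub 1 P) nMP.
have iA : #|A / 'Phi(A)| = 4 by rewrite card_quotient // index_Phi_der1.
have defPY : P :=: <[x]> <*> <[y]>.
  apply/eqP; rewrite eqEsubset join_subG !cycle_subG Px Py andbT.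
  by rewrite -{1}defP mul_subG ?joing_subl ?joing_subr.
have : cyclic (A / 'Phi(A)).
  rewrite quotient_der // {1}defPY quotientY ?cycle_subG // !quotient_cycle //.
  rewrite der1_joing_cycles ?cycle_cyclic // -!quotient_cycle // -quotientY ?cycle_subG //.
  rewrite -defPY -morphR //=.
  by apply: (subsetP (quotient_cents2r sAP)); rewrite mem_quotient // mem_commg.
move/(cyclic_abelem_prime (Phi_quotient_abelem pA)); rewrite -cardG_gt1 iA.
by move=> /(_ isT).
Qed.

(** [a] stabilizes a chain with factors of order 2 in [A / 'Phi(A)], so it acts trivially there, and
    so does [[~: P, <[a]>]]. The latter is all of [P], since its image in [P / 'Phi(P)], of order 4,
    has order at least 4. *)
Lemma odd_norm_cent_noncyclic_der1 (gT : finGroupType) (P : {group gT}) a :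
    2.-group P -> (exists x y, <[x]> * <[y]> = P) -> ~~ cyclic P^`(1) ->
    a \in 'N(P) -> odd #[a] ->
  a \in 'C(P).
Proof.
move=> pP bicP ncA nPa oa; apply/negPn/negP=> ncPa.
pose A := P^`(1)%G; pose M := 'Phi(A)%G.
have sAP : A \subset P := der_sub 1 P.
have pA : 2.-group A := pgroupS sAP pP.
have chM : M \char P := char_trans (Phi_char _) (der_char 1 _).
have nMP : P \subset 'N(M) := char_norm chM.
have nMA : A \subset 'N(M) := subset_trans sAP nMP.
have nMa : a \in 'N(M) by apply: (subsetP (char_norms chM)).
have nAa : a \in 'N(A) by apply: (subsetP (char_norms (der_char 1 P))).
have iA : #|A / M| = 4 by rewrite card_quotient // index_Phi_der1.
pose V := (A / M)%G; pose V1 := [~: V, P / M]%G; pose b := coset M a.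
have pV : 2.-group V := quotient_pgroup _ pA.
have nVP : P / M \subset 'N(V) by apply: quotient_norms; apply: der_norm.
have sVP : V \subset P / M := quotientS _ sAP.
have ntV : V :!=: 1 by rewrite -cardG_gt1 iA.
have prV1 : V1 \proper V.
  apply: (nil_comm_properl (pgroup_nil (quotient_pgroup M pP))) => //.
  by rewrite subsetI subxx.
have sV1V := proper_sub prV1.
have ntV1 : V1 :!=: 1.
  apply: contra (ncycl_der1_comm_nsub pP bicP ncA) => /eqP V11.
  by rewrite -quotient_cents2 //; apply/commG1P.
have oV1 : #|V1| = 2.
  have := cardSg sV1V; rewrite iA -[4]/(2 ^ 2)%N => /dvdn_pfactor[] // k le2 Ek.
  have := proper_card prV1; have := ntV1; rewrite -cardG_gt1 iA Ek.
  by case: k le2 {Ek} => [|[|[|]]].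
have nVb : b \in 'N(V) by rewrite (subsetP (quotient_norm _ _)) ?mem_quotient.
have nPb : b \in 'N(P / M) by rewrite (subsetP (quotient_norm _ _)) ?mem_quotient.
have nV1b : b \in 'N(V1) by rewrite -cycle_subG normsR // cycle_subG.
have ob : odd #[b] by apply: dvdn_odd (morph_order (coset_morphism M) nMa) oa.
have cVb : b \in 'C(V).
  have cyc (H N : {group coset_of M}) : N \subset H -> #|H : N| <= 2 -> b \in 'N(H) -> b \in 'N(N) ->
      H \subset 'N(N) -> [~: H, <[b]>] \subset N.
    move=> sNH i2 nHb nNb nNH; have := @comm_joing_sub _ H N b b nNH nNb nNb.
    rewrite (joing_idPl (subxx _)); apply=> h Hh; rewrite commgEl.
      have [Nh | nNh] := boolP (h \in N); first by rewrite groupM ?groupV ?memJ_norm.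
      by apply: (index_le2_mulVg sNH); rewrite ?memJ_norm.
    have [Nh | nNh] := boolP (h \in N); first by rewrite groupM ?groupV ?memJ_norm.
    by apply: (index_le2_mulVg sNH); rewrite ?memJ_norm.
  apply: (coprime_stable_chain (W := V1) (U := 1%G)) => //.
  - apply: cyc => //; first by have := divgS sV1V; rewrite iA oV1 => <-.
    by rewrite commg_norml.
  - apply: cyc => //; first exact: sub1G.
    + by rewrite indexg1 oV1.
    + by rewrite norm1 inE.
    by rewrite norm1 subsetT.
  by rewrite comm1G.
pose K := [~: P, <[a]>].
have cKV : K / M \subset 'C(V).
  rewrite /K quotientR ?cycle_subG // quotient_cycle //.
  have sbC : <[b]> \subset 'C(V) by rewrite cycle_subG.
  by rewrite (subset_trans (commgS _ sbC)) // commg_subr norms_cent.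
have ge4 := inv_index_cap_Phi pP nPa oa ncPa.
have sKP : K \subset P := inv_comm_sub nPa.
have defK : K = P.
  rewrite -[K]genGid; apply: Phi_nongen; apply/eqP; rewrite eqEcard join_subG Phi_sub sKP /=.
  have sPJ : 'Phi(P) \subset 'Phi(P) <*> K := joing_subl _ _.
  have nPhi : K \subset 'N('Phi(P)) := subset_trans sKP (gFnorm _ _).
  rewrite -(Lagrange (Phi_sub P)) -(Lagrange sPJ) leq_mul2l; apply/orP; right.
  rewrite (index_Phi_bicyclic pP bicP ncA) (leq_trans ge4) //.
  have EJ : 'Phi(P) <*> K = 'Phi(P) * K := norm_joinEr nPhi.
  by rewrite indexgI /= EJ -(indexMg 'Phi(P)%G).
case/negP: (ncycl_der1_comm_nsub pP bicP ncA).
by rewrite defK in cKV; rewrite -quotient_cents2 // centsC.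
Qed.

Lemma Aut_pgroup_noncyclic_der1 (gT : finGroupType) (P : {group gT}) :
  2.-group P -> (exists x y, <[x]> * <[y]> = P) -> ~~ cyclic P^`(1) -> 2.-group (Aut P).
Proof.
move=> pP [x [y defP]] ncA; have [hT [f [g [injf injg _ act gAut]]]] := holomorph P.
have Px : x \in P by rewrite -defP (subsetP (mulG_subl _ _)) ?cycle_id.
have Py : y \in P by rewrite -defP (subsetP (mulG_subr _ _)) ?cycle_id.
apply: odd_elt1_pgroup => b Ab odb; have [nb fix1] := gAut b Ab; apply: fix1.
apply: odd_norm_cent_noncyclic_der1; first exact: morphim_pgroup.
- exists (f x), (f y); rewrite -!morphim_cycle // -morphimMl ?cycle_subG //.
  by rewrite defP.
- by rewrite -morphim_der // (injm_cyclic injf) ?der_sub.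
- exact: nb.
by rewrite order_injm.
Qed.

Lemma essential_Sylow (gT : finGroupType) (P Q : {group gT}) (X : {group {perm gT}}) :
    2.-group P -> (exists x y, <[x]> * <[y]> = P) -> ~~ cyclic P^`(1) ->
    Q \subset P -> 'C_P(Q) \subset Q -> X \subset Aut Q ->
    2.-Sylow(X) (conj_aut Q @* 'N_P(Q)) ->
    (forall x, x \in X -> x \notin conj_aut Q @* 'N_P(Q) ->
       conj_aut Q @* 'N_P(Q) :&: (conj_aut Q @* 'N_P(Q)) :^ x \subset conj_aut Q @* Q) ->
  X :=: conj_aut Q @* 'N_P(Q).
Proof.
move=> pP bicP ncA sQP cQ sXA sylS TI.
have [prQ | ] := boolP (Q \proper P); first exact: (proper_essential_Sylow pP bicP ncA prQ cQ sXA sylS TI).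
rewrite properE sQP /= negbK => sPQ.
have defQ : Q :=: P by apply/eqP; rewrite eqEsubset sQP.
apply/esym; apply: (pHall_id sylS); apply: pgroupS sXA _.
by rewrite /= defQ Aut_pgroup_noncyclic_der1.
Qed.

Lemma Aut_imset (gT : finGroupType) (Q : {group gT}) a : a \in Aut Q -> [set a x | x in Q] = Q.
Proof. by move=> Aa; rewrite -[RHS](im_autm Aa) morphimEdom; apply: eq_imset. Qed.

(** * From automorphism groups to all morphisms of a saturated fusion system *)

Section SaturatedFusion.

Variables (gT : finGroupType) (P : {group gT}) (F : {set gT} -> pred (gT -> gT)).
Hypothesis pP : 2.-group P.
Hypothesis satF : saturated_fusion_system P 2 F.

Let fsF : fusion_system P F. Proof. by case: satF. Qed.

Lemma fusion_image_morphism (Q : {group gT}) f : F Q f ->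
  exists fm : {morphism Q >-> gT}, [/\ 'injm fm, forall x, fm x = f x & fm @* Q = f @: Q].
Proof.
case/(fs_hom fsF)=> _ _ fM finj _; exists (Morphism fM); split=> //.
  by apply/injmP.
by rewrite morphimEdom.
Qed.

Lemma fusion_id (Q : {group gT}) : Q \subset P -> F Q id.
Proof.
by move=> sQP; apply: (fs_ext fsF (fs_conj fsF sQP (group1 P))) => x _ /=; rewrite conjg1.
Qed.

Lemma mem_AutF (Q : {set gT}) a : (a \in AutF F Q) = (a \in Aut Q) && F Q (fun x => a x).
Proof. by rewrite in_set. Qed.

Lemma AutF_group_set (Q : {group gT}) : Q \subset P -> group_set (AutF F Q).
Proof.
move=> sQP; apply/group_setP; split.
  rewrite mem_AutF group1; apply: (fs_ext fsF (fusion_id sQP)) => x _ /=; by rewrite perm1.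
move=> a b; rewrite !mem_AutF => /andP[Aa Fa] /andP[Ab Fb]; rewrite groupM //=.
have := fs_comp fsF Fa; rewrite (Aut_imset Aa) => /(_ _ Fb) Fab.
by apply: (fs_ext fsF Fab) => x _ /=; rewrite permM.
Qed.

(* Sylow conjugation inside [AutF F (f @: Q)] moves the transport of [AutS P Q]
   along [f] into [AutS P (f @: Q)], which makes the whole normalizer extend. *)
Lemma fusion_extend_normalizer (Q Q1 : {group gT}) f :
    Q \subset P -> F Q f -> f @: Q = Q1 -> fully_normalized P F Q1 ->
  exists2 a, a \in AutF F Q1 & exists2 fb, F 'N_P(Q) fb & {in Q, forall x, fb x = a (f x)}.
Proof.
move=> sQP Ff Eim fnQ1.
have sQ1P : Q1 \subset P by rewrite -Eim; have [] := fs_hom fsF Ff.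
have [_ [norm ext]] := satF; have [fcQ1 sylQ1] := norm Q1 sQ1P fnQ1.
pose X1 := Group (AutF_group_set sQ1P).
have [fm [injf fmE Eim']] := fusion_image_morphism Ff.
have EQ1 : fm @* Q = Q1 by rewrite Eim' Eim.
pose T := Aut_isom injf (subxx Q) @* (conj_aut Q @* 'N_P(Q)).
have isoE b x : b \in Aut Q -> x \in Q -> Aut_isom injf (subxx Q) b (f x) = f (b x).
  by move=> Ab Qx; rewrite -!fmE Aut_isomE.
have pT : 2.-group T by rewrite !morphim_pgroup // (pgroupS (subsetIl _ _) pP).
have [h [Fh hf]] := fs_inv fsF Ff; rewrite Eim in Fh.
have imh : h @: Q1 = Q.
  rewrite -Eim -imset_comp; apply/setP=> x; apply/imsetP/idP=> [[y Qy ->] | Qx].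
    by rewrite /= hf.
  by exists x; rewrite //= hf.
have sTX : T \subset X1.
  apply/subsetP=> _ /morphimP[b Ab /morphimP[g ng /setIP[Pg _] Eb] ->].
  rewrite [_ \in _]mem_AutF /=; apply/andP; split.
    by rewrite -EQ1 Aut_Aut_isom.
  have F1 : F Q1 (fun y => h y ^ g).
    have := @fs_comp _ _ _ fsF Q1 h (fun x => x ^ g) Fh; rewrite imh; apply.
    exact: (fs_conj fsF).
  have im1 : [set h y ^ g | y in Q1] = Q.
    rewrite -[RHS](normP ng) -imh /conjugate -imset_comp //.
  have F2 := fs_comp fsF F1; rewrite im1 in F2; apply: (fs_ext fsF (F2 _ Ff)) => y.
  rewrite -Eim => /imsetP[x Qx ->] /=; rewrite hf // isoE // Eb norm_conj_autE //.
have [a Xa sTa] := Sylow_subJ (G := X1) sylQ1 sTX pT.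
have {}Xa : a^-1 \in X1 by rewrite groupV.
exists a^-1 => //; have := Xa; rewrite [_ \in _]mem_AutF => /andP[Aa Fa].
pose psi x := (a^-1)%g (f x).
have Fpsi : F Q psi.
  by have := @fs_comp _ _ _ fsF Q f (fun y => (a^-1)%g y) Ff; rewrite Eim; apply.
have imP : psi @: Q = Q1.
  by rewrite /psi (imset_comp (fun y => (a^-1)%g y) f) Eim (Aut_imset Aa).
have [fb [Ffb fbE]] : exists fb, F (Nphi P Q psi) fb /\ {in Q, fb =1 psi}.
  by apply: ext; rewrite ?imP.
exists fb; last exact: fbE.
suff <- : Nphi P Q psi = 'N_P(Q) by [].
apply/setP=> g; rewrite in_set andb_idr // => Ng.
have ng : g \in 'N(Q) by case/setIP: Ng.
have : Aut_isom injf (subxx Q) (conj_aut Q g) \in conj_aut Q1 @* 'N_P(Q1) :^ a.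
  apply: (subsetP sTa); rewrite mem_morphim ?Aut_aut //.
  by rewrite mem_morphim.
rewrite mem_conjg => /morphimP[k nk Nk Ek].
apply/existsP; exists k; rewrite imP Nk; apply/forallP=> x; apply/implyP=> Qx.
have Qpx : psi x \in Q1 by rewrite -imP imset_f.
rewrite /psi -/(psi x).
have -> : f (x ^ g) = Aut_isom injf (subxx Q) (conj_aut Q g) (f x).
  by rewrite isoE ?Aut_aut // norm_conj_autE.
by rewrite -(norm_conj_autE nk Qpx) -Ek /psi conjgE invgK !permM permKV.
Qed.

Section LargerConjugation.

Variable Q : {group gT}.
Hypothesis sQP : Q \subset P.
Hypothesis IH : forall (R : {group gT}) f, #|Q| < #|R| -> F R f ->
  exists2 g, g \in P & {in R, forall x, f x = x ^ g}.

Lemma normalizer_larger : Q :!=: P -> #|Q| < #|'N_P(Q)|.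
Proof.
move=> neQP; apply/proper_card/(nilpotent_proper_norm (pgroup_nil pP)).
by rewrite properEneq neQP.
Qed.

(** Pick an image [Q1] of [Q] with the largest normalizer. Up to an automorphism of [Q1], the map
    onto it extends to ['N_P(Q)], where it is conjugation by some [g]; so [Q1 = Q :^ g], and [Q] has
    a normalizer of the same order. *)
Lemma fully_normalized_larger : fully_normalized P F Q.
Proof.
have [defQ | neQP] := eqVneq (Q : {set gT}) P.
  by move=> Q' _; rewrite defQ (setIidPl (normG P)) subset_leq_card ?subsetIl.
pose h0 := [ffun x : gT => x].
have Fh0 : F Q h0 by apply: (fs_ext fsF (fusion_id sQP)) => x _; rewrite ffunE.
pose normQ (h : {ffun gT -> gT}) := #|'N_P(h @: Q)|.
case: (@arg_maxnP _ h0 (fun h : {ffun gT -> gT} => F Q h) normQ Fh0) => h1 Fh1 max1.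
have maxF k : F Q k -> #|'N_P(k @: Q)| <= #|'N_P(h1 @: Q)|.
  move=> Fk; have Fk' : F Q [ffun x => k x] by apply: (fs_ext fsF Fk) => x _; rewrite ffunE.
  have := max1 _ Fk'; congr (#|'N_P(_)| <= _).
  by apply: eq_imset => x; rewrite ffunE.
have [fm [_ _ Eim]] := fusion_image_morphism Fh1.
pose Q1 := (fm @* Q)%G; have Eim1 : h1 @: Q = Q1 by rewrite /= Eim.
have fnQ1 : fully_normalized P F Q1.
  move=> Q' [k [Fk <-]]; have := @fs_comp _ _ _ fsF Q h1 k Fh1; rewrite Eim1 => /(_ Fk) Fkh.
  by have := maxF _ Fkh; rewrite (imset_comp k h1) Eim1.
have [a Xa [fb Ffb fbE]] := fusion_extend_normalizer sQP Fh1 Eim1 fnQ1.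
have [g Pg gE] := @IH 'N_P(Q)%G fb (normalizer_larger neQP) Ffb.
have sQN : Q \subset 'N_P(Q) by rewrite subsetI sQP normG.
have EQ1 : Q1 :=: Q :^ g.
  have := Xa; rewrite mem_AutF => /andP[Aa _].
  have := Aut_imset Aa; rewrite -{1}Eim1 -imset_comp => <-; rewrite /conjugate.
  by apply: eq_in_imset => x Qx /=; rewrite -fbE // gE // (subsetP sQN).
move=> Q' [k [Fk <-]]; apply: leq_trans (maxF k Fk) _.
by rewrite Eim1 EQ1 normJ -{1}(conjGid Pg) -conjIg cardJg.
Qed.

Lemma AutF_larger_conj a n : a \in AutF F Q -> n \in Nphi P Q (fun x => a x) -> n \notin Q ->
  a \in conj_aut Q @* 'N_P(Q).
Proof.
rewrite mem_AutF => /andP[Aa Fa] Nn nQn.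
have [_ [norm ext]] := satF.
have [fcQ _] := norm Q sQP fully_normalized_larger.
have [fb [Ffb fbE]] : exists fb, F (Nphi P Q (fun x => a x)) fb /\ {in Q, fb =1 (fun x => a x)}.
  by apply: ext; rewrite ?Aut_imset.
have [gN _ _ _ _] := fs_hom fsF Ffb.
have sQN : Q \subset Nphi P Q (fun x => a x).
  apply/subsetP=> q Qq; rewrite in_set inE (subsetP sQP) ?(subsetP (normG Q)) //=.
  apply/existsP; exists (a q); rewrite Aut_imset //.
  have Qaq : a q \in Q by rewrite Aut_closed.
  rewrite inE (subsetP sQP) // (subsetP (normG Q)) //=.
  apply/forallP=> x; apply/implyP=> Qx; rewrite -(autmE Aa) /=.
  by rewrite morphJ.
have prQ : #|Q| < #|Group gN|.
  by apply: proper_card; rewrite properE sQN; apply/subsetPn; exists n.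
have [g Pg gE] := @IH (Group gN) fb prQ Ffb.
have aE x : x \in Q -> a x = x ^ g.
  by move=> Qx; rewrite -gE ?(subsetP sQN) // fbE.
have nQg : g \in 'N(Q).
  rewrite inE; apply/subsetP=> _ /imsetP[x Qx ->].
  by rewrite -aE // Aut_closed.
suff -> : a = conj_aut Q g by rewrite mem_morphim // inE Pg.
apply: (eq_Aut Aa (Aut_aut _ _)) => x Qx; rewrite aE //.
by rewrite -[RHS]/(conj_aut Q g x) norm_conj_autE.
Qed.

(** If ['C_P(Q)] is not inside [Q], any of its elements outside [Q] enlarges every extension domain,
    and [AutF_larger_conj] concludes. Otherwise the same lemma proves the intersection hypothesis of
    [essential_Sylow]: an [s] in [S :&: S :^ a] outside [Inn(Q)] yields such an element for [a]. *)
Lemma AutF_larger (bicP : exists x y, <[x]> * <[y]> = P) (ncA : ~~ cyclic P^`(1)) :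
  AutF F Q = conj_aut Q @* 'N_P(Q).
Proof.
have [_ [norm _]] := satF.
have [_ sylQ] := norm Q sQP fully_normalized_larger.
pose X := Group (AutF_group_set sQP); rewrite -[LHS]/(gval X).
have autX b : b \in X -> b \in Aut Q by rewrite [_ \in _]mem_AutF => /andP[].
have [cQ | /subsetPn[n /setIP[Pn cn] nQn]] := boolP ('C_P(Q) \subset Q); last first.
  apply/eqP; rewrite eqEsubset (pHall_sub sylQ) andbT; apply/subsetP=> a Xa.
  apply: (AutF_larger_conj (n := n)) => //; have Aa := autX a Xa.
  have nn : n \in 'N(Q) by rewrite (subsetP (cent_sub Q)).
  rewrite in_set inE Pn nn /=; apply/existsP; exists 1; rewrite group1 /=.
  apply/forallP=> x; apply/implyP=> Qx; rewrite conjg1.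
  by rewrite (conjg_fixP _) //; apply/commgP/commute_sym; apply: (centP cn).
apply: essential_Sylow => //; first by apply/subsetP.
move=> a Xa nSa; apply/subsetP=> s /setIP[/morphimP[g ng Ng Eg]].
rewrite mem_conjg => /morphimP[n nn Nn En].
have Aa := autX a Xa.
have Es : s = conj_aut Q n ^ a by rewrite -En conjgKV.
have [Qn | nQn] := boolP (n \in Q).
  by rewrite Es conj_aut_conjg // mem_morphim ?(subsetP (normG Q)) ?Aut_closed.
case/negP: nSa; apply: (AutF_larger_conj (n := n)) => //.
rewrite in_set Nn; apply/existsP; exists g; rewrite Aut_imset // Ng.
apply/forallP=> x; apply/implyP=> Qx; have Qax : a x \in Q by rewrite Aut_closed.
by rewrite -(norm_conj_autE nn Qx) -(norm_conj_autE ng Qax) -Eg Es conjgE !permM permK.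
Qed.

End LargerConjugation.

(** Followed by an automorphism [a] of the image, [f] extends to ['N_P(Q)], where induction makes it
    a conjugation, and [a] is itself one by [AutF_larger]. For [Q = P] the normalizer does not grow,
    but there [f] is an automorphism. *)
Lemma fusion_conj (bicP : exists x y, <[x]> * <[y]> = P) (ncA : ~~ cyclic P^`(1))
    (Q : {group gT}) f : F Q f -> exists2 g, g \in P & {in Q, forall x, f x = x ^ g}.
Proof.
have [m] := ubnP (#|P| - #|Q|); elim: m Q f => // m IHm Q f /ltnSE leQ Ff.
have [_ sQP _ _ sfP] := fs_hom fsF Ff.
have larger (Q1 : {group gT}) : #|Q1| = #|Q| -> forall (R : {group gT}) h, #|Q1| < #|R| -> F R h ->
    exists2 g, g \in P & {in R, forall x, h x = x ^ g}.
  move=> oQ1 R h ltR Fh; apply: IHm => //; apply: leq_trans leQ.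
  have [_ sRP _ _ _] := fs_hom fsF Fh.
  by rewrite ltn_sub2l -?oQ1 // (leq_trans ltR) ?subset_leq_card.
have [fm [injf fmE Eim]] := fusion_image_morphism Ff.
pose Q1 := (fm @* Q)%G; have Eim1 : f @: Q = Q1 by rewrite /= Eim.
have oQ1 : #|Q1| = #|Q| by rewrite /= card_injm.
have sQ1P : Q1 \subset P by rewrite -Eim1.
have fnQ1 := fully_normalized_larger sQ1P (larger Q1 oQ1).
have autQ1 := AutF_larger sQ1P (larger Q1 oQ1) bicP ncA.
have autC b : b \in AutF F Q1 -> exists2 g, g \in P & {in Q1, forall x, b x = x ^ g}.
  rewrite autQ1 => /morphimP[g ng /setIP[Pg _] ->]; exists g => // x Qx.
  exact: norm_conj_autE.
have [defQ | neQP] := eqVneq (Q : {set gT}) P.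
  have imQ : fm @* Q = Q.
    have sPQ : P \subset Q by rewrite -defQ.
    by apply/eqP; rewrite eqEcard oQ1 leqnn andbT (subset_trans sQ1P sPQ).
  have bE : {in Q, f =1 aut injf imQ} by move=> x Qx; rewrite autE // fmE.
  have : aut injf imQ \in AutF F Q by rewrite mem_AutF Aut_aut (fs_ext fsF Ff bE).
  rewrite (AutF_larger sQP (larger Q erefl) bicP ncA) => /morphimP[g ng /setIP[Pg _] Eg].
  by exists g => // x Qx; rewrite bE // Eg norm_conj_autE.
have Qf x : x \in Q -> f x \in Q1 by move=> Qx; rewrite -Eim1 imset_f.
have [a Xa [fb Ffb fbE]] := fusion_extend_normalizer sQP Ff Eim1 fnQ1.
have [u Pu uE] := autC a Xa.
have [g Pg gE] := larger Q erefl 'N_P(Q)%G fb (normalizer_larger sQP neQP) Ffb.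
exists (g * u^-1); first by rewrite groupM ?groupV.
have sQN : Q \subset 'N_P(Q) by rewrite subsetI sQP normG.
move=> x Qx; rewrite conjgM -gE ?(subsetP sQN) // fbE // uE ?Qf //.
by rewrite conjgK.
Qed.

End SaturatedFusion.

Theorem theorem4p16 (gT : finGroupType) (P : {group gT})
    (F : {set gT} -> pred (gT -> gT)) :
  2.-group P -> bicyclic P -> ~~ cyclic (P^`(1))%g ->
  saturated_fusion_system P 2 F -> nilpotent_fusion P F.
Proof.
move=> pP [x [y defP]] ncA satF Q sQP f; have [fsF _] := satF.
apply/idP/existsP=> [Ff | [g /andP[Pg /forallP fE]]].
  have [g Pg gE] := fusion_conj pP satF (ex_intro _ x (ex_intro _ y (esym defP))) ncA Ff.
  by exists g; rewrite Pg; apply/forallP=> z; apply/implyP=> Qz; apply/eqP/gE.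
apply: (fs_ext fsF (fs_conj fsF sQP Pg)) => z Qz /=.
by have := fE z; rewrite Qz => /eqP.
Qed.
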